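(* Let $\mathfrak q$ be a finite-dimensional Lie algebra over $\mathbb K$ with $[\mathfrak q,\mathfrak q]\ne0$, and let $n\ge 2$. Suppose that $\mathcal S(\mathfrak q)^{\mathfrak q}=\mathbb K[F_1,\dots,F_m]$ is a graded polynomial ring (with $F_i$ homogeneous and algebraically independent), where $m=\mathrm{ind}\,\mathfrak q$, and that the set $\Omega_{\mathfrak q^*}=\{\xi\in\mathfrak q^*: d_\xi F_1\wedge\dots\wedge d_\xi F_m\neq0\}$ is big. Let $p\in\mathbb K[t]$ be a monic polynomial of degree $n$ with $p(0)\ne0$. Then $$\psi_p(\mathcal Z(\widehat{\mathfrak q},t))=\mathcal Z(p,p+t).$$
   Context: $\mathbb K$ is an algebraically closed field of characteristic $0$. $\mathcal S(\mathfrak q)=\mathbb K[\mathfrak q^*]$ is the symmetric algebra with its Lie–Poisson bracket, and $\mathcal S(\mathfrak q)^{\mathfrak q}=\{H:\{H,x\}=0\ \forall x\in\mathfrak q\}$. $\mathrm{ind}\,\mathfrak q=\min_{\gamma\in\mathfrak q^*}\dim\mathfrak q_\gamma$ with $\mathfrak q_\gamma=\{x\in\mathfrak q:\gamma([x,\mathfrak q])=0\}$. An open subset of $\mathfrak q^*$ is big if its complement contains no divisors (i.e. has codimension at least $2$). For a monic $p\in\mathbb K[t]$ of degree $n$, the Lie algebra $\mathfrak q[t]/(p)=\mathfrak q\otimes(\mathbb K[t]/(p))$ is identified, as a vector space, with $\mathbb W=\mathfrak q\cdot 1\oplus\mathfrak q\bar t\oplus\dots\oplus\mathfrak q\bar t^{\,n-1}$,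 $\bar t=t+(p)$. The resulting bracket on $\mathbb W$ is $[\,,]_p$, the corresponding Lie–Poisson bracket on $\mathcal S(\mathbb W)$ is $\{\,,\}_p$, and $\mathcal Z_p\subset\mathcal S(\mathbb W)$ is the Poisson centre of $(\mathcal S(\mathbb W),\{\,,\}_p)$. If $p_1\ne p_2$ are monic of degree $n$ with $\deg(p_1-p_2)\le 1$, then $\mathcal Z(p_1,p_2)\subset\mathcal S(\mathbb W)$ denotes the subalgebra generated by all $\mathcal Z_{ap_1+(1-a)p_2}$, $a\in\mathbb K$. $\psi_p:\mathcal S(\mathfrak q[t])\to\mathcal S(\mathbb W)$ is the algebra homomorphism extending the quotient map $\mathfrak q[t]\to\mathfrak q[t]/(p)\cong\mathbb W$. $\mathcal Z(\widehat{\mathfrak q},t^{-1})=\mathcal S(t^{-1}\mathfrak q[t^{-1}])^{\mathfrak q[t]}$, where $\mathcal S(t^{-1}\mathfrak q[t^{-1}])$ is regarded as the quotient of $\mathcal S(\mathfrak q[t,t^{-1}])$ by the ideal generated by $\mathfrak q[t]$; that is, it consists of the $Y\in\mathcal S(t^{-1}\mathfrak q[t^{-1}])$ with $\{xt^k,Y\}\in\mathfrak q[t]\,\mathcal S(\mathfrak q[t,t^{-1}])$ for all $x\in\mathfrak q$, $k\ge0$. $\mathcal Z(\widehat{\mathfrak q},t)\subset\mathcal S(t\mathfrak q[t])$ is its image under the algebra isomorphism $\mathcal S(t^{-1}\mathfrak q[t^{-1}])\to\mathcal S(t\mathfrak q[t])$, $xt^{-k}\mapsto xt^k$. *)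

(* Defs.v *)
From HB Require Import structures.
From mathcomp Require Import all_boot all_order all_algebra.
From mathcomp Require Import finmap.
From mathcomp.multinomials Require Import monalg.

Set Implicit Arguments.
Unset Strict Implicit.
Unset Printing Implicit Defensive.

Import GRing.Theory.

Local Open Scope ring_scope.

(* A vector space with basis I has symmetric algebra K[x_i : i in I], the
   monoid algebra of {cmonom I}. It is wrapped, with locked products, because
   unification diverges on those of {malg K[{cmonom I}]}. *)
Record sym (K : fieldType) (I : choiceType) : Type :=
  Sym { sym_val :> {malg K[{cmonom I}]} }.

HB.lock Definition sym_mul (K : fieldType) (I : choiceType) (f g : sym K I) :
  sym K I := Sym (sym_val f * sym_val g).

HB.lock Definition sym_scale (K : fieldType) (I : choiceType) (c : K)
  (f : sym K I) : sym K I := Sym (c *: sym_val f).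

Section SymmetricAlgebraStructure.
Variables (K : fieldType) (I : choiceType).
Implicit Types f g h : sym K I.

HB.instance Definition _ := [isNew for @sym_val K I].
HB.instance Definition _ := [Choice of sym K I by <:].

Let add f g := Sym (sym_val f + sym_val g).
Let opp f := Sym (- sym_val f).
Let one : sym K I := Sym 1.

Let addA : associative add.
Proof. by move=> f g h; apply: val_inj; apply: addrA. Qed.
Let addC : commutative add.
Proof. by move=> f g; apply: val_inj; apply: addrC. Qed.
Let add0 : left_id (Sym 0) add.
Proof. by move=> f; apply: val_inj; apply: add0r. Qed.
Let addN : left_inverse (Sym 0) opp add.
Proof. by move=> f; apply: val_inj; apply: addNr. Qed.

HB.instance Definition _ :=
  GRing.isZmodule.Build (sym K I) addA addC add0 addN.

Let mulA : associative (@sym_mul K I).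
Proof. by move=> f g h; rewrite unlock; apply: val_inj; apply: mulrA. Qed.
Let mulC : commutative (@sym_mul K I).
Proof. by move=> f g; rewrite unlock; apply: val_inj; apply: mulrC. Qed.
Let mul1 : left_id one (@sym_mul K I).
Proof. by move=> f; rewrite unlock; apply: val_inj; apply: mul1r. Qed.
Let mulDl : left_distributive (@sym_mul K I) +%R.
Proof. by move=> f g h; rewrite unlock; apply: val_inj; apply: mulrDl. Qed.
Let one_neq0 : one != 0.
Proof. exact: (oner_neq0 {malg K[{cmonom I}]}). Qed.

HB.instance Definition _ :=
  GRing.Zmodule_isComNzRing.Build (sym K I) mulA mulC mul1 mulDl one_neq0.

Let scaleA a b f : sym_scale a (sym_scale b f) = sym_scale (a * b) f.
Proof. by rewrite unlock; apply: val_inj; apply: scalerA. Qed.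
Let scale1 : left_id 1 (@sym_scale K I).
Proof. by move=> f; rewrite unlock; apply: val_inj; apply: scale1r. Qed.
Let scaleDr : right_distributive (@sym_scale K I) +%R.
Proof. by move=> c f g; rewrite unlock; apply: val_inj; apply: scalerDr. Qed.
Let scaleDl f : {morph (@sym_scale K I)^~ f : a b / a + b}.
Proof. by move=> a b; rewrite unlock; apply: val_inj; apply: scalerDl. Qed.

HB.instance Definition _ := GRing.Zmodule_isLmodule.Build K (sym K I)
  scaleA scale1 scaleDr scaleDl.

Lemma sym_valD f g : sym_val (f + g) = sym_val f + sym_val g.
Proof. by []. Qed.

Lemma sym_valZ c f : sym_val (c *: f) = c *: sym_val f.
Proof. by rewrite [c *: f]/GRing.scale /= unlock. Qed.

Lemma sym_val1 : sym_val (1 : sym K I) = 1.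
Proof. by []. Qed.

Lemma sym_valM f g : sym_val (f * g) = sym_val f * sym_val g.
Proof. by rewrite [f * g]/GRing.mul /= unlock. Qed.

Let scaleAl (c : K) f g : c *: (f * g) = (c *: f) * g.
Proof.
by apply: val_inj; rewrite /= sym_valZ !sym_valM sym_valZ; apply: scalerAl.
Qed.

HB.instance Definition _ :=
  GRing.Lmodule_isLalgebra.Build K (sym K I) scaleAl.
HB.instance Definition _ := GRing.Lalgebra_isComAlgebra.Build K (sym K I).

End SymmetricAlgebraStructure.

HB.lock Definition gen (K : fieldType) (I : choiceType) (i : I) : sym K I :=
  Sym << ucm i >>.

Section PolynomialAlgebra.
Variables (K : fieldType) (I : choiceType).

Definition subst (A : comAlgType K) (v : I -> A) (f : sym K I) : A :=
  \sum_(u <- msupp f) f@_u *: \prod_(i <- finsupp u) v i ^+ u i.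

Definition vars (f : sym K I) : {fset I} :=
  (\bigcup_(u <- msupp f) finsupp u)%fset.

Definition pderiv (i : I) (f : sym K I) : sym K I :=
  \sum_(u <- msupp f) (f@_u *+ u i) *: Sym << divcm u (ucm i) >>.

Definition homogeneous (f : sym K I) : Prop :=
  exists k : nat, forall u, u \in msupp f -> mdeg u = k.

(* The biderivation extending the bracket b of the basis vectors; b i j is a
   linear form. *)
Definition poisson (b : I -> I -> sym K I) (f g : sym K I) : sym K I :=
  \sum_(i <- vars f) \sum_(j <- vars g) pderiv i f * pderiv j g * b i j.

End PolynomialAlgebra.

Section Subalgebras.
Variables (K : fieldType) (A : comAlgType K).

Definition is_subalgebra (B : A -> Prop) : Prop :=
  [/\ B 1,
      forall c x y, B x -> B y -> B (c *: x + y)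
    & forall x y, B x -> B y -> B (x * y)].

Definition generated_subalgebra (X : A -> Prop) (y : A) : Prop :=
  forall B : A -> Prop,
    is_subalgebra B -> (forall x, X x -> B x) -> B y.

Definition generated_ideal (X : A -> Prop) (y : A) : Prop :=
  exists (r : nat) (a g : 'I_r -> A),
    (forall i, X (g i)) /\ y = \sum_(i < r) a i * g i.

Definition alg_independent (m : nat) (F : 'I_m -> A) : Prop :=
  forall P : sym K 'I_m, subst F P = 0 -> P = 0.

End Subalgebras.

Record lieBracket (K : fieldType) (q : vectType K) := LieBracket {
  lie :> q -> q -> q;
  lie_linear_l : forall y, linear (lie^~ y);
  lie_linear_r : forall x, linear (lie x);
  lie_alternating : forall x, lie x x = 0;
  lie_jacobi : forall x y z,
    lie x (lie y z) + lie y (lie z x) + lie z (lie x y) = 0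
}.

Section LieAlgebra.
Variables (K : fieldType) (q : vectType K) (br : lieBracket q).

Definition basisv (i : 'I_(\dim {:q})) : q := (vbasis {:q})`_i.

Definition dualv : vectType K := 'Hom(q, K^o).

Definition stabiliser (g : dualv) : {vspace q} :=
  lker (linfun (fun x : q => linfun (fun y : q => g (br x y) : K^o) : dualv)).

Lemma stabiliserP (g : dualv) (x : q) :
  reflect (forall y, g (br x y) = 0) (x \in stabiliser g).
Proof.
have lr z : linear (fun y : q => g (br z y) : K^o).
  by move=> c u v; rewrite lie_linear_r linearP.
have inE z y : (linfun (fun y : q => g (br z y) : K^o) : dualv) y = g (br z y).
  pose h := GRing.isLinear.Build K q K^o _ _ (lr z).
  pose H : {linear q -> K^o} := HB.pack (fun y : q => g (br z y) : K^o) h.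
  exact: (lfunE H).
have ll : linear (fun z : q => linfun (fun y : q => g (br z y) : K^o) : dualv).
  move=> c u v; apply/lfunP => y.
  by rewrite add_lfunE scale_lfunE !inE lie_linear_l linearP.
pose h := GRing.isLinear.Build K q dualv _ _ ll.
pose H : {linear q -> dualv} :=
  HB.pack (fun z : q => linfun (fun y : q => g (br z y) : K^o) : dualv) h.
rewrite /stabiliser memv_ker (lfunE H) /=.
apply: (iffP eqP) => [/lfunP e y | e]; first by rewrite -inE e lfunE.
by apply/lfunP => y; rewrite inE e lfunE.
Qed.

Definition is_index (m : nat) : Prop :=
  (exists g : dualv, \dim (stabiliser g) = m) /\
  (forall g : dualv, (m <= \dim (stabiliser g))%N).

Notation Sq := (sym K 'I_(\dim {:q})).

Definition linform (x : q) : Sq := \sum_i coord (vbasis {:q}) i x *: gen K i.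

Definition poissonq : Sq -> Sq -> Sq :=
  poisson (fun i j => linform (br (basisv i) (basisv j))).

Definition lie_invariant (H : Sq) : Prop :=
  forall x : q, poissonq H (linform x) = 0.

Definition evalq (f : Sq) (xi : dualv) : K :=
  subst (fun i => xi (basisv i) : K^o) f.

Definition differential (f : Sq) (xi : dualv) (eta : dualv) : K :=
  \sum_i evalq (pderiv i f) xi * eta (basisv i).

(* d_xi F_1 /\ ... /\ d_xi F_m as an alternating m-form on q^*. *)
Definition wedge_differentials (m : nat) (F : 'I_m -> Sq) (xi : dualv)
    (eta : 'I_m -> dualv) : K :=
  \det (\matrix_(i < m, j < m) differential (F i) xi (eta j)).

Definition Omega (m : nat) (F : 'I_m -> Sq) (xi : dualv) : Prop :=
  exists eta : 'I_m -> dualv, wedge_differentials F xi eta != 0.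

(* Divisors of the affine space q^* are the zero loci of nonconstant
   polynomials. *)
Definition is_big (U : dualv -> Prop) : Prop :=
  forall f : Sq, ~ (exists c : K, f = c%:A) ->
    ~ (forall xi : dualv, evalq f xi = 0 -> ~ U xi).

(* Basis vectors of q (x) A are indexed by pairs of a basis vector of q and a
   basis vector a of A; tens x a stands for x (x) a. *)
Definition tens (J : choiceType) (x : q) (a : J) :
    sym K ('I_(\dim {:q}) * J)%type :=
  \sum_i coord (vbasis {:q}) i x *: gen K (i, a).

Notation Sloop := (sym K ('I_(\dim {:q}) * int)%type).
Notation Scurrent := (sym K ('I_(\dim {:q}) * nat)%type).

Definition poisson_loop : Sloop -> Sloop -> Sloop :=
  poisson (fun a b => tens (br (basisv a.1) (basisv b.1)) (a.2 + b.2)).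

Definition in_current (f : Sloop) : Prop :=
  exists (x : q) (k : nat), f = tens x k%:Z.

Definition in_Sneg (Y : Sloop) : Prop := forall a, a \in vars Y -> a.2 < 0.

Definition Zhat_neg (Y : Sloop) : Prop :=
  in_Sneg Y /\
  forall (x : q) (k : nat),
    generated_ideal in_current (poisson_loop (tens x k%:Z) Y).

(* Restricted to S(t^-1 q[t^-1]), this is the isomorphism onto S(t q[t])
   sending x t^-k to x t^k. *)
Definition flip : Sloop -> Scurrent := subst (fun a => gen K (a.1, `|a.2|%N)).

Definition Zhat_pos (Y : Scurrent) : Prop :=
  exists Y', Zhat_neg Y' /\ Y = flip Y'.

Section Quotient.
Variable n : nat.

(* (i, s) stands for the vector (basisv i) tbar^s, s < n. *)
Notation SW := (sym K ('I_(\dim {:q}) * 'I_n)%type).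

Definition tens_mod (p : {poly K}) (x : q) (k : nat) : SW :=
  \sum_(s < n) ('X^k %% p)`_s *: tens x s.

Definition poisson_mod (p : {poly K}) : SW -> SW -> SW :=
  poisson (fun a b : (_ * 'I_n)%type =>
    tens_mod p (br (basisv a.1) (basisv b.1)) (a.2 + b.2)%N).

Definition Zcentre (p : {poly K}) (Y : SW) : Prop :=
  forall G, poisson_mod p Y G = 0.

Definition Zpair (p1 p2 : {poly K}) : SW -> Prop :=
  generated_subalgebra
    (fun Y => exists a : K, Zcentre (a *: p1 + (1 - a) *: p2) Y).

Definition psi (p : {poly K}) : Scurrent -> SW :=
  subst (fun a => tens_mod p (basisv a.1) a.2).

End Quotient.
End LieAlgebra.

(* Main.v *)
Require Import Defs.
From HB Require Import structures.
From mathcomp Require Import all_boot all_order all_algebra.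
From mathcomp Require Import finmap.
From mathcomp.multinomials Require Import monalg.
From mathcomp Require Import boolp ring zify.
From Stdlib Require Import Classical.

Set Implicit Arguments.
Unset Strict Implicit.
Unset Printing Implicit Defensive.

Import GRing.Theory.

Local Open Scope ring_scope.

(** Both sides are described by generators, and the generators are compared by
   interpolation along the pencil p_c = p + cX.

   Write x_i for the basis of q. Fix nodes a_0, a_1, ... in K, put
   N_j = (X - a_0)...(X - a_(j-1)), and consider the generic current
   xi_i = sum_(j<n) x_ij N_j with independent variables x_ij, its Newton
   coordinates. An invariant F of q gives a polynomial F(xi) in X whose Newton
   coordinates F^[j] are killed by the vector fields
   D_(y,l) : x_ij |-> j-th Newton coordinate of N_l [y, x_i](xi).
   The main step (newton_generated) is that, for every choice of the nodes,
   repeated or not, the polynomials in the layers j < n killed by all D_(y,l)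
   are the polynomials in the F_i^[j], j < n. It goes by induction on n. The
   fields D_(y,n-1) move only the top layer eta = x_(.,n-1), by the value of
   [y, x_i] at zeta = xi(a_(n-1)). If a_(n-1) is a new node, zeta can replace
   eta as a coordinate, the fields become those of the Lie algebra q, and their
   invariants are the polynomials in the F_i(zeta). If a_(n-1) is a repeated
   node, zeta lives on the lower layers, and the invariants are the polynomials
   in zeta and in the linear forms ell_i = d_zeta F_i (eta) (Efield_invariants).
   In both cases these elements equal F_i^[n-1] up to a nonzero scalar and a
   polynomial in the lower layers, and they are algebraically independent over
   the lower layers. So the coefficients of an invariant, written as a
   polynomial in the F_i^[n-1], are invariants with fewer layers.

   Efield_invariants is where the index and the bigness enter. At a regular point
   the kernel of the matrix of the brackets is spanned by the m differentials of
   the F_i, so that an invariant H(xi, eta) depends on eta only through ell.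
   Solving ell = dF . eta by Cramer's rule, with the help of a constant matrix N,
   shows that det(dF N)^d times the component of degree d of H is a polynomial in
   xi and ell. Bigness says that no prime divides all the minors det(dF N), hence
   by unique factorisation the power of the minor can be cancelled.

   With all the nodes equal to 0, the fields D_(y,k) are the action of y t^k on
   S(t^-1 q[t^-1]), with x_ij standing for x_i t^(-j-1) (psi_Zhat_pos). Hence the
   left-hand side is generated by the coefficients of the F_i(sum_j x_i t^(j+1) u^j)
   as polynomials in u. With the roots of p as nodes, q[t]/(p) has the generic
   element Phi_p(x) = sum_(s<n) x t^s d_s, where d_s is the quotient of p by
   X^(s+1): it satisfies {y t^k, Phi_p(x)} = X^k Phi_p([y,x]) modulo p. Therefore
   the values of F_i(Phi_p) at the roots of p are in Z_p (Zcentre_root), and Z_p is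
   generated by the Newton coordinates of the F_i(Phi_p) (Zcentre_generated).

   The polynomial E_i = X Phi_(p_c)(x_i) - x_i p_c is the same for all c
   (X_takiff_gen). For v <> 0 choose c with p_c(v) = 0; then, F being homogeneous
   of degree d, F(E)(v) = v^d F(Phi_(p_c))(v) is in Z_(p_c). Conversely X is
   invertible modulo p_c because p_c(0) = p(0) <> 0, so that Z_(p_c) is generated
   by combinations of coefficients of the F_i(E), and interpolation recovers these
   coefficients from the values at the v <> 0. Finally u^(n-1) E_i(1/u) is congruent
   to u^n p(1/u) times sum_j x_i t^(j+1) u^j modulo every power of u. The factor
   u^n p(1/u) has constant term 1, so the coefficients of the F_i(E) and the
   generators of the left-hand side span the same spaces
   (pencil_values_coefficients). *)

(** * Monomials, evaluation and derivations of symmetric algebras *)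

(** Monomials and their coefficients are locked, for the same reason as the
   product of the algebra: unification diverges on their bodies. All later
   computations with monomials go through the lemmas below. *)
HB.lock Definition mono (K : fieldType) (I : choiceType) (u : {cmonom I}) :
  sym K I := Sym << u >>.

HB.lock Definition scoef (K : fieldType) (I : choiceType) (u : {cmonom I})
  (f : sym K I) : K := f@_u.

Section Monomials.
Variables (K : fieldType) (I : choiceType).
Implicit Types (u w : {cmonom I}) (f g : sym K I).
Local Notation mono := (@mono K I).

Lemma mono1 : mono (onecm I) = 1.
Proof. by rewrite unlock; apply: val_inj. Qed.

Lemma monoM u w : mono (mulcm u w) = mono u * mono w.
Proof.
rewrite unlock; apply: val_inj; rewrite /= sym_valM /= malgM_def fgmulUU.
by rewrite mulr1.
Qed.

Lemma gen_mono i : gen K i = mono (ucm i).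
Proof. by rewrite !unlock. Qed.

Lemma scoefD u f g : scoef u (f + g) = scoef u f + scoef u g.
Proof. by rewrite unlock sym_valD mcoeffD. Qed.

Lemma scoef0 u : scoef u 0 = 0 :> K.
Proof. by rewrite unlock mcoeff0. Qed.

Lemma scoefZ u k f : scoef u (k *: f) = k * scoef u f.
Proof. by rewrite unlock sym_valZ; apply: mcoeffZ. Qed.

Lemma scoef_mono u w : scoef w (mono u) = (u == w)%:R.
Proof. by rewrite !unlock; apply: mcoeffU1. Qed.

Lemma scoefP f g : (forall u, scoef u f = scoef u g) -> f = g.
Proof.
by move=> e; apply: val_inj; apply/malgP => u; move: (e u); rewrite unlock.
Qed.

Lemma scoef_supp u f : (u \in msupp f) = (scoef u f != 0).
Proof. by rewrite unlock mcoeff_neq0. Qed.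

Lemma msupp_mono u : msupp (mono u) = [fset u]%fset.
Proof.
apply/fsetP => w; apply: etrans (scoef_supp w (mono u)) _.
apply: etrans (esym (in_fset1 u w)); rewrite scoef_mono (eq_sym u).
by case: (w == u); rewrite ?oner_neq0 ?eqxx.
Qed.

Lemma scoef_sum (T : Type) (r : seq T) (P : pred T) (F : T -> sym K I) u :
  scoef u (\sum_(t <- r | P t) F t) = \sum_(t <- r | P t) scoef u (F t).
Proof. by elim/big_rec2: _ => [|t x y _ <-]; rewrite ?scoef0 ?scoefD. Qed.

Lemma sym_monoE f : f = \sum_(u <- msupp f) scoef u f *: mono u.
Proof.
apply: scoefP => w; rewrite scoef_sum.
under eq_bigr => u _ do rewrite scoefZ scoef_mono.
have [wf | wf] := boolP (w \in msupp f).
  rewrite (big_fsetD1 w wf) /= eqxx mulr1 big_seq big1 ?addr0 // => u.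
  by rewrite !inE => /andP[/negbTE-> _]; rewrite mulr0.
rewrite big_seq big1 => [| u uf]; first by apply/eqP; rewrite -[_ == _]negbK -scoef_supp.
by rewrite (negbTE (memPn wf _ uf)) mulr0.
Qed.

Lemma ucm_divK u i : i \in finsupp u -> mulcm (ucm i) (divcm u (ucm i)) = u.
Proof.
move=> iu; apply/eqP/cmP => j; rewrite mulcmE divcmE ucmE.
case: (eqVneq i j) => [<- | _]; last by rewrite subn0.
by rewrite subnKC // lt0n cmE_neq0.
Qed.

Lemma monomial_ind (P : {cmonom I} -> Prop) :
  P (onecm I) -> (forall i u, P u -> P (mulcm (ucm i) u)) -> forall u, P u.
Proof.
move=> P1 PM u; have [n] := ubnP (mdeg u).
elim: n u => // n IHn u; rewrite ltnS => le_un.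
have [u0|[i iu]] := fset_0Vmem (finsupp u : {fset I}).
  suff -> : u = onecm I by [].
  by apply/eqP/cmP => i; apply/eqP; rewrite onecmE cmE_eq0 u0.
rewrite -(ucm_divK iu); apply/PM/IHn.
apply: leq_trans le_un; rewrite -{2}(ucm_divK iu) [mdeg (mulcm _ _)]mdegM mdegU.
by rewrite add1n.
Qed.

(** Closure under multiplication by one variable at a time is enough, because a
   monomial is a product of variables; most identities are proved this way. *)
Lemma sym_ind (P : sym K I -> Prop) :
  (forall k : K, P k%:A) -> (forall f g, P f -> P g -> P (f + g)) ->
  (forall i f, P f -> P (gen K i * f)) -> forall f, P f.
Proof.
move=> PC PD PM f; rewrite (sym_monoE f).
elim/big_rec: _ => [| u g _ Pg]; first by rewrite -(scale0r 1).
apply: PD => //; move: (scoef u f) => k.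
elim/monomial_ind: u => [|i u Pu]; first by rewrite mono1.
by rewrite monoM -gen_mono scalerAr; apply: PM.
Qed.

End Monomials.

Section Evaluation.
Variables (K : fieldType) (I : choiceType) (A : comNzRingType).
Implicit Types (f g : sym K I) (u w : {cmonom I}).

Definition monev (v : I -> A) (u : {cmonom I}) : A :=
  \prod_(i <- finsupp u) v i ^+ u i.

Lemma monevEw (v : I -> A) (u : {cmonom I}) (Z : {fset I}) :
  (finsupp u `<=` Z)%fset -> monev v u = \prod_(i <- Z) v i ^+ u i.
Proof.
move=> uZ; rewrite /monev (big_fset_incl _ uZ) // => i iZ.
by rewrite -cmE_eq0 => /eqP->; rewrite expr0.
Qed.

Lemma monevM (v : I -> A) u w : monev v (mulcm u w) = monev v u * monev v w.
Proof.
rewrite (monevEw v (fsubset_refl _)).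
rewrite (_ : finsupp (mulcm u w) = finsupp u `|` finsupp w)%fset; last exact: mdomD.
rewrite (monevEw v (fsubsetUl (finsupp u) (finsupp w))).
rewrite (monevEw v (fsubsetUr (finsupp u) (finsupp w))) -big_split /=.
by apply: eq_bigr => i _; rewrite mulcmE exprD.
Qed.

Lemma monev1 (v : I -> A) : monev v (onecm I) = 1.
Proof. by rewrite /monev (_ : finsupp _ = fset0) ?big_nil //; apply: mdom1. Qed.

Lemma monevU (v : I -> A) i : monev v (ucm i) = v i.
Proof.
rewrite /monev (_ : finsupp (ucm i) = [fset i]%fset); last exact: mdomU.
by rewrite big_seq_fset1 ucmE eqxx expr1.
Qed.

(** The scalars act through a ring morphism c and not through an algebra
   structure, so that the target can be a ring of polynomials over an algebra,
   or K itself. *)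
Definition ev (c : {rmorphism K -> A}) (v : I -> A) (f : sym K I) : A :=
  \sum_(u <- msupp f) c (scoef u f) * monev v u.

Section Fixed.
Variables (c : {rmorphism K -> A}) (v : I -> A).

Lemma evEw f (Z : {fset {cmonom I}}) : (msupp f `<=` Z)%fset ->
  ev c v f = \sum_(u <- Z) c (scoef u f) * monev v u.
Proof.
move=> fZ; rewrite /ev (big_fset_incl _ fZ) // => u uZ.
by rewrite scoef_supp negbK => /eqP->; rewrite rmorph0 mul0r.
Qed.

Lemma evD f g : ev c v (f + g) = ev c v f + ev c v g.
Proof.
set Z := (msupp f `|` msupp g `|` msupp (f + g)%R)%fset.
have fZ : (msupp f `<=` Z)%fset by rewrite /Z -fsetUA fsubsetUl.
have gZ : (msupp g `<=` Z)%fset by rewrite /Z [X in (X `|` _)%fset]fsetUC -fsetUA fsubsetUl.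
have hZ : (msupp (f + g)%R `<=` Z)%fset by rewrite /Z fsubsetUr.
rewrite (evEw fZ) (evEw gZ) (evEw hZ) -big_split /=.
by apply: eq_bigr => u _; rewrite scoefD rmorphD mulrDl.
Qed.

Lemma evZ k f : ev c v (k *: f) = c k * ev c v f.
Proof.
set Z := (msupp f `|` msupp (k *: f)%R)%fset.
have fZ : (msupp f `<=` Z)%fset by rewrite /Z fsubsetUl.
have hZ : (msupp (k *: f)%R `<=` Z)%fset by rewrite /Z fsubsetUr.
rewrite (evEw fZ) (evEw hZ) mulr_sumr.
by apply: eq_bigr => u _; rewrite scoefZ rmorphM mulrA.
Qed.

Lemma ev_mono u : ev c v (mono K u) = monev v u.
Proof.
by rewrite /ev msupp_mono big_seq_fset1 scoef_mono eqxx rmorph1 mul1r.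
Qed.

Lemma evC k : ev c v k%:A = c k.
Proof. by rewrite evZ -mono1 ev_mono monev1 mulr1. Qed.

Lemma ev_gen i : ev c v (gen K i) = v i.
Proof. by rewrite gen_mono ev_mono monevU. Qed.

Lemma ev_monoM u f : ev c v (mono K u * f) = monev v u * ev c v f.
Proof.
rewrite (sym_monoE f) mulr_sumr.
elim/big_rec2: _ => [|w g h _ IH]; first by rewrite -(scale0r 0) evZ rmorph0 mul0r mulr0.
by rewrite !evD mulrDr IH -scalerAr !evZ -monoM !ev_mono monevM mulrCA.
Qed.

Lemma evM f g : ev c v (f * g) = ev c v f * ev c v g.
Proof.
rewrite (sym_monoE f) mulr_suml.
elim/big_rec2: _ => [|w h h' _ IH]; first by rewrite -(scale0r 0) evZ rmorph0 !mul0r.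
by rewrite !evD mulrDl IH -scalerAl !evZ ev_monoM ev_mono mulrA.
Qed.

Lemma ev_is_zmod_morphism : zmod_morphism (ev c v).
Proof. by move=> f g; rewrite evD -scaleN1r evZ rmorphN1 mulN1r. Qed.

Lemma ev_is_monoid_morphism : monoid_morphism (ev c v).
Proof. by split=> [|f g]; [rewrite -(scale1r 1) evC rmorph1 | rewrite evM]. Qed.

HB.instance Definition _ :=
  GRing.isZmodMorphism.Build (sym K I) A (ev c v) ev_is_zmod_morphism.
HB.instance Definition _ :=
  GRing.isMonoidMorphism.Build (sym K I) A (ev c v) ev_is_monoid_morphism.

End Fixed.

Lemma rmorph_sym_ext (f1 f2 : {rmorphism sym K I -> A}) :
  (forall k, f1 k%:A = f2 k%:A) -> (forall i, f1 (gen K i) = f2 (gen K i)) ->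
  f1 =1 f2.
Proof.
move=> eC eG; elim/sym_ind => [//|f g ef eg|i f ef].
  by rewrite !rmorphD ef eg.
by rewrite !rmorphM eG ef.
Qed.

Lemma eq_ev (c1 c2 : {rmorphism K -> A}) (v1 v2 : I -> A) :
  c1 =1 c2 -> v1 =1 v2 -> ev c1 v1 =1 ev c2 v2.
Proof.
by move=> ec eg; apply: rmorph_sym_ext => [k|i] /=; rewrite ?evC ?ev_gen.
Qed.

End Evaluation.

Lemma rmorph_ev (K : fieldType) (I : choiceType) (A B : comNzRingType)
    (c : {rmorphism K -> A}) (v : I -> A) (phi : {rmorphism A -> B}) f :
  phi (ev c v f) = ev (phi \o c) (phi \o v) f.
Proof.
by move: f; apply: (rmorph_sym_ext (f1 := phi \o ev c v)) => [k|i] /=;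
  rewrite ?evC ?ev_gen.
Qed.

Section Substitution.
Variables (K : fieldType) (I : choiceType).
Implicit Types f g : sym K I.

Lemma subst_ev (A : comAlgType K) (v : I -> A) f :
  subst v f = ev (GRing.in_alg A) v f.
Proof.
by apply: eq_bigr => u _; rewrite /= mulr_algl; congr (_ *: _); rewrite unlock.
Qed.

Variables (A : comAlgType K) (v : I -> A).

Lemma subst_gen i : subst v (gen K i) = v i.
Proof. by rewrite subst_ev ev_gen. Qed.

Lemma subst_is_zmod_morphism : zmod_morphism (subst v).
Proof. by move=> f g; rewrite !subst_ev rmorphB. Qed.

Lemma subst_is_monoid_morphism : monoid_morphism (subst v).
Proof. by split=> [|f g]; rewrite !subst_ev (rmorph1, rmorphM). Qed.

Lemma subst_is_scalable : scalable (subst v).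
Proof. by move=> k f; rewrite !subst_ev evZ /= mulr_algl. Qed.

HB.instance Definition _ :=
  GRing.isZmodMorphism.Build (sym K I) A (subst v) subst_is_zmod_morphism.
HB.instance Definition _ :=
  GRing.isMonoidMorphism.Build (sym K I) A (subst v) subst_is_monoid_morphism.
HB.instance Definition _ :=
  GRing.isScalable.Build K (sym K I) A *:%R (subst v) subst_is_scalable.

End Substitution.

Lemma subst_ext (K : fieldType) (I : choiceType) (A : comAlgType K)
    (f1 f2 : {lrmorphism sym K I -> A}) :
  (forall i, f1 (gen K i) = f2 (gen K i)) -> f1 =1 f2.
Proof. apply: rmorph_sym_ext => k.
exact: etrans (rmorph_alg f1 k) (esym (rmorph_alg f2 k)).
Qed.

Lemma eq_subst (K : fieldType) (I : choiceType) (A : comAlgType K)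
    (v1 v2 : I -> A) : v1 =1 v2 -> subst v1 =1 subst v2.
Proof. by move=> e; apply: subst_ext => i /=; rewrite !subst_gen. Qed.

Lemma subst_id (K : fieldType) (I : choiceType) (f : sym K I) :
  subst (@gen K I) f = f.
Proof.
by move: f; apply: (subst_ext (f2 := idfun)) => i /=; rewrite !subst_gen.
Qed.

Lemma lrmorph_subst (K : fieldType) (I : choiceType) (A B : comAlgType K)
    (v : I -> A) (phi : {lrmorphism A -> B}) f :
  phi (subst v f) = subst (phi \o v) f.
Proof.
by move: f; apply: (subst_ext (f1 := phi \o subst v)) => i /=; rewrite !subst_gen.
Qed.

Lemma rmorph_subst (K : fieldType) (I : choiceType) (A : comAlgType K)
    (B : comNzRingType) (v : I -> A) (phi : {rmorphism A -> B}) f :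
  phi (subst v f) = ev (phi \o GRing.in_alg A) (phi \o v) f.
Proof. by rewrite subst_ev rmorph_ev. Qed.

Section Derivatives.
Variables (K : fieldType) (I : choiceType).
Implicit Types f g : sym K I.

Definition dmono (i : I) (u : {cmonom I}) : sym K I :=
  mono K (divcm u (ucm i)) *+ u i.

Lemma pderivE i f : pderiv i f = \sum_(u <- msupp f) scoef u f *: dmono i u.
Proof.
apply: eq_bigr => u _; rewrite /dmono -scaler_nat scalerA mulr_natr.
by rewrite !unlock.
Qed.

Lemma pderivEw i f (Z : {fset {cmonom I}}) : (msupp f `<=` Z)%fset ->
  pderiv i f = \sum_(u <- Z) scoef u f *: dmono i u.
Proof.
move=> fZ; rewrite pderivE (big_fset_incl _ fZ) // => u uZ.
by rewrite scoef_supp negbK => /eqP->; rewrite scale0r.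
Qed.

Lemma pderiv_is_linear i : linear (pderiv i : sym K I -> sym K I).
Proof.
move=> k f g; set Z := (msupp f `|` msupp g `|` msupp (k *: f + g)%R)%fset.
have fZ : (msupp f `<=` Z)%fset by rewrite /Z -fsetUA fsubsetUl.
have gZ : (msupp g `<=` Z)%fset by rewrite /Z [X in (X `|` _)%fset]fsetUC -fsetUA fsubsetUl.
have hZ : (msupp (k *: f + g)%R `<=` Z)%fset by rewrite /Z fsubsetUr.
rewrite (pderivEw _ fZ) (pderivEw _ gZ) (pderivEw _ hZ) scaler_sumr -big_split /=.
by apply: eq_bigr => u _; rewrite scoefD scoefZ scalerDl scalerA.
Qed.

HB.instance Definition _ i :=
  GRing.isLinear.Build K (sym K I) (sym K I) *:%R (pderiv i) (pderiv_is_linear i).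

Lemma pderiv_mono i u : pderiv i (mono K u) = dmono i u.
Proof.
by rewrite pderivE msupp_mono big_seq_fset1 scoef_mono eqxx scale1r.
Qed.

Lemma dmono_genM i j u :
  dmono i (mulcm (ucm j) u) = (j == i)%:R * mono K u + gen K j * dmono i u.
Proof.
rewrite /dmono mulcmE ucmE mulrnDr mulrnAr gen_mono -monoM.
have [->|ne_ji] := eqVneq j i.
  rewrite mul1r /= mulr1n; congr (_ + _).
    congr mono; apply/eqP/cmP => k; rewrite divcmE mulcmE ucmE.
    by rewrite addKn.
  have [->|ui] := eqVneq (u i) 0%N; first by rewrite !mulr0n.
  congr (mono _ _ *+ _); rewrite ucm_divK; last by rewrite -cmE_neq0.
  by apply/eqP/cmP => k; rewrite divcmE mulcmE ucmE addKn.
rewrite /= mulr0n mul0r !add0r; congr (mono _ _ *+ _).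
apply/eqP/cmP => k; rewrite divcmE !mulcmE divcmE !ucmE.
case: (eqVneq i k) => [<-|_]; last by rewrite !subn0.
by rewrite (negbTE ne_ji) !add0n.
Qed.

Lemma pderiv_genM i j f :
  pderiv i (gen K j * f) = (j == i)%:R * f + gen K j * pderiv i f.
Proof.
rewrite (sym_monoE f) mulr_sumr !linear_sum !mulr_sumr -big_split /=.
apply: eq_bigr => u _; move: (scoef u f) => k.
rewrite -!scalerAr !linearZ /= -scalerAr -scalerDr; congr (_ *: _).
by rewrite gen_mono -monoM !pderiv_mono dmono_genM gen_mono.
Qed.

Lemma pderivC i (k : K) : pderiv i (k%:A : sym K I) = 0.
Proof. by rewrite linearZ /= -mono1 pderiv_mono /dmono onecmE mulr0n scaler0. Qed.

Lemma pderivM i f g : pderiv i (f * g) = pderiv i f * g + f * pderiv i g.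
Proof.
elim/sym_ind: f => [k|f h IHf IHh|j f IHf].
- by rewrite pderivC mul0r add0r -!scalerAl !mul1r linearZ.
- by rewrite mulrDl !linearD /= IHf IHh !mulrDl addrACA.
- by rewrite -!mulrA !pderiv_genM IHf !mulrDr !mulrDl !mulrA addrA.
Qed.

End Derivatives.

Section Derivations.
Variables (K : fieldType) (I : choiceType).
Implicit Types f g : sym K I.

Lemma pderiv_gen i j : pderiv i (gen K j) = (j == i)%:R :> sym K I.
Proof.
by rewrite -[gen K j]mulr1 pderiv_genM -(scale1r 1) pderivC mulr0 addr0 scale1r mulr1.
Qed.

Lemma pderiv_vars i f : i \notin vars f -> pderiv i f = 0.
Proof.
move=> nif; rewrite pderivE big_seq big1 // => u uf.
suff ui : u i = 0%N by rewrite /dmono ui mulr0n scaler0.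
apply/eqP; rewrite cmE_eq0; apply: contra nif => iu.
by apply/bigfcupP; exists u; rewrite ?uf.
Qed.

Lemma sum_varsE (A : pzRingType) (e : {additive sym K I -> A}) (w : I -> A) f
    (Z : {fset I}) : (vars f `<=` Z)%fset ->
  \sum_(i <- vars f) e (pderiv i f) * w i = \sum_(i <- Z) e (pderiv i f) * w i.
Proof.
move=> fZ; rewrite (big_fset_incl _ fZ) // => i iZ /pderiv_vars->.
by rewrite raddf0 mul0r.
Qed.

(** The derivation over the ring morphism e with value w i at the variable i.
   All vector fields and all Hamiltonian fields below have this form. *)
Definition dext (A : comNzRingType) (e : {rmorphism sym K I -> A}) (w : I -> A)
    f : A := \sum_(i <- vars f) e (pderiv i f) * w i.

Section Dext.
Variables (A : comNzRingType) (e : {rmorphism sym K I -> A}) (w : I -> A).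

Lemma dextEw f (Z : {fset I}) : (vars f `<=` Z)%fset ->
  dext e w f = \sum_(i <- Z) e (pderiv i f) * w i.
Proof. exact: sum_varsE. Qed.

Lemma dextD f g : dext e w (f + g) = dext e w f + dext e w g.
Proof.
set Z := (vars f `|` vars g `|` vars (f + g)%R)%fset.
have fZ : (vars f `<=` Z)%fset by rewrite /Z -fsetUA fsubsetUl.
have gZ : (vars g `<=` Z)%fset by rewrite /Z [X in (X `|` _)%fset]fsetUC -fsetUA fsubsetUl.
have hZ : (vars (f + g)%R `<=` Z)%fset by rewrite /Z fsubsetUr.
rewrite (dextEw fZ) (dextEw gZ) (dextEw hZ) -big_split /=.
by apply: eq_bigr => i _; rewrite linearD rmorphD mulrDl.
Qed.

Lemma dextM f g : dext e w (f * g) = dext e w f * e g + e f * dext e w g.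
Proof.
set Z := (vars f `|` vars g `|` vars (f * g)%R)%fset.
have fZ : (vars f `<=` Z)%fset by rewrite /Z -fsetUA fsubsetUl.
have gZ : (vars g `<=` Z)%fset by rewrite /Z [X in (X `|` _)%fset]fsetUC -fsetUA fsubsetUl.
have hZ : (vars (f * g)%R `<=` Z)%fset by rewrite /Z fsubsetUr.
rewrite (dextEw fZ) (dextEw gZ) (dextEw hZ) mulr_suml mulr_sumr -big_split /=.
apply: eq_bigr => i _; rewrite pderivM rmorphD !rmorphM mulrDl -!mulrA.
by rewrite [e g * _]mulrC.
Qed.

Lemma dextC (k : K) : dext e w k%:A = 0.
Proof. by rewrite /dext big1 // => i _; rewrite pderivC rmorph0 mul0r. Qed.

Lemma dextZ k f : dext e w (k *: f) = e k%:A * dext e w f.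
Proof. by rewrite -{1}[f]mul1r scalerAl dextM dextC mul0r add0r. Qed.

Lemma dext_gen i : dext e w (gen K i) = w i.
Proof.
rewrite (@dextEw _ (i |` vars (gen K i))%fset); last exact: fsubsetUr.
rewrite (big_fsetD1 i) ?fset1U1 //= pderiv_gen eqxx rmorph1 mul1r.
rewrite big_seq big1 ?addr0 // => j; rewrite in_fsetD1 => /andP[ne_ji _].
by rewrite pderiv_gen eq_sym (negbTE ne_ji) rmorph0 mul0r.
Qed.

Lemma dext0 : dext e w 0 = 0.
Proof. by rewrite -(scale0r 1) dextC. Qed.

Lemma dext_unique (d : sym K I -> A) :
  (forall f g, d (f + g) = d f + d g) -> (forall k : K, d k%:A = 0) ->
  (forall i f, d (gen K i * f) = w i * e f + e (gen K i) * d f) ->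
  d =1 dext e w.
Proof.
move=> dD dC dM; elim/sym_ind => [k|f g IHf IHg|i f IHf].
- by rewrite dC dextC.
- by rewrite dD dextD IHf IHg.
- by rewrite dM dextM dext_gen IHf.
Qed.

End Dext.

End Derivations.

(** The chain rule: both sides are derivations over the same morphism, and they
   agree on the variables. *)
Lemma derivation_ev (K : fieldType) (I : choiceType) (A B : comNzRingType)
    (c : {rmorphism K -> A}) (v : I -> A) (e : {rmorphism A -> B}) (d : A -> B) :
  (forall x y, d (x + y) = d x + d y) ->
  (forall x y, d (x * y) = d x * e y + e x * d y) ->
  (forall k, d (c k) = 0) -> forall f : sym K I,
  d (ev c v f) = dext (e \o ev c v) (d \o v) f.
Proof.
move=> dD dM dC; apply: dext_unique => [f g|k|i f] /=.
- by rewrite rmorphD dD.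
- by rewrite evC dC.
- by rewrite rmorphM /= dM ev_gen.
Qed.

(** * Polynomials and their values *)

Section Kronecker.
Variables (K : fieldType) (I : choiceType).
Implicit Types f g : sym K I.

Definition kron_exp (B : nat) (Z : seq I) (i : I) : nat := (B ^ index i Z)%N.

(** Kronecker's substitution: the variables become powers of a single one, with
   exponents so far apart that distinct monomials of a given polynomial stay
   distinct (digits in base B). It reduces the absence of zero divisors and the
   separation by points to polynomials in one variable. *)
Definition kron (B : nat) (Z : seq I) : sym K I -> {poly K} :=
  ev (@polyC K) (fun i => 'X^(kron_exp B Z i)).

Lemma kron_exp_inj B (Z : seq I) (u w : I -> nat) : uniq Z ->
  (forall i, u i < B)%N -> (forall i, w i < B)%N ->
  (\sum_(i <- Z) u i * kron_exp B Z i = \sum_(i <- Z) w i * kron_exp B Z i)%N ->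
  {in Z, u =1 w}.
Proof.
elim: Z => [|j Z IHZ] //= /andP[jZ uZ] uB wB.
have sumE (x : I -> nat) : (\sum_(i <- j :: Z) x i * kron_exp B (j :: Z) i =
    x j + B * \sum_(i <- Z) x i * kron_exp B Z i)%N.
  rewrite big_cons {1}/kron_exp /= eqxx expn0 muln1; congr addn.
  rewrite big_distrr /=; apply: eq_big_seq => i iZ.
  rewrite /kron_exp /= (negbTE (memPnC jZ _ iZ)) expnS.
  by rewrite mulnCA.
rewrite !sumE => e.
have B0 : (0 < B)%N by apply: leq_ltn_trans (uB j).
have ej : u j = w j.
  have modE a b : (a + B * b = a %[mod B])%N by rewrite mulnC addnC modnMDl.
  have := congr1 (modn^~ B) e; rewrite /= !modE.
  by rewrite !modn_small.
move/eqP: e; rewrite ej eqn_add2l eqn_pmul2l // => /eqP /(IHZ uZ uB wB) eZ i.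
by rewrite inE => /predU1P[->|/eZ].
Qed.

Lemma monev_Xn (e : I -> nat) (u : {cmonom I}) (Z : {fset I}) :
  (finsupp u `<=` Z)%fset ->
  monev (fun i => 'X^(e i) : {poly K}) u = 'X^(\sum_(i <- Z) u i * e i).
Proof.
move=> uZ; rewrite (monevEw _ uZ) -prodrXr.
by apply: eq_bigr => i _; rewrite -exprM mulnC.
Qed.

Lemma cmonom_le_mdeg (u : {cmonom I}) i : (u i <= mdeg u)%N.
Proof.
have [iu|] := boolP (i \in finsupp u).
  by rewrite /mdeg (big_fsetD1 i iu) leq_addr.
by rewrite -cmE_eq0 => /eqP->.
Qed.

Definition sym_height f : nat := (\max_(u <- msupp f) mdeg u).+1.

Lemma sym_heightP f (u : {cmonom I}) i : u \in msupp f -> (u i < sym_height f)%N.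
Proof.
move=> uf; rewrite ltnS (leq_trans (cmonom_le_mdeg u i)) //.
by rewrite (big_fsetD1 u uf) leq_maxl.
Qed.

Lemma finsupp_vars f (u : {cmonom I}) : u \in msupp f -> (finsupp u `<=` vars f)%fset.
Proof.
move=> uf; apply/fsubsetP => i iu; apply/bigfcupP; exists u => //.
by rewrite uf.
Qed.

Lemma kron_coef B (Z : {fset I}) f (w : {cmonom I}) : (vars f `<=` Z)%fset ->
  (sym_height f <= B)%N -> w \in msupp f ->
  (kron B Z f)`_(\sum_(i <- Z) w i * kron_exp B Z i) = scoef w f.
Proof.
move=> fZ fB wf; rewrite /kron /ev coef_sum.
set e := (\sum_(i <- Z) _)%N.
rewrite (big_fsetD1 w wf) /= big_seq big1 => [|u].
  rewrite addr0 (monev_Xn _ (fsubset_trans (finsupp_vars wf) fZ)).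
  by rewrite coefCM coefXn /e eqxx mulr1.
rewrite in_fsetD1 => /andP[ne_uw uf].
rewrite (monev_Xn _ (fsubset_trans (finsupp_vars uf) fZ)) coefCM coefXn.
case: eqP => [e'|]; last by rewrite mulr0.
case/eqP: ne_uw; apply/eqP/cmP => i.
have [iZ|niZ] := boolP (i \in Z).
  apply: (kron_exp_inj (u := u) (w := w) (fset_uniq Z)) iZ => [j|j|]; last exact: esym e'.
    exact: leq_trans (sym_heightP j uf) fB.
  exact: leq_trans (sym_heightP j wf) fB.
have out (x : {cmonom I}) : x \in msupp f -> x i = 0%N.
  move=> xf; apply/eqP; rewrite cmE_eq0; apply: contra niZ.
  exact/fsubsetP/(fsubset_trans (finsupp_vars xf) fZ).
by rewrite !out.
Qed.

Lemma sym_neq0_coef f : f != 0 -> exists2 w : {cmonom I}, w \in msupp f & scoef w f != 0.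
Proof.
move=> f0; have [e|[w wf]] := fset_0Vmem (msupp f).
  by case/eqP: f0; rewrite (sym_monoE f) e big_nil.
by exists w; rewrite // -scoef_supp.
Qed.

Lemma kron_neq0 B (Z : {fset I}) f : (vars f `<=` Z)%fset ->
  (sym_height f <= B)%N -> f != 0 -> kron B Z f != 0.
Proof.
move=> fZ fB /sym_neq0_coef[w wf]; rewrite -(kron_coef fZ fB wf).
by apply: contraNneq => ->; rewrite coef0.
Qed.

Lemma sym_mul_eq0 f g : f * g = 0 -> f = 0 \/ g = 0.
Proof.
move=> fg0; have [->|f0] := eqVneq f 0; first by left.
have [->|g0] := eqVneq g 0; first by right.
set Z := (vars f `|` vars g)%fset; set B := maxn (sym_height f) (sym_height g).
have := congr1 (kron B Z) fg0; rewrite /kron rmorphM rmorph0 /= => /eqP.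
rewrite mulf_eq0; case/norP; rewrite !kron_neq0 ?fsubsetUl ?fsubsetUr //.
  exact: leq_maxr.
exact: leq_maxl.
Qed.

End Kronecker.

Section Points.
Variables (K : fieldType) (char0 : [pchar K] =i pred0).

Lemma natr_inj_char0 : injective (fun k : nat => k%:R : K).
Proof.
have nz k : (k.+1%:R : K) != 0.
  by rewrite ((pcharf0P K).1 char0).
have le k l : k%:R = l%:R :> K -> (k <= l)%N.
  move=> e; rewrite leqNgt; apply/negP => lt_lk.
  have := nz (k - l.+1)%N; rewrite subnSK // natrB ?(ltnW lt_lk) // e subrr.
  by rewrite eqxx.
by move=> k l e; apply/eqP; rewrite eqn_leq !le.
Qed.

(** The images of the natural numbers give infinitely many points in characteristic 0. *)
Lemma poly_nonroot (f : {poly K}) (s : seq K) : f != 0 ->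
  exists2 t : K, f.[t] != 0 & t \notin s.
Proof.
move=> f0; pose g := f * \prod_(a <- s) ('X - a%:P).
have g0 : g != 0 by rewrite mulf_neq0 // monic_neq0 // monic_prod_XsubC.
pose r := [seq k%:R : K | k <- iota 0 (size g)].
have ur : uniq r by rewrite map_inj_uniq ?iota_uniq //; apply: natr_inj_char0.
have [rr|] := boolP (all (root g) r).
  by have := max_poly_roots g0 rr ur; rewrite size_map size_iota ltnn.
case/allPn => t _; rewrite /root hornerM mulf_eq0 negb_or => /andP[ft].
rewrite -/(root _ t) root_prod_XsubC => ts; by exists t.
Qed.

Section Eval.
Variable I : choiceType.
Implicit Types f g : sym K I.

Definition evp (t : I -> K) : sym K I -> K := ev idfun t.
HB.instance Definition _ t := GRing.RMorphism.on (evp t).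

Lemma evp_gen t i : evp t (gen K i) = t i.
Proof. exact: ev_gen. Qed.

Lemma evpZ t k f : evp t (k *: f) = k * evp t f.
Proof. exact: evZ. Qed.

Lemma sym_neq0_pt f : f != 0 -> exists t, evp t f != 0.
Proof.
move=> f0; have kf0 := kron_neq0 (fsubset_refl _) (leqnn _) f0.
have [t ft _] := poly_nonroot [::] kf0.
exists (fun i => ('X^(kron_exp (sym_height f) (vars f) i)).[t]).
apply: contraNneq ft => <-; apply/eqP.
rewrite -/(horner_eval t _) /kron rmorph_ev.
by apply: eq_ev => k //=; rewrite /horner_eval hornerC.
Qed.

(** Kronecker's substitution turns a nonzero polynomial into a nonzero polynomial
   in one variable, which has a point where it does not vanish. *)
Lemma eq_sym_pt f g : (forall t, evp t f = evp t g) -> f = g.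
Proof.
move=> e; apply/eqP; rewrite -subr_eq0; apply/negPn/negP => /sym_neq0_pt[t].
by rewrite rmorphB /= e subrr eqxx.
Qed.

(** The product d (f - g) vanishes everywhere. This lets an identity be checked
   on a dense open set, where matrices are invertible. *)
Lemma eq_sym_pt_gen d f g : d != 0 ->
  (forall t, evp t d != 0 -> evp t f = evp t g) -> f = g.
Proof.
move=> d0 e; have : d * (f - g) = 0.
  apply: eq_sym_pt => t; rewrite rmorphM rmorphB /= rmorph0.
  have [->|dt] := eqVneq (evp t d) 0; first by rewrite mul0r.
  by rewrite e // subrr mulr0.
by case/sym_mul_eq0 => [d0'|/eqP]; [rewrite d0' eqxx in d0 | rewrite subr_eq0 => /eqP].
Qed.
End Eval.

Lemma evp_subst (I J : choiceType) (t : I -> K) (v : J -> sym K I) (f : sym K J) :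
  evp t (subst v f) = evp (fun j => evp t (v j)) f.
Proof.
rewrite rmorph_subst; apply: eq_ev => // k /=.
by rewrite evpZ rmorph1 mulr1.
Qed.

Lemma eq_poly_pt (f g : {poly K}) : (forall t, f.[t] = g.[t]) -> f = g.
Proof.
move=> e; apply/eqP; rewrite -subr_eq0; apply/negPn/negP => h0.
have [t + _] := poly_nonroot [::] h0.
by rewrite hornerD hornerN e subrr eqxx.
Qed.

End Points.

(** * Unique factorisation *)

Section SymDomain.
Variables (K : fieldType) (I : choiceType).
Implicit Types f g : sym K I.

Definition sym_unit : pred (sym K I) :=
  fun f => (f == (scoef (onecm I) f)%:A) && (scoef (onecm I) f != 0).

Definition sym_inv f : sym K I :=
  if sym_unit f then ((scoef (onecm I) f)^-1)%:A else f.

Let mulVf : {in sym_unit, left_inverse 1 sym_inv *%R}.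
Proof.
move=> f; rewrite /in_mem /= => uf; rewrite /sym_inv uf.
case/andP: uf => /eqP ef c0; rewrite {2}ef -scalerAl mul1r scalerA mulVf //.
by rewrite scale1r.
Qed.

(** Under Kronecker's substitution an invertible polynomial becomes an invertible
   polynomial in one variable, of size 1, and every monomial of f other than 1
   would survive as a positive power. *)
Lemma sym_invertible_const f g : g * f = 1 -> f = (scoef (onecm I) f)%:A.
Proof.
move=> gf1; have c1 : scoef (onecm I) (1 : sym K I) = 1.
  by rewrite -mono1 scoef_mono eqxx.
set Z := (vars f `|` vars g)%fset; set B := maxn (sym_height f) (sym_height g).
have := congr1 (kron B Z) gf1; rewrite /kron rmorphM rmorph1 /=.
rewrite -/(kron B Z f) -/(kron B Z g) => e.
have /size_poly1P[c _ ec] : size (kron B Z f) == 1%N.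
  by have /andP[] : (size (kron B Z g) == 1%N) && (size (kron B Z f) == 1%N)
    by rewrite -size_mul_eq1 e size_poly1.
apply: scoefP => w; rewrite scoefZ -[in RHS]mono1 scoef_mono.
have [<-|ne_w] := eqVneq; first by rewrite mulr1.
rewrite mulr0; apply/eqP; apply: contraNT ne_w; rewrite -scoef_supp => wf.
have fB : (sym_height f <= B)%N by rewrite leq_maxl.
have := kron_coef (fsubsetUl (vars f) (vars g)) fB wf; rewrite ec coefC.
have B0 : (0 < B)%N by apply: leq_trans fB.
case: eqP => [e0 _|_ /esym/eqP]; last first.
  by move/negPn; rewrite -scoef_supp wf.
apply/cmP => i; rewrite onecmE; apply/esym/eqP; rewrite cmE_eq0.
apply/negP => iw; have iZ : i \in Z.
  by rewrite in_fsetU (fsubsetP (finsupp_vars wf)).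
move/eqP: e0; rewrite sum_nat_seq_eq0 => /allP/(_ i iZ) /=.
by rewrite muln_eq0 cmE_eq0 iw /= /kron_exp expn_eq0 (gtn_eqF B0).
Qed.

Lemma sym_unitP f g : g * f = 1 -> sym_unit f.
Proof.
move=> gf1; have ef := sym_invertible_const gf1.
rewrite /sym_unit -ef eqxx /=; apply: contra_eq_neq gf1 => c0.
by rewrite ef c0 scale0r mulr0 eq_sym oner_neq0.
Qed.

Let inv_out : {in [predC sym_unit], sym_inv =1 id}.
Proof. by move=> f; rewrite inE /= /sym_inv /in_mem /= => /negbTE->. Qed.

HB.instance Definition _ :=
  GRing.ComNzRing_hasMulInverse.Build (sym K I) mulVf sym_unitP inv_out.

Let mul_eq0 f g : f * g = 0 -> (f == 0) || (g == 0).
Proof. by case/sym_mul_eq0=> ->; rewrite eqxx ?orbT. Qed.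

HB.instance Definition _ := GRing.ComUnitRing_isIntegral.Build (sym K I) mul_eq0.

End SymDomain.

Definition divides (R : comNzRingType) (a b : R) : Prop := exists c, b = c * a.

Definition prime_elt (R : comNzRingType) (a : R) : Prop :=
  ~ divides a 1 /\
  forall x y, divides a (x * y) -> divides a x \/ divides a y.

(** Existence of factorisations into primes in the strong sense, which makes them
   unique. Prime elements are used, not irreducible ones, because they pass to
   polynomial rings by Gauss's lemma. In a domain 0 is a prime_elt, but it cannot
   occur as a factor of a nonzero element. *)
Definition ufd (R : comNzRingType) : Prop :=
  forall a : R, a != 0 -> exists2 s : seq R, {in s, forall x, prime_elt x} &
    exists2 u, divides u 1 & a = u * \prod_(x <- s) x.

Lemma divides_refl (R : comNzRingType) (a : R) : divides a a.
Proof. by exists 1; rewrite mul1r. Qed.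

Lemma divides_trans (R : comNzRingType) (a b c : R) :
  divides a b -> divides b c -> divides a c.
Proof. by move=> [x ->] [y ->]; exists (y * x); rewrite mulrA. Qed.

Lemma divides_mulr (R : comNzRingType) (a b c : R) : divides a b -> divides a (b * c).
Proof. by move=> [x ->]; exists (c * x); rewrite mulrAC [c * x]mulrC. Qed.

Lemma divides_mull (R : comNzRingType) (a b c : R) : divides a b -> divides a (c * b).
Proof. by rewrite mulrC; apply: divides_mulr. Qed.

Lemma divides0 (R : comNzRingType) (a : R) : divides a 0.
Proof. by exists 0; rewrite mul0r. Qed.

Lemma dividesD (R : comNzRingType) (a b c : R) :
  divides a b -> divides a c -> divides a (b + c).
Proof. by move=> [x ->] [y ->]; exists (x + y); rewrite mulrDl. Qed.

Lemma dividesB (R : comNzRingType) (a b c : R) :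
  divides a b -> divides a c -> divides a (b - c).
Proof. by move=> [x ->] [y ->]; exists (x - y); rewrite mulrBl. Qed.

Lemma prime_prod (R : comNzRingType) (a : R) (s : seq R) : prime_elt a ->
  divides a (\prod_(x <- s) x) -> exists2 x, x \in s & divides a x.
Proof.
move=> [a1 pa]; elim: s => [|x s IHs]; first by rewrite big_nil.
rewrite big_cons => /pa[ax|/IHs[y ys ay]]; first by exists x; rewrite ?mem_head.
by exists y; rewrite // inE ys orbT.
Qed.

Lemma prime_unit (R : comNzRingType) (a u : R) : prime_elt a -> divides u 1 ->
  ~ divides a u.
Proof. by move=> [a1 _] u1 au; apply: a1; apply: divides_trans u1. Qed.

Lemma prime_exp (R : comNzRingType) (a b : R) k : prime_elt a ->
  divides a (b ^+ k) -> divides a b.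
Proof.
move=> [a1 pa]; elim: k => [//|k IHk].
by rewrite exprS => /pa[|/IHk].
Qed.

Section GaussLemma.
Variables (R : idomainType) (ufdR : ufd R).
Implicit Types f g h : {poly R}.

Lemma dividesC (a : R) f : (forall i, divides a f`_i) -> divides a%:P f.
Proof.
elim/poly_ind: f => [_|f c IHf H]; first exact: divides0.
have [d ->] : divides a c by have := H 0%N; rewrite coefD coefMX coefC add0r.
have /IHf[g ->] : forall i, divides a f`_i.
  by move=> i; have := H i.+1; rewrite coefD coefMX coefC addr0.
by exists (g * 'X + d%:P); rewrite mulrDl polyCM mulrAC.
Qed.

Lemma divides_coef (a : R) f i : divides a%:P f -> divides a f`_i.
Proof. by move=> [g ->]; rewrite coefMC; exists g`_i. Qed.

(** Gauss's lemma: induction on the sizes of both factors, removing constant terms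
   divisible by a. *)
Lemma prime_polyC (a : R) : prime_elt a -> prime_elt a%:P.
Proof.
move=> [a1 pa]; split=> [/(divides_coef 0)|f g]; first by rewrite coef1.
have [n] := ubnP (size f + size g); elim: n f g => // n IHn f g le_n afg.
(* Exchanging f and g, the constant term of f may be assumed divisible by a. *)
wlog: f g le_n afg / divides a f`_0.
  have : divides a (f`_0 * g`_0) by rewrite -coef0M; apply: divides_coef.
  case/pa=> [af H|ag H]; first exact: H le_n afg af.
  by apply/or_comm; apply: H ag; [rewrite addnC | rewrite mulrC].
move: le_n afg; elim/poly_ind: f => [|f c _] le_n afg; first by left; apply: divides0.
rewrite coefD coefMX coefC add0r /= => ac.
have acP : divides a%:P c%:P by case: ac => d ->; exists d%:P; rewrite polyCM.
have [f0|f0] := eqVneq f 0; first by left; rewrite f0 mul0r add0r.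
have afg' : divides a%:P (f * g).
  have : divides a%:P (f * 'X * g).
    by rewrite -[f * 'X](addrK c%:P) mulrBl; apply: dividesB => //; apply: divides_mulr.
  move=> H; apply: dividesC => i.
  have -> : (f * g)`_i = (f * 'X * g)`_i.+1 by rewrite mulrAC coefMX.
  exact: divides_coef.
have [] := IHn f g _ afg'; last by right.
  move: le_n; rewrite size_MXaddC (negbTE f0) /= addSn !ltnS => le_n.
  exact: le_n.
by move=> af; left; apply: dividesD => //; apply: divides_mulr.
Qed.

Definition primitive_poly f := forall a : R, prime_elt a -> ~ divides a%:P f.

(** Without greatest common divisors, the content is extracted one prime at a
   time; this stops because the primes extracted divide the leading
   coefficient, which has finitely many prime factors. *)
Lemma content_split f : f != 0 -> exists2 s : seq R,
  {in s, forall x, prime_elt x} &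
  exists2 g, primitive_poly g & f = (\prod_(x <- s) x)%:P * g.
Proof.
move=> f0; have lf0 : lead_coef f != 0 by rewrite lead_coef_eq0.
have [s ps [u u1 es]] := ufdR lf0.
have [n] := ubnP (size s); elim: n s f f0 lf0 ps u u1 es => // n IHn s f f0 lf0 ps u u1 es le_n.
have [pf|npf] := classic (primitive_poly f).
  by exists [::]; [|exists f]; rewrite // big_nil mul1r.
have [a [pa [g eg]]] : exists a : R, prime_elt a /\ divides a%:P f.
  apply: NNPP => H; apply: npf => a pa af; apply: H; by exists a.
have g0 : g != 0 by apply: contraNneq f0 => g0; rewrite eg g0 mul0r.
have a0 : a != 0 by apply: contraNneq f0 => a0; rewrite eg a0 mulr0.
have elf : lead_coef f = lead_coef g * a by rewrite eg lead_coefM lead_coefC.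
have : divides a (lead_coef f) by exists (lead_coef g).
rewrite es => /(proj2 pa)[/(prime_unit pa)//|/(prime_prod pa)[x xs [r exr]]].
have x0 : x != 0.
  apply: contraNneq lf0 => x0; rewrite es (big_rem x) //= x0 mul0r mulr0.
  exact: eqxx.
have [k ek] : divides x a.
  have [] := (proj2 (ps x xs)) r a; rewrite -?exr //; first exact: divides_refl.
  case=> k ek; case: (proj1 pa); exists k; apply: (mulIf x0).
  by rewrite mul1r {1}exr ek mulrAC.
have rk : r * k = 1 by apply: (mulIf x0); rewrite mul1r -mulrA -ek -exr.
have [|||||s' ps' [h ph eh]] := IHn (rem x s) g g0 _ _ (u * r).
- by rewrite lead_coef_eq0.
- by move=> y /mem_rem; apply: ps.
- case: u1 => v ->; exists (v * k).
  by rewrite -mulrA [k * _]mulrC -(mulrA u) rk mulr1.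
- apply: (mulIf a0); rewrite -elf es (big_rem x) //= exr.
  by rewrite mulrA [u * _]mulrA mulrAC.
- by move: le_n; rewrite size_rem // ltnS; case: (s) xs.
exists (a :: s'); first by move=> y; rewrite inE => /predU1P[->|/ps'].
by exists h => //; rewrite big_cons polyCM eg eh mulrAC [a%:P * _]mulrC.
Qed.

(** The constant c is a product of primes, and none of them divides the primitive
   factor h, so each can be cancelled against g. *)
Lemma primitive_cancel (c : R) f g h : primitive_poly h -> c != 0 ->
  c%:P * f = g * h -> divides h f.
Proof.
move=> ph c0; have [s ps [u [v uv] ec]] := ufdR c0; rewrite {}ec in c0 *.
elim: s ps f g c0 => [|a s IHs] ps f g c0.
  rewrite big_nil mulr1 => e; exists (v%:P * g).
  by rewrite -mulrA -e mulrA -polyCM -uv mul1r.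
have pa := ps a (mem_head _ _); move: c0; rewrite big_cons mulrCA => c0 e.
move: c0; rewrite mulf_eq0 negb_or => /andP[a0 c0].
have [] := (proj2 (prime_polyC pa)) g h.
- by exists ((u * \prod_(x <- s) x)%:P * f); rewrite -e polyCM -mulrA mulrC.
- case=> g' eg; apply: (IHs _ f g' c0); first by move=> x xs; apply: ps; rewrite inE xs orbT.
  apply: (mulfI (_ : a%:P != 0)); first by rewrite polyC_eq0.
  by rewrite mulrA -polyCM e eg mulrAC mulrC.
- by move/(ph _ pa).
Qed.

Lemma primitive_unit f : f != 0 -> primitive_poly f -> (size f <= 1)%N -> divides f 1.
Proof.
move=> f0 pf /size1_polyC ef; have c0 : f`_0 != 0.
  by apply: contraNneq f0 => c0; rewrite ef c0.
have [[|a s] ps [u [v uv] ec]] := ufdR c0.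
  exists v%:P; rewrite ef ec big_nil mulr1 -polyCM -uv //.
case: (pf a (ps _ (mem_head _ _))); rewrite ef ec big_cons.
by exists (u * \prod_(x <- s) x)%:P; rewrite -polyCM mulrCA mulrC.
Qed.

Lemma irreducible_factor f : (1 < size f)%N ->
  exists2 h, irreducible_poly h & h %| f.
Proof.
have [n] := ubnP (size f); elim: n f => // n IHn f le_n f1.
have [irf|nirf] := classic (irreducible_poly f); first by exists f.
have [h [h1 [hf nh]]] : exists h, size h != 1%N /\ h %| f /\ ~~ (h %= f).
  apply: NNPP => H; apply: nirf; split=> // h h1 hf.
  by apply: contraT => nh; case: H; exists h.
have f0 : f != 0 by rewrite -size_poly_gt0 ltnW.
have h0 : h != 0 by apply: contraTneq hf => ->; rewrite dvd0p.
have [||g irg gh] := IHn h.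
- move: nh; rewrite -(dvdp_size_eqp hf) => nh.
  by rewrite ltnS in le_n; apply: leq_trans le_n; rewrite ltn_neqAle nh dvdp_leq.
- by rewrite ltn_neqAle eq_sym h1 size_poly_gt0.
by exists g => //; apply: dvdp_trans hf.
Qed.

(** Divisibility by h over the fraction field means divisibility up to a constant,
   and primitive_cancel removes the constant. *)
Lemma irreducible_prime h : irreducible_poly h -> primitive_poly h -> prime_elt h.
Proof.
move=> [h1 irh] ph; split=> [[k e]|f g [k e]].
  have := size_poly1 R; rewrite e => /eqP; rewrite size_mul_eq1.
  by case/andP=> _; rewrite gtn_eqF.
have toD q : h %| q -> divides h q.
  case/Pdiv.WeakIdomain.dvdpP=> [[c r]] /= c0 er; apply: (primitive_cancel (g := r) ph c0).
  by rewrite mul_polyC.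
have hfg : h %| f * g by rewrite e dvdp_mulIr.
have [cop|ncop] := boolP (coprimep h f).
  by right; apply: toD; rewrite -(Gauss_dvdpr _ cop).
left; apply: toD.
by rewrite -(eqp_dvdl _ (irh _ ncop (dvdp_gcdl h f))) dvdp_gcdr.
Qed.

(** Split off an irreducible factor over the fraction field, replace it by its
   primitive part, and induct on the size. *)
Lemma primitive_factor f : f != 0 -> primitive_poly f ->
  exists2 s, {in s, forall x, prime_elt x} &
  exists2 u, divides u 1 & f = u * \prod_(x <- s) x.
Proof.
have [n] := ubnP (size f); elim: n f => // n IHn f le_n f0 pf.
have [f1|f1] := leqP (size f) 1.
  exists [::] => //; exists f; last by rewrite big_nil mulr1.
  exact: primitive_unit.
have [h irh hf] := irreducible_factor f1.
have [t pt [h' ph' eh]] := content_split (irredp_neq0 irh).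
have t0 : (\prod_(x <- t) x)%:P != 0 :> {poly R}.
  by apply: contraNneq (irredp_neq0 irh) => t0; rewrite eh t0 mul0r.
have hh' : h %= h'.
  rewrite eh mul_polyC eqp_scale //; by rewrite polyC_eq0 in t0.
have irh' : irreducible_poly h'.
  case: irh => h1 irh; split; first by rewrite -(eqp_size hh').
  by move=> q q1; rewrite -(eqp_dvdr _ hh') => /(irh q q1)/eqp_trans; apply.
have ph := irreducible_prime irh' ph'.
have [k ek] : divides h' f.
  have : h' %| f by rewrite -(eqp_dvdl _ hh').
  case/Pdiv.WeakIdomain.dvdpP=> [[c r]] /= c0 er; apply: (primitive_cancel (g := r) ph' c0).
  by rewrite mul_polyC.
have k0 : k != 0 by apply: contraNneq f0 => k0; rewrite ek k0 mul0r.
have h0 := irredp_neq0 irh'.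
have [|||s ps [u u1 es]] := IHn k.
- rewrite ltnS in le_n; apply: leq_trans le_n; rewrite ek size_mul //.
  case: irh' => h1 _; rewrite -subn1 -addnBA; last exact: ltnW.
  by rewrite -[X in (X < _)%N]addn0 ltn_add2l subn_gt0.
- exact: k0.
- by move=> a pa [l el]; apply: (pf a pa); rewrite ek el; exists (l * h'); rewrite mulrAC.
exists (h' :: s); first by move=> y; rewrite inE => /predU1P[->|/ps].
by exists u => //; rewrite big_cons ek es mulrAC mulrA.
Qed.

Theorem ufd_poly : ufd {poly R}.
Proof.
move=> f f0; have [t pt [g pg eg]] := content_split f0.
have g0 : g != 0 by apply: contraNneq f0 => g0; rewrite eg g0 mulr0.
have [s ps [u u1 es]] := primitive_factor g0 pg.
exists (map polyC t ++ s).
  move=> x; rewrite mem_cat => /orP[/mapP[y /pt py ->]|/ps //].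
  exact: prime_polyC.
exists u => //; rewrite big_cat /= big_map -rmorph_prod eg es.
by rewrite mulrCA.
Qed.

End GaussLemma.

Lemma divides_rmorph (R S : comNzRingType) (f : {rmorphism R -> S}) a b :
  divides a b -> divides (f a) (f b).
Proof. by move=> [c ->]; exists (f c); rewrite rmorphM. Qed.

Lemma ufd_iso (R S : comNzRingType) (f : {rmorphism R -> S})
    (g : {rmorphism S -> R}) : cancel f g -> cancel g f -> ufd R -> ufd S.
Proof.
move=> fK gK ufdR a a0.
have [|s ps [u u1 es]] := ufdR (g a).
  by apply: contraNneq a0 => ga0; rewrite -(gK a) ga0 rmorph0.
exists (map f s).
  move=> _ /mapP[x /ps[x1 px] ->]; split=> [fx1|y z fxyz].
    by apply: x1; rewrite -(fK x) -(rmorph1 g); apply: divides_rmorph.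
  have := divides_rmorph g fxyz; rewrite fK rmorphM => /px[] /(divides_rmorph f).
    by rewrite gK; left.
  by rewrite gK; right.
exists (f u); first by rewrite -(rmorph1 f); apply: divides_rmorph.
by rewrite big_map -rmorph_prod -rmorphM -es gK.
Qed.

Section LastVariable.
Variables (K : fieldType) (d : nat).
Local Notation S := (sym K 'I_d).
Local Notation S1 := (sym K 'I_d.+1).

(** A symmetric algebra in d+1 variables is a polynomial ring in the last variable
   over the symmetric algebra in d variables; of_poly is the inverse. *)
Definition to_poly : S1 -> {poly S} :=
  ev (@polyC S \o GRing.in_alg S)
     (fun i => if unlift ord_max i is Some j then (gen K j)%:P else 'X).

Definition of_poly : {poly S} -> S1 :=
  horner_eval (gen K ord_max) \o map_poly (subst (fun j => gen K (lift ord_max j))).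

HB.instance Definition _ := GRing.RMorphism.on to_poly.
HB.instance Definition _ := GRing.RMorphism.on of_poly.

Lemma of_polyE p : of_poly p =
  (map_poly (subst (fun j => gen K (lift ord_max j))) p).[gen K ord_max].
Proof. by []. Qed.

Lemma to_polyC c : to_poly (subst (fun j => gen K (lift ord_max j)) c) = c%:P.
Proof.
rewrite /to_poly rmorph_subst /=.
rewrite -[c in RHS]subst_id rmorph_subst /=.
apply: eq_ev => [k|j] /=; first by rewrite evC.
by rewrite ev_gen liftK.
Qed.

Lemma to_poly_max : to_poly (gen K ord_max) = 'X.
Proof. by rewrite /to_poly ev_gen unlift_none. Qed.

Lemma of_polyMXaddC p c : of_poly (p * 'X + c%:P) =
  of_poly p * gen K ord_max + subst (fun j => gen K (lift ord_max j)) c.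
Proof. by rewrite of_polyE rmorphD rmorphM /= map_polyC map_polyX hornerMXaddC. Qed.

Lemma of_polyK : cancel of_poly to_poly.
Proof.
elim/poly_ind => [|p c IHp]; first by rewrite !rmorph0.
by rewrite of_polyMXaddC rmorphD rmorphM /= IHp to_poly_max to_polyC.
Qed.

Lemma to_polyK : cancel to_poly of_poly.
Proof.
apply: (rmorph_sym_ext (f1 := of_poly \o to_poly) (f2 := idfun)) => [k|i] /=.
  rewrite /to_poly evC /= -[(_%:A)%:P]add0r -(mul0r 'X) of_polyMXaddC rmorph0 mul0r.
  by rewrite add0r linearZ /= rmorph1.
case: (unliftP ord_max i) => [j ->|->].
  rewrite /to_poly ev_gen liftK -[(gen K j)%:P]add0r -(mul0r 'X) of_polyMXaddC.
  by rewrite rmorph0 mul0r add0r subst_gen.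
by rewrite to_poly_max -['X]mul1r -[_ * 'X]addr0 of_polyMXaddC rmorph1 mul1r rmorph0 addr0.
Qed.

End LastVariable.

Lemma sym0_const (K : fieldType) (f : sym K 'I_0) : exists c : K, f = c%:A.
Proof.
elim/sym_ind: f => [k|f g [a ->] [b ->]|[] //]; first by exists k.
by exists (a + b); rewrite scalerDl.
Qed.

Theorem ufd_sym (K : fieldType) d : ufd (sym K 'I_d).
Proof.
elim: d => [|d IHd].
  move=> a a0; have [c ec] := sym0_const a; exists [::] => //.
  have c0 : c != 0 by apply: contraNneq a0 => c0; rewrite ec c0 scale0r.
  exists a; rewrite ?big_nil ?mulr1 // ec; exists (c^-1)%:A.
  by rewrite -scalerAl mul1r scalerA mulVf // scale1r.
exact (ufd_iso (@of_polyK K d) (@to_polyK K d) (ufd_poly IHd)).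
Qed.

(** A prime factor b of a misses some M t, hence divides c; dividing both a and c
   by b, one concludes by induction on the number of prime factors of a. *)
Lemma ufd_cancel (R : idomainType) (T : Type) (M : T -> R) (a c : R) k :
  ufd R ->
  (forall b, prime_elt b -> b != 0 -> exists t, ~ divides b (M t)) ->
  a != 0 -> (forall t, divides a (M t ^+ k * c)) -> divides a c.
Proof.
move=> ufdR HM a0; have [s ps [u [v uv] ea]] := ufdR a a0.
rewrite {}ea in a0 *; elim: s ps a0 c => [|b s IHs] ps a0 c H.
  by exists (c * v); rewrite big_nil mulr1 -mulrA -uv mulr1.
have pb := ps b (mem_head _ _).
move: a0; rewrite big_cons mulrCA mulf_eq0 negb_or => /andP[b0 a0].
have [t bt] := HM b pb b0.
have bd : divides b c.
  have : divides b (M t ^+ k * c).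
    apply: divides_trans (H t); rewrite big_cons mulrCA mulrC.
    exact/divides_mull/divides_refl.
  by case/(proj2 pb) => [/(prime_exp pb)|].
case: bd => e ee; have [||x ex] := IHs _ a0 e.
  by move=> y ys; apply: ps; rewrite inE ys orbT.
  move=> t'; have [x ex] := H t'; exists x; apply: (mulIf b0).
  by rewrite -mulrA -ee ex big_cons -!mulrA [b * _]mulrC.
by exists x; rewrite ee ex -!mulrA [P in _ = x * P]mulrC -mulrA.
Qed.

(** * Coefficients along a splitting of the variables *)

Section LinearExtension.
Variables (K : fieldType) (I : choiceType) (V : lmodType K).
Implicit Types f g : sym K I.

Definition lin (h : {cmonom I} -> V) f : V :=
  \sum_(u <- msupp f) scoef u f *: h u.

Lemma linEw h f (Z : {fset {cmonom I}}) : (msupp f `<=` Z)%fset ->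
  lin h f = \sum_(u <- Z) scoef u f *: h u.
Proof.
move=> fZ; rewrite /lin (big_fset_incl _ fZ) // => u uZ.
by rewrite scoef_supp negbK => /eqP->; rewrite scale0r.
Qed.

Lemma lin_is_linear h : linear (lin h).
Proof.
move=> k f g; set Z := (msupp f `|` msupp g `|` msupp (k *: f + g)%R)%fset.
have fZ : (msupp f `<=` Z)%fset by rewrite /Z -fsetUA fsubsetUl.
have gZ : (msupp g `<=` Z)%fset by rewrite /Z [X in (X `|` _)%fset]fsetUC -fsetUA fsubsetUl.
have hZ : (msupp (k *: f + g)%R `<=` Z)%fset by rewrite /Z fsubsetUr.
rewrite (linEw _ fZ) (linEw _ gZ) (linEw _ hZ) scaler_sumr -big_split /=.
by apply: eq_bigr => u _; rewrite scoefD scoefZ scalerDl scalerA.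
Qed.

HB.instance Definition _ h :=
  GRing.isLinear.Build K (sym K I) V *:%R (lin h) (lin_is_linear h).

Lemma lin_mono h u : lin h (mono K u) = h u.
Proof. by rewrite /lin msupp_mono big_seq_fset1 scoef_mono eqxx scale1r. Qed.

End LinearExtension.

Section Coefficients.
Variables (K : fieldType) (P C : choiceType).
Local Notation PC := (P + C)%type.
Implicit Types (u : {cmonom P}) (w : {cmonom PC}) (H : sym K PC) (G : sym K C).

Definition cm_restr (J : choiceType) (e : J -> PC) (p : PC -> option J) w : {cmonom J} :=
  [cmonom w (e i) | i in [fset x in pmap p (finsupp w)]%fset]%M.

Lemma cm_restrE (J : choiceType) (e : J -> PC) (p : PC -> option J) w i :
  pcancel e p -> cm_restr e p w i = w (e i).
Proof.
move=> eK; rewrite /cm_restr cmE fsfun_fun; case: ifP => // /negP ni.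
apply/esym/eqP; rewrite cmE_eq0; apply/negP => iw; apply: ni.
by rewrite in_fset /= mem_pmap; apply/mapP; exists (e i); rewrite ?eK.
Qed.

Definition cm_left w : {cmonom P} :=
  cm_restr inl (fun z => if z is inl i then Some i else None) w.

Definition cm_right w : {cmonom C} :=
  cm_restr inr (fun z => if z is inr i then Some i else None) w.

Lemma cm_leftE w i : cm_left w i = w (inl i).
Proof. exact: cm_restrE. Qed.

Lemma cm_rightE w i : cm_right w i = w (inr i).
Proof. exact: cm_restrE. Qed.

Definition inlS : sym K P -> sym K PC := subst (fun i => gen K (inl i)).
Definition inrS : sym K C -> sym K PC := subst (fun i => gen K (inr i)).
HB.instance Definition _ := GRing.LRMorphism.on inlS.
HB.instance Definition _ := GRing.LRMorphism.on inrS.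

Lemma inlS_gen i : inlS (gen K i) = gen K (inl i).
Proof. exact: subst_gen. Qed.
Lemma inrS_gen i : inrS (gen K i) = gen K (inr i).
Proof. exact: subst_gen. Qed.

(** The coefficient of the monomial u, when a polynomial is regarded as a
   polynomial in the left variables with coefficients in the right ones. *)
Definition co u : sym K PC -> sym K C :=
  lin (fun w => if cm_left w == u then mono K (cm_right w) else 0).
HB.instance Definition _ u := GRing.Linear.on (co u).

Lemma cm_leftM w1 w2 : cm_left (mulcm w1 w2) = mulcm (cm_left w1) (cm_left w2).
Proof. by apply/eqP/cmP => i; rewrite mulcmE !cm_leftE mulcmE. Qed.
Lemma cm_rightM w1 w2 : cm_right (mulcm w1 w2) = mulcm (cm_right w1) (cm_right w2).
Proof. by apply/eqP/cmP => i; rewrite mulcmE !cm_rightE mulcmE. Qed.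
Lemma cm_left1 : cm_left (onecm _) = onecm _.
Proof. by apply/eqP/cmP => i; rewrite cm_leftE !onecmE. Qed.
Lemma cm_right1 : cm_right (onecm _) = onecm _.
Proof. by apply/eqP/cmP => i; rewrite cm_rightE !onecmE. Qed.

Lemma co_genM u c H : co u (gen K (inr c) * H) = gen K c * co u H.
Proof.
rewrite (sym_monoE H) mulr_sumr !linear_sum mulr_sumr.
apply: eq_bigr => w _; rewrite -scalerAr !linearZ -scalerAr; congr (_ *: _).
rewrite /= gen_mono -monoM /co !lin_mono cm_leftM cm_rightM.
have -> : cm_left (ucm (inr c : PC)) = onecm _.
  by apply/eqP/cmP => i; rewrite cm_leftE ucmE onecmE.
have -> : cm_right (ucm (inr c : PC)) = ucm c.
  by apply/eqP/cmP => i; rewrite cm_rightE !ucmE.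
by rewrite mul0cm; case: ifP => _; rewrite ?mulr0 // gen_mono monoM.
Qed.

Lemma co_inrM u G H : co u (inrS G * H) = G * co u H.
Proof.
elim/sym_ind: G => [k|G1 G2 IH1 IH2|c G IHG].
- by rewrite linearZ /= rmorph1 -!scalerAl !mul1r linearZ.
- by rewrite rmorphD /= !mulrDl linearD /= IH1 IH2.
- by rewrite rmorphM /= inrS_gen -!mulrA co_genM IHG.
Qed.

Lemma co_inl_mono u v : co u (inlS (mono K v)) = (v == u)%:R.
Proof.
suff [w [-> <- wr]] : exists w, [/\ inlS (mono K v) = mono K w, cm_left w = v
    & cm_right w = onecm _].
  by rewrite /co lin_mono wr; case: eqP; rewrite ?mono1.
elim/monomial_ind: v => [|i v [w [ew lw rw]]].
  by exists (onecm _); rewrite cm_left1 cm_right1 !mono1 rmorph1.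
exists (mulcm (ucm (inl i)) w); split.
- by rewrite !monoM rmorphM /= ew -!gen_mono inlS_gen.
- rewrite cm_leftM lw; congr mulcm.
  by apply/eqP/cmP => j; rewrite cm_leftE !ucmE.
- rewrite cm_rightM rw -[RHS]mul0cm; congr mulcm.
  by apply/eqP/cmP => j; rewrite cm_rightE ucmE onecmE.
Qed.

Lemma co_inlr u v G : co u (inlS (mono K v) * inrS G) = (v == u)%:R * G.
Proof. by rewrite mulrC co_inrM co_inl_mono mulrC. Qed.

Lemma sym_pairs H : exists r : seq ({cmonom P} * sym K C),
  H = \sum_(x <- r) inlS (mono K x.1) * inrS x.2.
Proof.
elim/sym_ind: H => [k|H1 H2 [r1 ->] [r2 ->]|[i|c] H [r ->]].
- exists [:: (onecm _, k%:A)]; rewrite big_seq1 /= mono1 rmorph1 mul1r.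
  by rewrite linearZ /= rmorph1.
- by exists (r1 ++ r2); rewrite big_cat.
- exists [seq (mulcm (ucm i) x.1, x.2) | x <- r]; rewrite big_map mulr_sumr.
  apply: eq_bigr => x _ /=.
  by rewrite monoM rmorphM /= -gen_mono inlS_gen mulrA.
- exists [seq (x.1, gen K c * x.2) | x <- r]; rewrite big_map mulr_sumr.
  by apply: eq_bigr => x _ /=; rewrite rmorphM /= inrS_gen mulrCA.
Qed.

Lemma sym_expand H : exists2 U : seq {cmonom P}, uniq U &
  H = \sum_(u <- U) inlS (mono K u) * inrS (co u H).
Proof.
have [r ->] := sym_pairs H; exists (undup (map fst r)); first exact: undup_uniq.
transitivity (\sum_(u <- undup (map fst r)) \sum_(x <- r)
    inlS (mono K u) * inrS (co u (inlS (mono K x.1) * inrS x.2))); last first.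
  apply: eq_bigr => u _; rewrite (linear_sum (co u)) (linear_sum inrS) mulr_sumr.
  by [].
rewrite exchange_big /=; apply: eq_big_seq => x xr.
rewrite (bigD1_seq x.1) ?undup_uniq ?mem_undup ?map_f //=.
rewrite co_inlr eqxx mul1r big1 ?addr0 // => u ne_ux.
by rewrite co_inlr eq_sym (negbTE ne_ux) mul0r rmorph0 mulr0.
Qed.

Lemma co_sum (U : seq {cmonom P}) (G : {cmonom P} -> sym K C) u : uniq U -> u \in U ->
  co u (\sum_(v <- U) inlS (mono K v) * inrS (G v)) = G u.
Proof.
move=> uU uIn; rewrite (linear_sum (co u)) (bigD1_seq u) //= co_inlr eqxx mul1r.
by rewrite big1 ?addr0 // => v /negbTE ne_vu; rewrite co_inlr ne_vu mul0r.
Qed.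

(** This is how invariance passes from a polynomial to its coefficients: the fields
   D move only the right variables. *)
Lemma co_derivation (D : sym K PC -> sym K PC) (d : sym K C -> sym K C) :
  (forall H1 H2, D (H1 + H2) = D H1 + D H2) ->
  (forall G1 G2, d (G1 + G2) = d G1 + d G2) ->
  (forall u G, D (inlS (mono K u) * inrS G) = inlS (mono K u) * inrS (d G)) ->
  forall u H, co u (D H) = d (co u H).
Proof.
move=> DD dD DM u H; have D0 : D 0 = 0.
  by apply: (addrI (D 0)); rewrite -DD !addr0.
have d0 : d 0 = 0 by apply: (addrI (d 0)); rewrite -dD !addr0.
have [r ->] := sym_pairs H; elim: r => [|x r IHr].
  by rewrite big_nil D0 !linear0 d0.
rewrite big_cons DD !linearD /= dD IHr DM !co_inlr; congr (_ + _).
by case: eqP; rewrite ?mul1r ?mul0r.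
Qed.

End Coefficients.

(** * Linear vector fields at regular points *)

Lemma dext_fin (K : fieldType) (I : finType) (A : comNzRingType)
    (e : {rmorphism sym K I -> A}) (w : I -> A) f :
  dext e w f = \sum_(i : I) e (pderiv i f) * w i.
Proof.
rewrite (@dextEw _ _ _ e w f [fset i | i in I]%fset); last first.
  by apply/fsubsetP => i _; rewrite in_fset.
rewrite (perm_big (index_enum I)) //; apply: uniq_perm.
- exact: fset_uniq.
- exact: index_enum_uniq.
by move=> i; rewrite mem_index_enum /= in_fset.
Qed.

Lemma deriv_eq0 (K : fieldType) (g : {poly K}) : [pchar K] =i pred0 ->
  g^`() = 0 -> g = (g`_0)%:P.
Proof.
move=> char0 g0; apply/polyP => -[|i]; rewrite coefC //=.
have := congr1 (fun h : {poly K} => h`_i) g0; rewrite coef_deriv coef0 => /eqP.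
by rewrite -mulr_natr mulf_eq0 ((pcharf0P K).1 char0) orbF => /eqP.
Qed.

Lemma coef_comp_scale (K : fieldType) (g : {poly K}) (c : K) i :
  c ^+ i * g`_i = (g \Po (c *: 'X))`_i.
Proof.
elim/poly_ind: g i => [|g a IHg] i; first by rewrite comp_poly0 !coef0 mulr0.
rewrite comp_polyD comp_polyM comp_polyX comp_polyC !coefD !coefC coefMX.
rewrite -scalerAr coefZ coefMX; case: i => [|i] /=.
  by rewrite expr0 mul1r mulr0.
by rewrite !addr0 -IHg exprS mulrA.
Qed.

(** By the dimension count the rows of J span the kernel of A, so h is a combination
   of rows of J. *)
Lemma kernel_orthogonal (K : fieldType) (D m : nat) (A : 'M[K]_D) (J : 'M_(m, D))
    (h : 'rV_D) (w : 'cV_D) :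
  (\rank (kermx A) <= m)%N -> \rank J = m -> J *m A = 0 -> h *m A = 0 ->
  J *m w = 0 -> h *m w = 0.
Proof.
move=> rA rJ JA hA Jw.
have JkA : (J <= kermx A)%MS by apply/sub_kermxP.
have kAJ : (kermx A <= J)%MS.
  by rewrite -(geq_leqif (mxrank_leqif_sup JkA)) rJ.
have /submxP[c ->] : (h <= J)%MS.
  by apply: submx_trans kAJ; apply/sub_kermxP.
by rewrite -mulmxA Jw mulmx0.
Qed.

Lemma rmorph_cross (A B : comNzRingType) (f : {rmorphism A -> B}) a b x y a' b' h :
  f a = a' -> f b = b' -> a' * h = f x -> b' * h = f y -> f (a * y - b * x) = 0.
Proof. by move=> ea eb ex ey; rewrite rmorphB !rmorphM ea eb -ex -ey mulrCA subrr. Qed.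

Section VectorFields.
Variables (K : fieldType) (char0 : [pchar K] =i pred0) (D m : nat).
Local Notation S := (sym K 'I_D).
Variables (L : 'I_D -> 'I_D -> S) (F : 'I_m -> S).

(** The Jacobian matrix of the generators; jacp is its value at a point, and adp is
   the value of the matrix of the brackets [y, x_k]. *)
Definition jac : 'M[S]_(m, D) := \matrix_(i, k) pderiv k (F i).
Definition jacp (t : 'I_D -> K) : 'M[K]_(m, D) := map_mx (evp t) jac.
Definition adp (t : 'I_D -> K) : 'M[K]_D := \matrix_(k, y) evp t (L y k).

Hypothesis F_inv : forall i y, dext idfun (L y) (F i) = 0.
Hypothesis L_index : exists t, (\rank (kermx (adp t)) <= m)%N.
Hypothesis F_reg : exists t (N : 'M[K]_(D, m)), \det (jacp t *m N) != 0.
Hypothesis F_big : forall f : S, ~ (exists c : K, f = c%:A) ->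
  exists2 t, evp t f = 0 & exists N : 'M[K]_(D, m), \det (jacp t *m N) != 0.

Definition minor (N : 'M[K]_(D, m)) : S := \det (jac *m map_mx (GRing.in_alg S) N).

Lemma evp_minor t N : evp t (minor N) = \det (jacp t *m N).
Proof.
rewrite /minor -det_map_mx map_mxM; congr (\det (_ *m _)).
by apply/matrixP => i j; rewrite !mxE /= evpZ rmorph1 mulr1.
Qed.

Lemma jacp_adp t : jacp t *m adp t = 0.
Proof.
apply/matrixP => i y; rewrite !mxE -[RHS](rmorph0 (evp t)) -(F_inv i y).
rewrite dext_fin rmorph_sum; apply: eq_bigr => k _ /=.
by rewrite !mxE rmorphM.
Qed.

(** The rank of the matrix of the brackets can only go up near a point, which is
   expressed by a minor of maximal size at a given point. *)
Lemma regular_open : exists2 d : S, d != 0 &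
  forall t, evp t d != 0 -> (\rank (kermx (adp t)) <= m)%N.
Proof.
have [t0 rt0] := L_index; set A0 := adp t0; set r := \rank A0.
pose AS : 'M[S]_D := \matrix_(k, y) L y k.
have ASt t : map_mx (evp t) AS = adp t by apply/matrixP => k y; rewrite !mxE.
have [U [V UV]] : exists (U : 'M[K]_(r, D)) (V : 'M[K]_(D, r)), U *m A0 *m V = 1%:M.
  have [B BE] := row_fullP (col_base_full A0).
  have [B' BE'] := row_freeP (row_base_free A0).
  have e1 : B *m (col_base A0 *m row_base A0) = row_base A0.
    exact: etrans (mulmxA _ _ _) (etrans (congr1 (mulmx^~ _) BE) (mul1mx _)).
  by exists B, B'; rewrite mulmx_base in e1; rewrite e1.
(* The matrices U and V select a nonzero minor of size r of the matrix at t0. *)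
pose d : S := \det (map_mx (GRing.in_alg S) U *m AS *m map_mx (GRing.in_alg S) V).
have in_algK p n t (M : 'M[K]_(p, n)) : map_mx (evp t) (map_mx (GRing.in_alg S) M) = M.
  by apply/matrixP => i j; rewrite !mxE /= evpZ rmorph1 mulr1.
have dt t : evp t d = \det (U *m adp t *m V).
  by rewrite /d -det_map_mx !map_mxM /= !in_algK ASt.
exists d.
  apply/negP => /eqP d0; have := dt t0; rewrite d0 rmorph0 UV det1 => /eqP.
  by rewrite eq_sym oner_eq0.
move=> t; rewrite dt => dt0.
have rr : (r <= \rank (adp t))%N.
  have e : \rank (U *m adp t *m V) = r.
    by apply: mxrank_unit; rewrite unitmxE unitfE.
  rewrite -[X in (X <= _)%N]e.
  exact: leq_trans (mxrankM_maxl _ _) (mxrankM_maxr _ _).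
rewrite mxrank_ker; apply: leq_trans rt0; rewrite mxrank_ker.
exact: leq_sub2l.
Qed.

Local Notation S2 := (sym K ('I_D + 'I_D)%type).

(** Points (eta, xi) of the product of two spaces; the left variables are the
   coordinates of eta. *)
Definition pt2 (p : nat) (eta : 'I_p -> K) (xi : 'I_D -> K) : 'I_p + 'I_D -> K :=
  fun z => match z with inl k => eta k | inr k => xi k end.

(** The linear field eta_k |-> [y, x_k](xi), constant along the fibre over xi. *)
Definition Efield (y : 'I_D) : S2 -> S2 :=
  dext idfun (fun z => if z is inl k then inrS 'I_D (L y k) else 0).

(** The differential of F_i at xi, applied to eta. *)
Definition ell (i : 'I_m) : S2 :=
  \sum_k inrS 'I_D (pderiv k (F i)) * gen K (inl k).

Lemma evp_inrS p (eta : 'I_p -> K) xi (f : S) :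
  evp (pt2 eta xi) (inrS 'I_p f) = evp xi f.
Proof. by rewrite evp_subst; apply: eq_ev => // k; rewrite evp_gen. Qed.

Lemma evp_ell eta xi i :
  evp (pt2 eta xi) (ell i) = (jacp xi *m (\col_k eta k)) i 0.
Proof.
rewrite /ell rmorph_sum mxE; apply: eq_bigr => k _.
by rewrite rmorphM /= evp_inrS evp_gen !mxE.
Qed.

(** Over a regular point xi the gradient of H along the fibre is orthogonal to the
   fields, hence a combination of the differentials of the F_i. So H does not
   change along the segment from eta1 to eta2, on which the ell_i are constant;
   in characteristic 0 a vanishing derivative means that H is constant there. *)
Lemma Efield_const (H : S2) : (forall y, Efield y H = 0) ->
  forall xi eta1 eta2, (\rank (kermx (adp xi)) <= m)%N ->
  (exists N, \det (jacp xi *m N) != 0) ->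
  jacp xi *m (\col_k eta1 k) = jacp xi *m (\col_k eta2 k) ->
  evp (pt2 eta1 xi) H = evp (pt2 eta2 xi) H.
Proof.
move=> EH xi eta1 eta2 rA [N detN] e12.
have rJ : \rank (jacp xi) = m.
  apply/eqP; rewrite eqn_leq rank_leq_row /=.
  have {1}<- : \rank (jacp xi *m N) = m by apply: mxrank_unit; rewrite unitmxE unitfE.
  exact: mxrankM_maxl.
(* H is restricted to the segment from eta1 to eta2. *)
pose w k := eta2 k - eta1 k.
pose v : 'I_D + 'I_D -> {poly K} := fun z =>
  match z with inl k => (eta1 k)%:P + w k *: 'X | inr k => (xi k)%:P end.
pose g : {poly K} := ev (@polyC K) v H.
have gE s : g.[s] = evp (pt2 (fun k => eta1 k + s * w k) xi) H.
  rewrite -/(horner_eval s g) /g rmorph_ev; apply: eq_ev => [k|[k|k]] /=.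
  - by rewrite /horner_eval hornerC.
  - by rewrite /horner_eval !hornerE mulrC.
  - by rewrite /horner_eval hornerC.
have dg : g^`() = \sum_k ev (@polyC K) v (pderiv (inl k) H) * (w k)%:P.
  rewrite /g (@derivation_ev _ _ _ _ _ _ idfun (@deriv K)); last first.
  - by move=> k; rewrite derivC.
  - exact: derivM.
  - exact: derivD.
  rewrite dext_fin big_sumType [X in _ + X = _]big1 ?addr0 => [|k _]; last first.
    by rewrite /= derivC mulr0.
  by apply: eq_bigr => k _; rewrite /= derivD derivC add0r derivZ derivX alg_polyC.
have g0 : g^`() = 0.
  apply: (eq_poly_pt char0) => s; rewrite dg horner0 horner_sum.
  set pt := pt2 (fun k => eta1 k + s * w k) xi.
  pose h : 'rV[K]_D := \row_k evp pt (pderiv (inl k) H).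
  have hA : h *m adp xi = 0.
    apply/matrixP => i y; rewrite !mxE -[RHS](rmorph0 (evp pt)) -(EH y).
    rewrite /Efield dext_fin big_sumType /= [X in _ + X]big1 ?addr0 => [|k _]; last first.
      by rewrite mulr0.
    rewrite rmorph_sum; apply: eq_bigr => k _.
    by rewrite !mxE rmorphM /= evp_inrS.
  have hw : h *m (\col_k w k) = 0.
    apply: (kernel_orthogonal rA rJ (jacp_adp xi) hA).
    have -> : \col_k w k = \col_k eta2 k - \col_k eta1 k.
      by apply/matrixP => k j; rewrite !mxE.
    by rewrite mulmxBr e12 subrr.
  have := congr1 (fun M : 'M_1 => M 0 0) hw; rewrite !mxE => hw0; apply: etrans hw0.
  apply: eq_bigr => k _; rewrite !mxE hornerM hornerC; congr (_ * _).
  rewrite -/(horner_eval s _) rmorph_ev; apply: eq_ev => [c|[c|c]] /=.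
  - by rewrite /horner_eval hornerC.
  - by rewrite /horner_eval !hornerE mulrC.
  - by rewrite /horner_eval hornerC.
have gc := deriv_eq0 char0 g0.
have -> : evp (pt2 eta1 xi) H = g.[0].
  by rewrite gE; apply: eq_ev => // -[k|k] //=; rewrite mul0r addr0.
have -> : evp (pt2 eta2 xi) H = g.[1].
  by rewrite gE; apply: eq_ev => // -[k|k] //=; rewrite mul1r addrC subrK.
by rewrite gc !hornerC.
Qed.

(** The left variables are multiplied by a new variable X, so that the coefficient
   of X^d is the component of degree d in them. *)
Definition scaled (p : nat) (A : comAlgType K) (r : 'I_p -> A) (x : 'I_D -> A)
    (H : sym K ('I_p + 'I_D)%type) : {poly A} :=
  ev (@polyC A \o GRing.in_alg A)
     (fun z => match z with inl k => r k *: 'X | inr k => (x k)%:P end) H.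

Lemma scaled_horner p (A : comAlgType K) (r : 'I_p -> A) x H (t : K) :
  (scaled r x H).[t%:A] =
  subst (fun z => match z with inl k => t *: r k | inr k => x k end) H.
Proof.
rewrite -/(horner_eval _ _) /scaled rmorph_ev subst_ev.
apply: eq_ev => [k|[k|k]] /=; rewrite /horner_eval ?hornerC //.
by rewrite hornerZ hornerX mulr_algr.
Qed.

Definition scaledp p (r : 'I_p -> K) (x : 'I_D -> K) (H : sym K ('I_p + 'I_D)%type) :
    {poly K} :=
  ev (@polyC K) (fun z => match z with inl k => r k *: 'X | inr k => (x k)%:P end) H.

Lemma scaledp_horner p (r : 'I_p -> K) x H (t : K) :
  (scaledp r x H).[t] = evp (pt2 (fun k => t * r k) x) H.
Proof.
rewrite -/(horner_eval _ _) /scaledp rmorph_ev.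
apply: eq_ev => [k|[k|k]] /=; rewrite /horner_eval ?hornerC //.
by rewrite hornerZ hornerX mulrC.
Qed.

Lemma evp_scaled p (I : choiceType) (r : 'I_p -> sym K I) x H (pt : I -> K) :
  map_poly (evp pt) (scaled r x H) =
  scaledp (fun k => evp pt (r k)) (fun k => evp pt (x k)) H.
Proof.
rewrite /scaled rmorph_ev; apply: eq_ev => [k|[k|k]] /=.
- by rewrite map_polyC /= evpZ rmorph1 mulr1.
- by rewrite map_polyZ map_polyX.
- by rewrite map_polyC.
Qed.

Definition at_ell : sym K ('I_m + 'I_D)%type -> S2 :=
  subst (fun z => match z with inl i => ell i | inr k => gen K (inr k) end).
HB.instance Definition _ := GRing.LRMorphism.on at_ell.

Lemma evp_at_ell eta xi Q : evp (pt2 eta xi) (at_ell Q) =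
  evp (pt2 (fun i => (jacp xi *m (\col_k eta k)) i 0) xi) Q.
Proof.
rewrite evp_subst; apply: eq_ev => // -[k|k] /=; first exact: evp_ell.
by rewrite evp_gen.
Qed.

Lemma minor_neq0 : exists N, minor N != 0.
Proof.
have [t [N tN]] := F_reg; exists N; apply: contraNneq tN => N0.
by rewrite -evp_minor N0 rmorph0.
Qed.

Lemma inrS_eq0 p (f : S) : inrS 'I_p f = 0 -> f = 0.
Proof.
move=> f0; apply: (eq_sym_pt char0) => t.
by rewrite -(@evp_inrS p (fun=> 0) t) f0 !rmorph0.
Qed.

(** Where the minor of N does not vanish, the map from eta to (ell_i) is onto, by
   inverting dF N; so a relation between the ell_i vanishes at all points over
   a dense open set. *)
Lemma at_ell_inj Q : at_ell Q = 0 -> Q = 0.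
Proof.
move=> Q0; have [N N0] := minor_neq0.
apply: (eq_sym_pt_gen char0 (d := inrS 'I_m (minor N))).
  by apply: contraNneq N0 => /inrS_eq0->.
move=> t; set y := t \o inl; set xi := t \o inr.
rewrite (_ : evp t = evp (pt2 y xi)); last first.
  by congr (evp _); apply: funext => -[].
rewrite evp_inrS evp_minor => dN.
pose M := jacp xi *m N; pose eta := N *m (invmx M *m (\col_i y i)).
have := evp_at_ell (fun k => eta k 0) xi Q; rewrite Q0 !rmorph0 => e.
rewrite e; apply: eq_ev => // -[i|k] //=.
have -> : \col_k eta k 0 = eta by apply/matrixP => k j; rewrite !mxE ord1.
rewrite /eta mulmxA -/M mulKVmx ?mxE //.
by rewrite unitmxE unitfE.
Qed.

(** Cramer's rule: for eta = N adj(dF N) y the linear forms are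
   ell(eta) = det(dF N) y. *)
Definition rvec (N : 'M[K]_(D, m)) (k : 'I_D) : sym K ('I_m + 'I_D)%type :=
  \sum_i inrS 'I_m ((map_mx (GRing.in_alg S) N *m
     \adj (jac *m map_mx (GRing.in_alg S) N)) k i) * gen K (inl i).

Lemma evp_rvec N k y xi : evp (pt2 y xi) (rvec N k) =
  (N *m \adj (jacp xi *m N) *m \col_i y i) k 0.
Proof.
rewrite /rvec rmorph_sum mxE; apply: eq_bigr => i _.
rewrite rmorphM /= evp_inrS evp_gen; congr (_ * _); last by rewrite mxE.
rewrite -(_ : map_mx (evp xi) (map_mx (GRing.in_alg S) N *m
     \adj (jac *m map_mx (GRing.in_alg S) N)) = N *m \adj (jacp xi *m N)).
  by rewrite !mxE.
have inK : map_mx (evp xi) (map_mx (GRing.in_alg S) N) = N.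
  by apply/matrixP => a b; rewrite !mxE /= evpZ rmorph1 mulr1.
by rewrite map_mxM map_mx_adj map_mxM inK.
Qed.

(** At a regular point, det(dF N) eta and N adj(dF N) ell(eta) have the same image
   under dF, hence H takes the same value at them. Comparing the components of
   degree d gives the power of the minor. *)
Lemma Efield_component (H : S2) : (forall y, Efield y H = 0) ->
  forall N d, minor N != 0 ->
  inrS 'I_D (minor N) ^+ d *
    (scaled (fun k => gen K (inl k)) (fun k => gen K (inr k)) H)`_d =
  at_ell (scaled (rvec N) (fun k => gen K (inr k)) H)`_d.
Proof.
move=> EH N d N0; have [del del0 reg] := regular_open.
apply: (eq_sym_pt_gen char0 (d := inrS 'I_D (del * minor N))).
  have : del * minor N != 0 by rewrite mulf_neq0.
  by apply: contraNneq => /inrS_eq0->.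
move=> t; set eta := t \o inl; set xi := t \o inr.
rewrite (_ : evp t = evp (pt2 eta xi)); last first.
  by congr (evp _); apply: funext => -[].
rewrite evp_inrS rmorphM /= mulf_eq0 negb_or evp_minor => /andP[/reg rA dN].
rewrite evp_at_ell rmorphM rmorphXn /= evp_inrS evp_minor.
rewrite -!coef_map /= !evp_scaled.
set c := \det _; set P := scaledp _ _ _; set Q := scaledp _ _ _.
suff eQ : P \Po (c *: 'X) = Q.
  by rewrite -eQ -coef_comp_scale.
apply: (eq_poly_pt char0) => s; rewrite horner_comp hornerZ hornerX.
rewrite !scaledp_horner.
set eta1 := fun k => (c * s) * eta k.
set eta2 := fun k => s * evp (pt2 (fun i => (jacp xi *m \col_k eta k) i 0) xi) (rvec N k).
transitivity (evp (pt2 eta1 xi) H).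
  by apply: eq_ev => // -[k|k] /=; rewrite evp_gen.
transitivity (evp (pt2 eta2 xi) H); last first.
  by apply: eq_ev => // -[k|k] /=; rewrite ?evp_gen.
apply: (Efield_const EH rA); first by exists N.
have -> : \col_k eta1 k = (c * s) *: \col_k eta k.
  by apply/matrixP => a b; rewrite !mxE.
have -> : \col_k eta2 k =
    s *: (N *m \adj (jacp xi *m N) *m (jacp xi *m \col_k eta k)).
  apply/matrixP => a b; rewrite mxE [RHS]mxE /eta2 evp_rvec (ord1 b).
  congr (_ * (_ *m _) _ _).
  by apply/matrixP => a' b'; rewrite mxE (ord1 b').
rewrite -!scalemxAr !mulmxA mul_mx_adj mul_scalar_mx.
by rewrite -scalemxAl scalerA mulrC.
Qed.

(** Bigness, for the divisor defined by a prime b: it contains a point where some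
   minor does not vanish. *)
Lemma prime_minor (b : S) : prime_elt b -> b != 0 -> exists N, ~ divides b (minor N).
Proof.
move=> pb b0; have [|t bt [N tN]] := F_big (f := b).
  move=> [c ec]; have c0 : c != 0 by apply: contraNneq b0 => c0; rewrite ec c0 scale0r.
  apply: (proj1 pb); exists (c^-1)%:A.
  by rewrite ec -scalerAl mul1r scalerA mulVf // scale1r.
exists N => -[e ee]; case/eqP: tN.
by rewrite -evp_minor ee rmorphM /= bt mulr0.
Qed.

Lemma divides_inrS p (a : S) (Q : sym K ('I_p + 'I_D)%type) :
  (forall u, divides a (co u Q)) -> divides (inrS 'I_p a) Q.
Proof.
move=> H; have [U _ ->] := sym_expand Q.
elim/big_rec: _ => [|u x _ IH]; first exact: divides0.
apply: dividesD IH; apply: divides_mull.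
by have [e ->] := H u; exists (inrS 'I_p e); rewrite rmorphM.
Qed.

Lemma at_ell_inrS (f : S) : at_ell (inrS 'I_m f) = inrS 'I_D f.
Proof.
rewrite /at_ell /inrS lrmorph_subst; apply: eq_subst => k /=.
by rewrite subst_gen.
Qed.

(** By Efield_component the polynomials Q_N with minor(N)^d H_d = Q_N(xi, ell)
   satisfy minor(N)^d Q_N0 = minor(N0)^d Q_N, because the ell_i are free. As the
   minors have no common prime factor, minor(N0)^d divides Q_N0, and it can be
   cancelled. *)
Theorem Efield_invariants (H : S2) : (forall y, Efield y H = 0) ->
  exists Q, H = at_ell Q.
Proof.
move=> EH; have [N0 nz0] := minor_neq0.
pose Hd d := (scaled (fun k => gen K (inl k)) (fun k => gen K (inr k)) H)`_d.
have EHd d : exists Q, Hd d = at_ell Q.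
  pose Qd N := (scaled (rvec N) (fun k => gen K (inr k)) H)`_d.
  have Ecomp N : minor N != 0 -> inrS 'I_D (minor N) ^+ d * Hd d = at_ell (Qd N).
    exact: Efield_component.
  have ea N : at_ell (inrS 'I_m (minor N ^+ d)) = inrS 'I_D (minor N) ^+ d.
    exact: etrans (at_ell_inrS _) (rmorphXn _ _ _).
  move: (Hd d) Ecomp => {Hd} hd; clearbody Qd => Ecomp.
  have [e ee] : divides (inrS 'I_m (minor N0 ^+ d)) (Qd N0).
    apply: divides_inrS => u.
    apply: (ufd_cancel (@ufd_sym K D) prime_minor (k := d)).
      by rewrite expf_neq0.
    move=> N; have [mN|mN] := eqVneq (minor N) 0.
      rewrite mN; case: (d) => [|d']; last first.
        by rewrite expr0n /= mul0r; apply: divides0.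
      by exists (1 * co u (Qd N0)); rewrite !expr0 mulr1.
    exists (co u (Qd N)); apply: etrans (esym (co_inrM u _ _)) (etrans _ (mulrC _ _)).
    apply: etrans _ (co_inrM u _ _); apply: (congr1 (co u)).
    apply/eqP; rewrite -subr_eq0; apply/eqP/at_ell_inj.
    exact: (rmorph_cross (ea N) (ea N0) (Ecomp N mN) (Ecomp N0 nz0)).
  exists e; apply: (mulfI (_ : inrS 'I_D (minor N0) ^+ d != 0)).
    by rewrite expf_neq0 //; apply: contraNneq nz0 => /inrS_eq0->.
  apply: etrans (Ecomp N0 nz0) _; rewrite ee.
  apply: etrans (rmorphM at_ell _ _) _; rewrite /= (ea N0).
  exact: mulrC.
pose Hs := scaled (fun k => gen K (inl k)) (fun k => gen K (inr k)) H.
have HE : H = \sum_(d < size Hs) Hd d.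
  have := horner_coef Hs (1 : K)%:A; rewrite scaled_horner => e1.
  transitivity (\sum_(i < size Hs) Hs`_i * 1%:A ^+ i).
    rewrite -e1 -[LHS]subst_id; apply: eq_subst => -[k|k] //=.
    by rewrite scale1r.
  by apply: eq_bigr => i _; rewrite scale1r expr1n mulr1.
rewrite HE; elim/big_rec: _ => [|d x _ [Q ->]]; first by exists 0; rewrite rmorph0.
by have [Q' ->] := EHd d; exists (Q' + Q); rewrite rmorphD.
Qed.

End VectorFields.

(** * Divided differences and Newton interpolation *)

Section DividedDifference.
Variable A : comNzRingType.
Implicit Types (f g : {poly A}) (c : A).

(** The divided difference (f - f(c)) / (X - c). *)
Definition ddiff c f : {poly A} := Pdiv.Ring.rdivp f ('X - c%:P).

Lemma ddiffE c f : f = ddiff c f * ('X - c%:P) + (f.[c])%:P.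
Proof.
have e := Pdiv.RingMonic.rdivp_eq (monicXsubC c) f.
have [r er] : exists r, Pdiv.Ring.rmodp f ('X - c%:P) = r%:P.
  exists (Pdiv.Ring.rmodp f ('X - c%:P))`_0; apply: size1_polyC.
  have := Pdiv.CommonRing.ltn_rmodpN0 f (monic_neq0 (monicXsubC c)).
  by rewrite size_XsubC.
rewrite {1}e er /ddiff; congr (_ + _%:P).
by rewrite {1}e er hornerD hornerM_comm ?hornerXsubC ?subrr ?mulr0 ?add0r ?hornerC //; apply: mulrC.
Qed.

Lemma mul_XsubC_inj c f g : f * ('X - c%:P) = g * ('X - c%:P) -> f = g.
Proof. exact: (monic_rreg (monicXsubC c)). Qed.

Lemma ddiffP c f g r : f = g * ('X - c%:P) + r%:P -> ddiff c f = g /\ f.[c] = r.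
Proof.
move=> e; have er : f.[c] = r.
  by rewrite e hornerD hornerM hornerXsubC subrr mulr0 add0r hornerC.
split=> //; apply: (@mul_XsubC_inj c).
by apply: (addIr r%:P); rewrite -e -er -ddiffE.
Qed.

Lemma ddiff_linear c (x : A) f g : ddiff c (x *: f + g) = x *: ddiff c f + ddiff c g.
Proof.
apply: (proj1 (ddiffP (r := x * f.[c] + g.[c]) _)).
rewrite {1}(ddiffE c f) {1}(ddiffE c g) mulrDl scalerDr polyCD polyCM.
by rewrite -scalerAl mul_polyC addrACA.
Qed.

End DividedDifference.

(** The map phi is only additive and compatible with the multiplication by c: it
   will be a derivation, or a linear map. *)
Lemma ddiff_map (A B : comNzRingType) (phi : A -> B) (c : A) (d : B) (f : {poly A}) :
  (forall x y, phi (x + y) = phi x + phi y) -> (forall x, phi (x * c) = phi x * d) ->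
  map_poly phi (ddiff c f) = ddiff d (map_poly phi f) /\
  (map_poly phi f).[d] = phi f.[c].
Proof.
move=> phiD phic; have phi0 : phi 0 = 0.
  by apply: (addrI (phi 0)); rewrite -phiD !addr0.
have phiN x : phi (- x) = - phi x by apply: (addrI (phi x)); rewrite -phiD !subrr.
suff e : map_poly phi f = map_poly phi (ddiff c f) * ('X - d%:P) + (phi f.[c])%:P.
  by have [-> ->] := ddiffP e.
apply/polyP => i; rewrite coef_map_id0 // {1}(ddiffE c f).
rewrite !mulrBr !coefD !coefN !coefMX !coefMC !coefC !phiD !phiN phic !coef_map_id0 //.
by case: i => [|i] /=; rewrite ?phi0.
Qed.

Section Newton.
Variables (K : fieldType) (a : nat -> K).

Definition newton (A : comAlgType K) (n : nat) : {poly A} :=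
  \prod_(l < n) ('X - ((a l)%:A)%:P).

Section Fixed.
Variable A : comAlgType K.
Implicit Types f g : {poly A}.
Local Notation N := (newton A).

Lemma newton0 : N 0 = 1. Proof. by rewrite /newton big_ord0. Qed.

Lemma newtonS n : N n.+1 = N n * ('X - ((a n)%:A)%:P).
Proof. by rewrite /newton big_ord_recr. Qed.

Lemma newton_monic n : N n \is monic.
Proof. by apply: monic_prod => i _; apply: monicXsubC. Qed.

Lemma size_newton n : size (N n) = n.+1.
Proof.
elim: n => [|n IHn]; first by rewrite newton0 size_poly1.
by rewrite newtonS size_Mmonic ?monicXsubC ?monic_neq0 ?newton_monic // IHn size_XsubC addn2.
Qed.

(** The quotient of f by the n-th Newton polynomial. Its value at the next node is
   the n-th coordinate of f in the basis of the Newton polynomials. *)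
Fixpoint nrem n f : {poly A} :=
  if n is n'.+1 then ddiff (a n')%:A (nrem n' f) else f.

Definition nc n f : A := (nrem n f).[(a n)%:A].

Lemma nremS n f : nrem n.+1 f = ddiff (a n)%:A (nrem n f).
Proof. by []. Qed.

Lemma nrem_linear n (x : A) f g : nrem n (x *: f + g) = x *: nrem n f + nrem n g.
Proof. by elim: n => [|n IHn] //=; rewrite IHn ddiff_linear. Qed.

Lemma nc_linear n (x : A) f g : nc n (x *: f + g) = x * nc n f + nc n g.
Proof. by rewrite /nc nrem_linear hornerD hornerZ. Qed.

Lemma ncD n f g : nc n (f + g) = nc n f + nc n g.
Proof. by rewrite -[f]scale1r nc_linear mul1r scale1r. Qed.

Lemma nc0 n : nc n 0 = 0.
Proof. by apply: (addrI (nc n 0)); rewrite -ncD !addr0. Qed.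

Lemma ncZ n (x : A) f : nc n (x *: f) = x * nc n f.
Proof. by rewrite -[x *: f]addr0 nc_linear nc0 addr0. Qed.

Lemma ncN n f : nc n (- f) = - nc n f.
Proof. by rewrite -scaleN1r ncZ mulN1r. Qed.

Lemma nc_sum n (T : Type) (r : seq T) (P : pred T) (G : T -> {poly A}) :
  nc n (\sum_(t <- r | P t) G t) = \sum_(t <- r | P t) nc n (G t).
Proof. by elim/big_rec2: _ => [|t y1 y2 _ <-]; rewrite ?nc0 ?ncD. Qed.

Lemma newton_expand n f : f = \sum_(j < n) nc j f *: N j + N n * nrem n f.
Proof.
elim: n => [|n IHn]; first by rewrite big_ord0 add0r newton0 mul1r.
rewrite big_ord_recr /= newtonS {1}IHn -addrA; congr (_ + _).
rewrite {1}(ddiffE (a n)%:A (nrem n f)) mulrDr addrC -/(nc n f).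
by rewrite [N n * _%:P]mulrC mul_polyC -mulrA [('X - _) * _]mulrC.
Qed.

Lemma nrem_newton n g : nrem n (N n * g) = g.
Proof.
elim: n g => [|n IHn] g; first by rewrite newton0 mul1r.
rewrite newtonS -mulrA /= IHn.
by apply: (proj1 (ddiffP (r := 0) _)); rewrite addr0 mulrC.
Qed.

Lemma nc_newton n g : nc n (N n * g) = g.[(a n)%:A].
Proof. by rewrite /nc nrem_newton. Qed.

Lemma newton_split j n : (j <= n)%N -> exists h, N n = N j * h.
Proof.
elim: n => [|n IHn]; first by rewrite leqn0 => /eqP->; exists 1; rewrite mulr1.
rewrite leq_eqVlt => /predU1P[->|]; first by exists 1; rewrite mulr1.
by rewrite ltnS => /IHn[h eh]; exists (h * ('X - ((a n)%:A)%:P)); rewrite newtonS eh mulrA.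
Qed.

(** Newton coordinates of index j < n only depend on the class modulo the n-th
   Newton polynomial. This is used throughout to discard multiples of it. *)
Lemma nc_newton_lt j n g : (j < n)%N -> nc j (N n * g) = 0.
Proof.
move=> /newton_split[h ->]; rewrite newtonS -!mulrA nc_newton.
by rewrite hornerM hornerXsubC subrr mul0r.
Qed.

Lemma nc_basis j l : nc j (N l) = (j == l)%:R.
Proof.
have [lt_jl|lt_lj|->] := ltngtP j l.
- by rewrite -[N l]mulr1 nc_newton_lt.
- have e := newton_expand l.+1 (N l).
  have nl : nrem l (N l) = 1 by rewrite -{1}[N l]mulr1 nrem_newton.
  have n0 : nrem l.+1 (N l) = 0.
    by rewrite /= nl; apply: (proj1 (ddiffP (r := 1) _)); rewrite mul0r add0r.
  have nk k : nrem (l.+1 + k) (N l) = 0.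
    elim: k => [|k IHk]; first by rewrite addn0.
    by rewrite addnS nremS IHk; apply: (proj1 (ddiffP (r := 0) _)); rewrite mul0r add0r.
  by rewrite /nc -(subnKC lt_lj) nk horner0.
- by rewrite -{1}[N l]mulr1 nc_newton hornerC.
Qed.

Lemma nc_size f n : (size f <= n)%N -> f = \sum_(j < n) nc j f *: N j.
Proof.
move=> sf; have e := newton_expand n f.
suff n0 : nrem n f = 0 by rewrite {1}e n0 mulr0 addr0.
apply/eqP; apply: contraTT sf => n0; rewrite -ltnNge {1}e.
have sN : (n < size (N n * nrem n f)%R)%N.
  rewrite size_monicM ?newton_monic // size_newton.
  by rewrite addSn /= -[X in (X < _)%N]addn0 ltn_add2l size_poly_gt0.
rewrite addrC size_polyDl //; apply: leq_ltn_trans sN.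
apply: leq_trans (size_sum _ _ _) _; apply/bigmax_leqP => j _.
by apply: leq_trans (size_scale_leq _ _) _; rewrite size_newton.
Qed.

End Fixed.

Lemma nc_map (A B : comAlgType K) (phi : A -> B) j (f : {poly A}) :
  (forall x y, phi (x + y) = phi x + phi y) ->
  (forall k x, phi (k *: x) = k *: phi x) ->
  phi (nc j f) = nc j (map_poly phi f).
Proof.
move=> phiD phiZ.
have phic l x : phi (x * (a l)%:A) = phi x * (a l)%:A by rewrite !mulr_algr.
have nremE n : map_poly phi (nrem n f) = nrem n (map_poly phi f).
  elim: n => [|n IHn] //=; rewrite -IHn.
  by have [] := ddiff_map (nrem n f) phiD (phic n).
rewrite /nc -nremE; have [_ ->] := ddiff_map (nrem j f) phiD (phic j).
by [].
Qed.

End Newton.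

(** * Generic currents in Newton coordinates *)

Lemma rmorph_dext (K : fieldType) (I : choiceType) (A B : comNzRingType)
    (e : {rmorphism sym K I -> A}) (phi : {rmorphism A -> B}) (w : I -> A) f :
  phi (dext e w f) = dext (phi \o e) (phi \o w) f.
Proof. by rewrite /dext rmorph_sum; apply: eq_bigr => i _; rewrite rmorphM. Qed.

Lemma eq_dext (K : fieldType) (I : choiceType) (A : comNzRingType)
    (e1 e2 : {rmorphism sym K I -> A}) (w1 w2 : I -> A) f :
  e1 =1 e2 -> w1 =1 w2 -> dext e1 w1 f = dext e2 w2 f.
Proof. by move=> ee ew; apply: eq_bigr => i _; rewrite ee ew. Qed.

Lemma dext_subst (K : fieldType) (I J : choiceType) (w : I -> sym K I)
    (v : J -> sym K I) (f : sym K J) :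
  dext idfun w (subst v f) = dext (subst v) (dext idfun w \o v) f.
Proof.
rewrite subst_ev (@derivation_ev _ _ _ _ _ _ idfun (dext idfun w)) //=.
- by apply: eq_dext => // g; rewrite /= subst_ev.
- exact: dextD.
- exact: dextM.
- exact: dextC.
Qed.

(** Evaluation is a ring morphism, so it respects congruences modulo N. *)
Lemma ev_cong (K : fieldType) (I : choiceType) (A : comNzRingType)
    (c : {rmorphism K -> A}) (v w r : I -> A) (N : A) (f : sym K I) :
  (forall i, v i = w i + N * r i) -> exists g, ev c v f = ev c w f + N * g.
Proof.
move=> e; elim/sym_ind: f => [k|f g [x ex] [y ey]|i f [x ex]].
- by exists 0; rewrite !evC mulr0 addr0.
- by exists (x + y); rewrite !rmorphD /= ex ey mulrDr addrACA.
exists (w i * x + r i * ev c w f + N * r i * x).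
rewrite !rmorphM /= !ev_gen e ex; move: (ev c w f) (w i) (r i) => F W R.
by ring.
Qed.

(** Taylor expansion to first order, the remainder being a multiple of N^2. *)
Lemma ev_taylor (K : fieldType) (I : finType) (A : comNzRingType)
    (c : {rmorphism K -> A}) (v w r : I -> A) (N : A) (f : sym K I) :
  (forall i, v i = w i + N * r i) ->
  exists g, ev c v f = ev c w f + N * (\sum_i ev c w (pderiv i f) * r i) + N ^+ 2 * g.
Proof.
move=> e; have dE h : \sum_i ev c w (pderiv i h) * r i = dext (ev c w) r h.
  by rewrite dext_fin.
rewrite dE; elim/sym_ind: f => [k|f g [x ex] [y ey]|i f [x ex]].
- by exists 0; rewrite dextC !evC !mulr0 !addr0.
- by exists (x + y); rewrite dextD !rmorphD /= ex ey !mulrDr addrACA [X in X + _]addrACA.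
exists (w i * x + r i * dext (ev c w) r f + N * r i * x).
rewrite dextM dext_gen !rmorphM /= !ev_gen e ex expr2.
move: (ev c w f) (dext _ r f) (w i) (r i) => F D W R.
by ring.
Qed.

Section Trunc.
Variables (K : fieldType) (D : nat).
Local Notation I := ('I_D * nat)%type.
Local Notation S := (sym K I).

(** The polynomials in the layers j < n are encoded as the fixed points of this
   projection, so that all layers live in a single ring. *)
Definition trunc (n : nat) : S -> S :=
  subst (fun b : I => if (b.2 < n)%N then gen K b else 0).
HB.instance Definition _ n := GRing.LRMorphism.on (trunc n).

Lemma trunc_gen n b : trunc n (gen K b) = if (b.2 < n)%N then gen K b else 0.
Proof. exact: subst_gen. Qed.

Lemma trunc_trunc n n' f : trunc n (trunc n' f) = trunc (minn n n') f.
Proof.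
rewrite /trunc lrmorph_subst; apply: eq_subst => b /=; rewrite ltn_min andbC.
by case: ifP => _; rewrite ?rmorph0 // subst_gen.
Qed.

Lemma trunc_id n f : trunc n (trunc n f) = trunc n f.
Proof. by rewrite trunc_trunc minnn. Qed.

Lemma trunc_le n n' f : (n <= n')%N -> trunc n f = f -> trunc n' f = f.
Proof. by move=> le_n <-; rewrite trunc_trunc (minn_idPr le_n). Qed.

End Trunc.

Section CurrentAlgebra.
Variables (K : fieldType) (D : nat) (a : nat -> K).
Local Notation I := ('I_D * nat)%type.
Local Notation S := (sym K I).
Local Notation Sq := (sym K 'I_D).
Local Notation N := (newton a S).
Local Notation nc := (nc a).

(** The generic element, of degree less than n, with the variables as its Newton
   coordinates; evx substitutes it into a polynomial on the dual of q. *)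
Definition xi (n : nat) (i : 'I_D) : {poly S} := \sum_(j < n) gen K (i, val j) *: N j.

Definition evx (n : nat) : Sq -> {poly S} :=
  ev (@polyC S \o GRing.in_alg S) (xi n).
HB.instance Definition _ n := GRing.RMorphism.on (evx n).

(** Any bound n > j on the layers gives the same coordinate (nc_evx); the least one
   shows which variables occur. *)
Definition newton_coef (j : nat) (f : Sq) : S := nc j (evx j.+1 f).

Lemma xiS n i : xi n.+1 i = xi n i + N n * (gen K (i, n))%:P.
Proof. by rewrite /xi big_ord_recr /= mulrC mul_polyC. Qed.

Lemma xi_split j n i : (j <= n)%N -> exists g, xi n i = xi j i + N j * g.
Proof.
elim: n => [|n IHn]; first by rewrite leqn0 => /eqP->; exists 0; rewrite mulr0 addr0.
rewrite leq_eqVlt => /predU1P[->|]; first by exists 0; rewrite mulr0 addr0.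
rewrite ltnS => le_jn; have [g eg] := IHn le_jn.
have [h eh] := newton_split a S le_jn.
by exists (g + h * (gen K (i, n))%:P); rewrite xiS eg eh mulrDr mulrA addrA.
Qed.

Lemma evx_split j n f : (j <= n)%N -> exists g, evx n f = evx j f + N j * g.
Proof.
move=> le_jn; have /choice[r er] := fun i => xi_split i le_jn.
exact: ev_cong er.
Qed.

Lemma nc_evx j n f : (j < n)%N -> nc j (evx n f) = newton_coef j f.
Proof.
move=> lt_jn; have [g ->] := evx_split f lt_jn.
by rewrite ncD nc_newton_lt // addr0.
Qed.

Lemma nc_newton_evx l j n f : (j < n)%N -> nc j (N l * evx n f) = nc j (N l * evx j.+1 f).
Proof.
move=> lt_jn; have [g ->] := evx_split f lt_jn.
by rewrite mulrDr ncD (mulrCA (N l) (N j.+1)) (nc_newton_lt _ _ (ltnSn j)) addr0.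
Qed.

Section Derivation.
Variables (L : 'I_D -> 'I_D -> Sq).

(** The field of y t^l, the function t^l being replaced by the Newton polynomial
   N_l: on the generic element it acts as multiplication by N_l after the
   bracket with y. As for newton_coef, any larger bound on the layers gives the
   same coordinate (nc_newton_evx). *)
Definition D_cur (y : 'I_D) (l : nat) : S -> S :=
  dext idfun (fun b : I => nc b.2 (N l * evx b.2.+1 (L y b.1))).

Lemma D_cur_gen y l n i j : (j < n)%N ->
  D_cur y l (gen K (i, j)) = nc j (N l * evx n (L y i)).
Proof. by move=> lt_jn; rewrite /D_cur dext_gen (nc_newton_evx l _ lt_jn). Qed.

Lemma D_curD y l f g : D_cur y l (f + g) = D_cur y l f + D_cur y l g.
Proof. exact: dextD. Qed.

Lemma D_curM y l f g : D_cur y l (f * g) = D_cur y l f * g + f * D_cur y l g.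
Proof. exact: dextM. Qed.

Lemma D_curC y l (k : K) : D_cur y l k%:A = 0.
Proof. exact: dextC. Qed.

Lemma D_curZ y l (k : K) f : D_cur y l (k *: f) = k *: D_cur y l f.
Proof. by rewrite -mulr_algl D_curM D_curC mul0r add0r mulr_algl. Qed.

Lemma D_cur0 y l : D_cur y l 0 = 0.
Proof. exact: dext0. Qed.

Lemma D_cur_is_linear y l : linear (D_cur y l).
Proof. by move=> k f g; rewrite D_curD D_curZ. Qed.
HB.instance Definition _ y l :=
  GRing.isLinear.Build K S S *:%R (D_cur y l) (D_cur_is_linear y l).

Lemma map_D_cur_XsubC y l (g : {poly S}) (k : K) :
  map_poly (D_cur y l) (g * ('X - (k%:A)%:P)) = map_poly (D_cur y l) g * ('X - (k%:A)%:P).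
Proof.
apply/polyP => i; rewrite coef_map !mulrBr !coefB !coefMX !coefMC raddfB /= !coef_map.
rewrite !mulr_algr D_curZ; congr (_ - _).
by case: i => [|i] //=; rewrite raddf0.
Qed.

Lemma map_D_cur_newton y l (c : S) n :
  map_poly (D_cur y l) (c *: N n) = D_cur y l c *: N n.
Proof.
elim: n => [|n IHn]; first by rewrite newton0 !alg_polyC map_polyC.
by rewrite newtonS scalerAl map_D_cur_XsubC IHn scalerAl.
Qed.

Lemma map_D_curD y l (f g : {poly S}) :
  map_poly (D_cur y l) (f + g) = map_poly (D_cur y l) f + map_poly (D_cur y l) g.
Proof. exact: raddfD. Qed.

Lemma map_D_curM y l (f g : {poly S}) : map_poly (D_cur y l) (f * g) =
  map_poly (D_cur y l) f * g + f * map_poly (D_cur y l) g.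
Proof.
apply/polyP => i; rewrite coefD coef_map !coefM raddf_sum -big_split.
by apply: eq_bigr => j _; rewrite /= D_curM !coef_map.
Qed.

Lemma map_D_cur_xi y l n i : exists g,
  map_poly (D_cur y l) (xi n i) = N l * evx n (L y i) - N n * g.
Proof.
exists (nrem a n (N l * evx n (L y i))).
rewrite {1}(newton_expand a n (N l * evx n (L y i))) addrK /xi.
by rewrite raddf_sum; apply: eq_bigr => j _; rewrite /= map_D_cur_newton (D_cur_gen _ _ _ (ltn_ord j)).
Qed.

(** The field sends xi to N_l [y, .](xi) modulo a Newton polynomial, hence F(xi) to
   N_l times the derivative of F along y, taken at xi, which is 0. *)
Lemma D_cur_newton_coef (f : Sq) : (forall y, dext idfun (L y) f = 0) ->
  forall y l j, D_cur y l (newton_coef j f) = 0.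
Proof.
move=> finv y l j; rewrite /newton_coef.
rewrite (nc_map a j _ (@D_curD y l) (@D_curZ y l)).
rewrite {1}/evx (@derivation_ev _ _ _ _ _ _ idfun (map_poly (D_cur y l))); last first.
- by move=> k; rewrite /= -[_%:P]alg_polyC -(newton0 a S) map_D_cur_newton D_curC scale0r.
- exact: map_D_curM.
- exact: map_D_curD.
rewrite dext_fin /=; have /choice[g eg] := map_D_cur_xi y l j.+1.
transitivity (nc j (N l * evx j.+1 (dext idfun (L y) f) -
   N j.+1 * \sum_k evx j.+1 (pderiv k f) * g k)); last first.
  by rewrite finv rmorph0 mulr0 sub0r ncN nc_newton_lt ?oppr0.
congr (nc j _); rewrite dext_fin rmorph_sum !mulr_sumr -sumrB.
apply: eq_bigr => k _; rewrite rmorphM /= eg mulrBr.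
by congr (_ - _); rewrite mulrCA.
Qed.

Lemma map_trunc_newton n l : map_poly (trunc n) (N l) = N l.
Proof.
rewrite /newton rmorph_prod; apply: eq_bigr => j _ /=.
by rewrite rmorphB /= map_polyX map_polyC /= linearZ /= rmorph1.
Qed.

Lemma map_trunc_evx n j f : (j <= n)%N -> map_poly (trunc n) (evx j f) = evx j f.
Proof.
move=> le_jn; rewrite /evx rmorph_ev; apply: eq_ev => [k|i] /=.
  by rewrite map_polyC /= linearZ /= rmorph1.
rewrite raddf_sum; apply: eq_bigr => k _ /=.
rewrite map_polyZ /= map_trunc_newton trunc_gen /=.
by rewrite (leq_trans (ltn_ord k) le_jn).
Qed.

Lemma trunc_nc n j (f : {poly S}) : trunc n (nc j f) = nc j (map_poly (trunc n) f).
Proof. by apply: nc_map => [f1 f2|k f1]; rewrite ?rmorphD ?linearZ. Qed.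

Lemma trunc_newton_coef n j f : (j < n)%N -> trunc n (newton_coef j f) = newton_coef j f.
Proof. by move=> lt_jn; rewrite /newton_coef trunc_nc map_trunc_evx. Qed.

Lemma D_cur_subst y l (J : choiceType) (v : J -> S) (f : sym K J) :
  D_cur y l (subst v f) = dext (subst v) (D_cur y l \o v) f.
Proof. exact: dext_subst. Qed.

Lemma trunc_D_cur n y l f : trunc n f = f -> trunc n (D_cur y l f) = D_cur y l f.
Proof.
move=> <-; rewrite {2 3}/trunc D_cur_subst rmorph_dext; apply: eq_dext => [g|b] /=.
  exact: trunc_id.
case: ifP => [lt_bn|_]; last by rewrite D_cur0 rmorph0.
case: b lt_bn => i j /= lt_jn; rewrite (D_cur_gen y l i (ltnSn j)) trunc_nc rmorphM /=.
by rewrite map_trunc_newton map_trunc_evx.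
Qed.

End Derivation.
End CurrentAlgebra.

(** * Invariants of truncated currents *)

Lemma dext_scale (K : fieldType) (I : choiceType) (A : comAlgType K)
    (e : {rmorphism sym K I -> A}) (w : I -> A) (k : K) f :
  dext e (fun i => k *: w i) f = k *: dext e w f.
Proof. by rewrite /dext scaler_sumr; apply: eq_bigr => i _; rewrite scalerAr. Qed.

Section ExtendDerivation.
Variables (K : fieldType) (P C : choiceType) (w : C -> sym K C).

Definition dext_inr : sym K (P + C)%type -> sym K (P + C)%type :=
  dext idfun (fun z => if z is inr c then inrS P (w c) else 0).

Lemma dext_inrZ k f : dext_inr (k *: f) = k *: dext_inr f.
Proof. by rewrite /dext_inr dextZ /= mulr_algl. Qed.

Lemma dext_inrD f g : dext_inr (f + g) = dext_inr f + dext_inr g.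
Proof. exact: dextD. Qed.

Lemma dext_inr_gen c : dext_inr (gen K (inr c)) = inrS P (w c).
Proof. exact: dext_gen. Qed.

Lemma dext_inr_sum (T : Type) (r : seq T) (Q : pred T) (G : T -> sym K (P + C)%type) :
  dext_inr (\sum_(t <- r | Q t) G t) = \sum_(t <- r | Q t) dext_inr (G t).
Proof.
rewrite /dext_inr; elim/big_rec2: _ => [|t y1 y2 _ <-]; first by rewrite dext0.
by rewrite dextD.
Qed.

Lemma dext_inr_inlS f : dext_inr (inlS C f) = 0.
Proof.
by rewrite /dext_inr /inlS dext_subst; apply: big1 => i _; rewrite /= dext_gen mulr0.
Qed.

Lemma dext_inr_inrS G : dext_inr (inrS P G) = inrS P (dext idfun w G).
Proof.
rewrite rmorph_dext /dext_inr {1}/inrS dext_subst; apply: eq_dext => // c /=.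
by rewrite dext_gen.
Qed.

Lemma dext_inr_mono u G : dext_inr (inlS C (mono K u) * inrS P G) =
  inlS C (mono K u) * inrS P (dext idfun w G).
Proof.
by rewrite {1}/dext_inr dextM -!/(dext_inr _) dext_inr_inlS mul0r add0r dext_inr_inrS.
Qed.

End ExtendDerivation.

Section Invariants.
Variables (K : fieldType) (char0 : [pchar K] =i pred0) (D m : nat) (a : nat -> K).
Local Notation I := ('I_D * nat)%type.
Local Notation S := (sym K I).
Local Notation Sq := (sym K 'I_D).
Local Notation N := (newton a S).
Local Notation nc := (nc a).
Variables (L : 'I_D -> 'I_D -> Sq) (F : 'I_m -> Sq).

Hypothesis F_inv : forall i y, dext idfun (L y) (F i) = 0.
Hypothesis L_index : exists t, (\rank (kermx (adp L t)) <= m)%N.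
Hypothesis F_reg : exists t (M : 'M[K]_(D, m)), \det (jacp F t *m M) != 0.
Hypothesis F_big : forall f : Sq, ~ (exists c : K, f = c%:A) ->
  exists2 t, evp t f = 0 & exists M : 'M[K]_(D, m), \det (jacp F t *m M) != 0.
Hypothesis F_gen : forall H : Sq, (forall y, dext idfun (L y) H = 0) ->
  exists P, H = subst F P.
Hypothesis F_indep : alg_independent F.

Section Step.
Variable n : nat.

(** Polynomials in the elements Psi_i and in the lower layers; the right variables
   are truncated so that only the layers j < n are used. *)
Definition at_gen (Psi : 'I_m -> S) : sym K ('I_m + I)%type -> S :=
  subst (fun z => match z with inl i => Psi i | inr b => trunc n (gen K b) end).
HB.instance Definition _ Psi := GRing.LRMorphism.on (at_gen Psi).

(** The map at_gen kills the variables of the layers from n on, so that freeness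
   means that a relation vanishes after these variables are removed. *)
Definition truncr : sym K ('I_m + I)%type -> sym K ('I_m + I)%type :=
  subst (fun z => match z with inl i => gen K (inl i) | inr b => inrS 'I_m (trunc n (gen K b)) end).
HB.instance Definition _ := GRing.LRMorphism.on truncr.

Definition generates_layer (Psi : 'I_m -> S) : Prop :=
  forall H, trunc n.+1 H = H -> (forall y, D_cur a L y n H = 0) ->
  exists Q, H = at_gen Psi Q.

Definition free_layer (Psi : 'I_m -> S) : Prop :=
  forall Q, at_gen Psi Q = 0 -> truncr Q = 0.

Lemma at_gen_inr Psi f : at_gen Psi (inrS 'I_m f) = trunc n f.
Proof.
by rewrite /at_gen /inrS lrmorph_subst; apply: eq_subst => b /=; rewrite subst_gen trunc_gen.
Qed.

Lemma at_gen_inl Psi (i : 'I_m) : at_gen Psi (gen K (inl i)) = Psi i.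
Proof. exact: subst_gen. Qed.

Lemma truncr_inr f : truncr (inrS 'I_m f) = inrS 'I_m (trunc n f).
Proof.
rewrite /truncr /inrS /trunc !lrmorph_subst; apply: eq_subst => b /=.
by rewrite !subst_gen.
Qed.

Lemma truncr_inl (i : 'I_m) : truncr (gen K (inl i)) = gen K (inl i).
Proof. exact: subst_gen. Qed.

Definition shift (k : K) (s : 'I_m -> S) :
    sym K ('I_m + I)%type -> sym K ('I_m + I)%type :=
  subst (fun z => match z with
    | inl i => k *: gen K (inl i) + inrS 'I_m (s i) | inr b => gen K (inr b) end).
HB.instance Definition _ k s := GRing.LRMorphism.on (shift k s).

Lemma shift_inl k s (i : 'I_m) :
  shift k s (gen K (inl i)) = k *: gen K (inl i) + inrS 'I_m (s i).
Proof. exact: subst_gen. Qed.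

Lemma shift_inr k s f : shift k s (inrS 'I_m f) = inrS 'I_m f.
Proof.
rewrite /shift /inrS lrmorph_subst; apply: eq_subst => b /=.
by rewrite !subst_gen.
Qed.

Lemma at_gen_shift Psi k s Q : (forall i, trunc n (s i) = s i) ->
  at_gen Psi (shift k s Q) = at_gen (fun i => k *: Psi i + s i) Q.
Proof.
move=> es; rewrite {2}/at_gen /shift lrmorph_subst; apply: eq_subst => -[i|b] /=.
  by rewrite rmorphD /= linearZ /= at_gen_inl at_gen_inr es.
by rewrite -[gen K (inr b)]inrS_gen at_gen_inr.
Qed.

(** Both properties are unchanged when the generators undergo an invertible affine
   substitution over the lower layers. This passes from the elements suggested by
   the geometry to the Newton coordinates of the F_i. *)
Lemma layer_shift (Psi Phi : 'I_m -> S) (k : K) s : k != 0 ->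
  (forall i, trunc n (s i) = s i) -> (forall i, Psi i = k *: Phi i + s i) ->
  (generates_layer Psi -> generates_layer Phi) /\ (free_layer Psi -> free_layer Phi).
Proof.
move=> k0 es ePsi; have Psi_eq : Psi = fun i => k *: Phi i + s i by apply: funext.
split=> [gP H tH DH|fP Q Q0].
  by have [Q ->] := gP H tH DH; exists (shift k s Q); rewrite at_gen_shift // Psi_eq.
pose Q' := shift k^-1 (fun i => - (k^-1 *: s i)) Q.
have es' i : trunc n (- (k^-1 *: s i)) = - (k^-1 *: s i) by rewrite rmorphN /= linearZ /= es.
have : at_gen Psi Q' = 0.
  rewrite at_gen_shift // -Q0 /at_gen; apply: eq_subst => -[i|b] //=.
  by rewrite ePsi scalerDr scalerA mulVf // scale1r addrK.
move/fP => TQ0; have := congr1 (shift k s) TQ0; rewrite rmorph0 => <-.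
rewrite /Q'.
apply: (subst_ext (f1 := truncr)
  (f2 := shift k s \o truncr \o shift k^-1 (fun i => - (k^-1 *: s i)))) => -[i|b] /=.
  rewrite truncr_inl shift_inl rmorphD /= linearZ /= truncr_inl truncr_inr es'.
  rewrite rmorphD /= linearZ /= shift_inl shift_inr scalerDr scalerA mulVf // scale1r.
  by rewrite rmorphN /= linearZ /= addrK.
by rewrite -[gen K (inr b)]inrS_gen shift_inr truncr_inr shift_inr.
Qed.

(** After a change of coordinates lift, with inverse back, the fields E move only
   the right variables. Then the coefficients with respect to the left variables
   are invariants in the right variables, which are assumed to be known. *)
Lemma gen_transfer (C : choiceType) (Psi : 'I_m -> S) (H : S)
    (lift : S -> sym K (I + C)%type) (back : {lrmorphism sym K (I + C)%type -> S})
    (E : 'I_D -> sym K (I + C)%type -> sym K (I + C)%type)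
    (e : 'I_D -> sym K C -> sym K C) :
  (forall y G1 G2, E y (G1 + G2) = E y G1 + E y G2) ->
  (forall y G1 G2, e y (G1 + G2) = e y G1 + e y G2) ->
  (forall y u G, E y (inlS C (mono K u) * inrS I G) = inlS C (mono K u) * inrS I (e y G)) ->
  (forall y, E y (lift H) = 0) -> back (lift H) = H ->
  (forall u, exists Q, back (inlS C (mono K u)) = at_gen Psi Q) ->
  (forall G, (forall y, e y G = 0) -> exists Q, back (inrS I G) = at_gen Psi Q) ->
  exists Q, H = at_gen Psi Q.
Proof.
move=> ED eD Ee EH bH bl br; rewrite -bH.
have [U _ ->] := sym_expand (lift H).
have coH u : exists Q, back (inrS I (co u (lift H))) = at_gen Psi Q.
  apply: br => y.
  by rewrite -(@co_derivation _ _ _ (E y) (e y)) // EH linear0.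
elim: U => [|u U [Q eQ]]; first by exists 0; rewrite big_nil !rmorph0.
have [Q1 e1] := bl u; have [Q2 e2] := coH u.
by exists (Q1 * Q2 + Q); rewrite big_cons !rmorphD !rmorphM /= -e1 -e2 eQ.
Qed.

Definition zeta (k : 'I_D) : S := (xi a n.+1 k).[(a n)%:A].

Definition newton_at (j : nat) : K := \prod_(l < j) (a n - a l).

Lemma newton_node j : (N j).[(a n)%:A] = (newton_at j)%:A.
Proof.
rewrite /newton /newton_at horner_prod -[RHS]in_algE rmorph_prod; apply: eq_bigr => l _ /=.
by rewrite hornerXsubC scalerBl.
Qed.

Lemma zetaE k : zeta k = \sum_(j < n.+1) newton_at j *: gen K (k, val j).
Proof.
rewrite /zeta /xi horner_sum; apply: eq_bigr => j _.
by rewrite hornerZ newton_node mulr_algr.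
Qed.

Lemma evx_node f : (evx a n.+1 f).[(a n)%:A] = subst zeta f.
Proof.
rewrite -/(horner_eval _ _) /evx rmorph_ev subst_ev; apply: eq_ev => [k|i] //=.
by rewrite /horner_eval hornerC.
Qed.

(** The field of index n on the first n+1 layers: N_n is divisible by the Newton
   polynomials of smaller index, so that only the top layer moves, by the value
   of the bracket at a_n. *)
Definition top_field (y : 'I_D) : S -> S :=
  dext idfun (fun b : I => if b.2 == n then subst zeta (L y b.1) else 0).

Lemma top_field_cur y H : trunc n.+1 H = H -> D_cur a L y n H = top_field y H.
Proof.
move=> <-; rewrite {1 2}/trunc D_cur_subst [RHS]dext_subst.
apply: eq_dext => // -[i j] /=.
case: ifP => [|_]; last by rewrite D_cur0 dext0.
rewrite ltnS leq_eqVlt => /predU1P[->|lt_jn].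
  by rewrite (D_cur_gen _ _ _ _ _ (ltnSn n)) nc_newton evx_node dext_gen eqxx.
rewrite (D_cur_gen _ _ _ _ _ (ltnSn j)) nc_newton_lt // dext_gen /=.
by rewrite (ltn_eqF lt_jn).
Qed.

Lemma at_gen_inlS Psi P : at_gen Psi (inlS I P) = subst Psi P.
Proof.
by rewrite /inlS lrmorph_subst; apply: eq_subst => b /=; rewrite at_gen_inl.
Qed.

Section SimpleNode.
Hypothesis at0 : newton_at n != 0.
Local Notation SD := (sym K (I + 'I_D)%type).

(** At a new node the top layer is eliminated in favour of zeta: the coefficient of
   x_in in zeta_i is not 0. The right variables are the coordinates of zeta. *)
Definition lift1 : S -> SD :=
  subst (fun b : I => if (b.2 < n)%N then gen K (inl b) else if b.2 == n then
    (newton_at n)^-1 *: (gen K (inr b.1) - \sum_(j < n) newton_at j *: gen K (inl (b.1, val j)))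
    else 0).
HB.instance Definition _ := GRing.LRMorphism.on lift1.

Definition back1 : SD -> S :=
  subst (fun z => match z with inl b => trunc n (gen K b) | inr i => zeta i end).
HB.instance Definition _ := GRing.LRMorphism.on back1.

Lemma back1_inlS f : back1 (inlS 'I_D f) = trunc n f.
Proof.
rewrite /inlS lrmorph_subst /trunc; apply: eq_subst => b /=.
by rewrite /back1 subst_gen trunc_gen.
Qed.

Lemma back1_inrS G : back1 (inrS I G) = subst zeta G.
Proof.
by rewrite /inrS lrmorph_subst; apply: eq_subst => b /=; rewrite /back1 subst_gen.
Qed.

Lemma lift1_low i j : (j < n)%N -> lift1 (gen K (i, j)) = gen K (inl (i, j)).
Proof. by move=> lt_jn; rewrite /lift1 subst_gen /= lt_jn. Qed.

Lemma lift1_top i : lift1 (gen K (i, n)) =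
  (newton_at n)^-1 *: (gen K (inr i) - \sum_(j < n) newton_at j *: gen K (inl (i, val j))).
Proof. by rewrite /lift1 subst_gen /= ltnn eqxx. Qed.

Lemma lift1_zeta i : lift1 (zeta i) = gen K (inr i).
Proof.
rewrite zetaE big_ord_recr rmorphD rmorph_sum /= linearZ /= lift1_top.
rewrite scalerA mulfV // scale1r.
rewrite (eq_bigr (fun j : 'I_n => newton_at j *: gen K (inl (i, val j)) : SD)) => [|j _].
  by rewrite addrC subrK.
by rewrite linearZ /= lift1_low.
Qed.

Lemma back1_lift1 f : back1 (lift1 f) = trunc n.+1 f.
Proof.
apply: (subst_ext (f1 := back1 \o lift1) (f2 := trunc n.+1)) => -[i j] /=.
rewrite trunc_gen /= ltnS leq_eqVlt.
have [->|ne_jn] /= := eqVneq j n.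
  rewrite lift1_top linearZ /= rmorphB rmorph_sum /= {1}/back1 subst_gen zetaE.
  rewrite big_ord_recr /= [X in _ - X](eq_bigr (fun j : 'I_n => newton_at j *: gen K (i, val j))).
    by rewrite [X in X - _]addrC addrK scalerA mulVf // scale1r.
  by move=> k _; rewrite linearZ /= /back1 subst_gen trunc_gen /= ltn_ord.
case: ifP => [lt_jn|ge_jn].
  by rewrite lift1_low // /back1 subst_gen trunc_gen /= lt_jn.
by rewrite /lift1 subst_gen /= ge_jn (negbTE ne_jn) rmorph0.
Qed.

Lemma dext_lift1 y f : dext_inr (L y) (lift1 f) = (newton_at n)^-1 *: lift1 (top_field y f).
Proof.
rewrite /top_field rmorph_dext -dext_scale /dext_inr {1}/lift1 dext_subst.
apply: eq_dext => // -[i j] /=.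
case: ifP => [lt_jn|_].
  by rewrite dext_gen (ltn_eqF lt_jn) rmorph0 scaler0.
case: ifP => [_|_]; last by rewrite dext0 rmorph0 scaler0.
rewrite -/(dext_inr (L y) _) dext_inrZ; congr (_ *: _).
rewrite dext_inrD dext_inr_gen -scaleN1r dext_inrZ.
have -> : dext_inr (L y) (\sum_(k < n) newton_at k *: gen K (inl (i, val k))) = 0.
  rewrite dext_inr_sum big1 // => k _.
  by rewrite dext_inrZ -[gen K (inl _)]inlS_gen dext_inr_inlS scaler0.
rewrite scaler0 addr0 lrmorph_subst /inrS; apply: eq_subst => k /=.
by rewrite lift1_zeta.
Qed.

Lemma simple_generates : generates_layer (fun i => subst zeta (F i)).
Proof.
move=> H tH DH.
apply: (@gen_transfer _ _ H lift1 back1 (fun y => dext_inr (L y))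
  (fun y => dext idfun (L y))).
- by move=> y G1 G2; apply: dextD.
- by move=> y G1 G2; apply: dextD.
- by move=> y u G; apply: dext_inr_mono.
- by move=> y; rewrite dext_lift1 -top_field_cur // DH rmorph0 scaler0.
- exact: etrans (back1_lift1 H) tH.
- move=> u; exists (inrS 'I_m (mono K u)).
  exact: etrans (back1_inlS _) (esym (at_gen_inr _ _)).
move=> G /F_gen[P ->]; exists (inlS I P).
apply: etrans (back1_inrS _) _; rewrite at_gen_inlS.
by rewrite lrmorph_subst.
Qed.

(** A relation between the F_i(zeta) over the lower layers is tested at points: the
   lower layers can be fixed and zeta be prescribed freely by the top layer, which
   gives a relation between the F_i. *)
Lemma simple_free : free_layer (fun i => subst zeta (F i)).
Proof.
move=> Q Q0; apply: (eq_sym_pt char0) => t; rewrite rmorph0.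
(* The lower layers are fixed at om, which leaves the relation Qom. *)
pose om (b : I) := if (b.2 < n)%N then t (inr b) else 0.
pose Qom : sym K 'I_m := subst (fun z => match z with
  inl i => gen K i | inr b => (om b)%:A end) Q.
have -> : evp t (truncr Q) = evp (t \o inl) Qom.
  rewrite !evp_subst; apply: eq_ev => // -[i|b] /=; first by rewrite !evp_gen.
  rewrite evpZ rmorph1 mulr1 trunc_gen /om; case: ifP => _; last by rewrite !rmorph0.
  by rewrite inrS_gen evp_gen.
suff -> : Qom = 0 by rewrite rmorph0.
apply: F_indep; apply: (eq_sym_pt char0) => z; rewrite rmorph0.
pose pt (b : I) := if b.2 == n then
  (newton_at n)^-1 * (z b.1 - \sum_(j < n) newton_at j * om (b.1, val j)) else om b.
have ptz k : evp pt (zeta k) = z k.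
  rewrite zetaE big_ord_recr rmorphD rmorph_sum /= evpZ evp_gen /pt /= eqxx.
  rewrite mulrA mulfV // mul1r.
  rewrite (eq_bigr (fun j : 'I_n => newton_at j * om (k, val j))) => [|j _].
    by rewrite addrC subrK.
  by rewrite evpZ evp_gen /pt /= (ltn_eqF (ltn_ord j)).
transitivity (evp pt (at_gen (fun i => subst zeta (F i)) Q)); last by rewrite Q0 rmorph0.
rewrite /at_gen /Qom !evp_subst; apply: eq_ev => // -[i|b] /=.
  rewrite evp_gen evp_subst; apply: eq_ev => // k; by rewrite ptz.
rewrite evpZ rmorph1 mulr1 trunc_gen /om; case: ifP => lt_bn; last by rewrite rmorph0.
by rewrite evp_gen /pt /om (ltn_eqF lt_bn) lt_bn.
Qed.

End SimpleNode.

Section MultipleNode.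
Hypothesis at0 : newton_at n = 0.
Local Notation S2 := (sym K ('I_D + 'I_D)%type).
Local Notation SD := (sym K (I + ('I_D + 'I_D))%type).

Lemma repeated_node_gt0 : (0 < n)%N.
Proof.
case: n at0 => // e; case/eqP: (oner_neq0 K).
by rewrite -[RHS]e /newton_at big_ord0.
Qed.

(** At a repeated node the top layer disappears from zeta, and the layer 0, which
   always has coefficient 1, takes its place as the free coordinate. *)
Lemma zeta_split i :
  zeta i = gen K (i, 0%N) + \sum_(j < n | (0 < j)%N) newton_at j *: gen K (i, val j).
Proof.
rewrite zetaE big_ord_recr /= at0 scale0r addr0 (bigD1 (Ordinal repeated_node_gt0)) //=.
rewrite {1}/newton_at big_ord0 scale1r; congr (_ + _); apply: eq_bigl => j.
by rewrite lt0n -val_eqE.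
Qed.

Lemma trunc_zeta i : trunc n (zeta i) = zeta i.
Proof.
rewrite zeta_split rmorphD rmorph_sum /= trunc_gen /= repeated_node_gt0; congr (_ + _).
by apply: eq_bigr => j _; rewrite linearZ /= trunc_gen /= ltn_ord.
Qed.

(** The layers strictly between 0 and n are parameters, left alone by the top
   fields. *)
Definition mid : S -> S :=
  subst (fun b : I => if (0 < b.2 < n)%N then gen K b else 0).
HB.instance Definition _ := GRing.LRMorphism.on mid.

Lemma trunc_mid f : trunc n (mid f) = mid f.
Proof.
rewrite /mid lrmorph_subst; apply: eq_subst => b /=.
by case: ifP => [/andP[_ lt_bn]|_]; rewrite ?rmorph0 // trunc_gen lt_bn.
Qed.

(** At a repeated node the layer 0 is eliminated in favour of zeta. The right
   variables are the top layer eta and zeta. *)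
Definition lift2 : S -> SD :=
  subst (fun b : I =>
    if b.2 == 0%N then gen K (inr (inr b.1)) -
      \sum_(j < n | (0 < j)%N) newton_at j *: gen K (inl (b.1, val j))
    else if (b.2 < n)%N then gen K (inl b)
    else if b.2 == n then gen K (inr (inl b.1)) else 0).
HB.instance Definition _ := GRing.LRMorphism.on lift2.

Definition back2 : SD -> S :=
  subst (fun z => match z with
    | inl b => mid (gen K b) | inr (inl i) => gen K (i, n) | inr (inr i) => zeta i end).
HB.instance Definition _ := GRing.LRMorphism.on back2.

Lemma back2_inlS f : back2 (inlS _ f) = mid f.
Proof.
rewrite /inlS lrmorph_subst /mid; apply: eq_subst => b /=.
by rewrite /back2 subst_gen /mid subst_gen.
Qed.

Definition on_layer : S2 -> S :=
  subst (fun z => match z with inl i => gen K (i, n) | inr i => zeta i end).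
HB.instance Definition _ := GRing.LRMorphism.on on_layer.

Lemma back2_inrS G : back2 (inrS I G) = on_layer G.
Proof.
by rewrite /inrS lrmorph_subst; apply: eq_subst => -[i|i] /=; rewrite /back2 subst_gen.
Qed.

Lemma lift2_low i j : (0 < j < n)%N -> lift2 (gen K (i, j)) = gen K (inl (i, j)).
Proof.
by case/andP=> j0 lt_jn; rewrite /lift2 subst_gen /= (gtn_eqF j0) lt_jn.
Qed.

Lemma lift2_bot i : lift2 (gen K (i, 0%N)) =
  gen K (inr (inr i)) - \sum_(j < n | (0 < j)%N) newton_at j *: gen K (inl (i, val j)).
Proof. by rewrite /lift2 subst_gen. Qed.

Lemma lift2_top i : lift2 (gen K (i, n)) = gen K (inr (inl i)).
Proof. by rewrite /lift2 subst_gen /= (gtn_eqF repeated_node_gt0) ltnn eqxx. Qed.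

Lemma lift2_zeta i : lift2 (zeta i) = gen K (inr (inr i)).
Proof.
rewrite zeta_split rmorphD rmorph_sum /= lift2_bot.
rewrite [X in _ + X](eq_bigr (fun j : 'I_n => newton_at j *: gen K (inl (i, val j)) : SD)) => [|j j0].
  by rewrite subrK.
by rewrite linearZ /= lift2_low // j0 /=.
Qed.

Lemma back2_lift2 f : back2 (lift2 f) = trunc n.+1 f.
Proof.
apply: (subst_ext (f1 := back2 \o lift2) (f2 := trunc n.+1)) => -[i j] /=.
rewrite trunc_gen /=; have [->|j0] := eqVneq j 0%N.
  rewrite lift2_bot rmorphB rmorph_sum /= {1}/back2 subst_gen zeta_split.
  rewrite [X in _ - X](eq_bigr (fun j : 'I_n => newton_at j *: gen K (i, val j))) ?addrK // => k k0.
  by rewrite linearZ /= /back2 subst_gen /mid subst_gen /= k0 ltn_ord.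
rewrite ltnS leq_eqVlt; have [->|ne_jn] /= := eqVneq j n.
  by rewrite lift2_top /back2 subst_gen.
case: ifP => [lt_jn|ge_jn].
  have jj : (0 < j < n)%N by rewrite lt0n j0.
  by rewrite lift2_low // /back2 subst_gen /mid subst_gen /= jj.
by rewrite /lift2 subst_gen /= (negbTE j0) ge_jn (negbTE ne_jn) rmorph0.
Qed.

Definition Evec (y : 'I_D) : 'I_D + 'I_D -> S2 :=
  fun z => if z is inl k then inrS 'I_D (L y k) else 0.

Lemma dext_lift2 y f : dext_inr (Evec y) (lift2 f) = lift2 (top_field y f).
Proof.
rewrite /top_field rmorph_dext /dext_inr {1}/lift2 dext_subst.
apply: eq_dext => // -[i j] /=; rewrite -/(dext_inr (Evec y) _).
have [->|j0] := eqVneq j 0%N.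
  rewrite (ltn_eqF repeated_node_gt0) rmorph0 dext_inrD dext_inr_gen /= rmorph0 add0r.
  rewrite -scaleN1r dext_inrZ dext_inr_sum big1 ?scaler0 // => k _.
  by rewrite dext_inrZ -[gen K (inl _)]inlS_gen dext_inr_inlS scaler0.
case: ifP => [lt_jn|_].
  by rewrite (ltn_eqF lt_jn) rmorph0 -[gen K (inl _)]inlS_gen dext_inr_inlS.
case: ifP => [_|_]; last by rewrite rmorph0 /dext_inr dext0.
rewrite dext_inr_gen /Evec lrmorph_subst /inrS lrmorph_subst; apply: eq_subst => k /=.
by rewrite lift2_zeta inrS_gen.
Qed.

(** The linear form ell_i at xi = zeta, on the top layer. *)
Definition ell_zeta (i : 'I_m) : S :=
  \sum_k subst zeta (pderiv k (F i)) * gen K (k, n).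

Lemma on_layer_ellE i : on_layer (ell F i) = ell_zeta i.
Proof.
rewrite /ell rmorph_sum; apply: eq_bigr => k _; rewrite rmorphM /=.
rewrite {2}/on_layer subst_gen; congr (_ * _).
rewrite /inrS lrmorph_subst; apply: eq_subst => l /=.
by rewrite /on_layer subst_gen.
Qed.

Lemma multiple_generates : generates_layer ell_zeta.
Proof.
move=> H tH DH.
apply: (@gen_transfer _ _ H lift2 back2 (fun y => dext_inr (Evec y))
  (fun y => dext idfun (Evec y))).
- by move=> y G1 G2; apply: dextD.
- by move=> y G1 G2; apply: dextD.
- by move=> y u G; apply: dext_inr_mono.
- by move=> y; rewrite dext_lift2 -top_field_cur // DH rmorph0.
- exact: etrans (back2_lift2 H) tH.
- move=> u; exists (inrS 'I_m (mid (mono K u))).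
  apply: etrans (back2_inlS _) (esym _).
  exact: etrans (at_gen_inr _ _) (trunc_mid _).
move=> G /(Efield_invariants char0 F_inv L_index F_reg F_big)[P ->].
exists (subst (fun z => match z with
  inl i => gen K (inl i) | inr k => inrS 'I_m (zeta k) end) P).
apply: etrans (back2_inrS _) _; rewrite /at_ell !lrmorph_subst.
apply: eq_subst => -[i|k] /=; first by rewrite at_gen_inl on_layer_ellE.
by rewrite at_gen_inr trunc_zeta /on_layer subst_gen.
Qed.

(** The same test at points, with zeta prescribed by the layer 0 and eta by the top
   layer, reduces to the freeness of the ell_i. *)
Lemma multiple_free : free_layer ell_zeta.
Proof.
move=> Q Q0; apply: (eq_sym_pt char0) => t; rewrite rmorph0.
pose om (b : I) := if (b.2 < n)%N then t (inr b) else 0.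
pose rest k := \sum_(j < n | (0 < j)%N) newton_at j * om (k, val j).
pose Qom : sym K ('I_m + 'I_D)%type := subst (fun z => match z with
  | inl i => gen K (inl i)
  | inr b => if b.2 == 0%N then gen K (inr b.1) - (rest b.1)%:A else (om b)%:A end) Q.
have -> : evp t (truncr Q) =
    evp (pt2 (t \o inl) (fun k => om (k, 0%N) + rest k)) Qom.
  rewrite !evp_subst; apply: eq_ev => // -[i|[i j]] /=; first by rewrite !evp_gen.
  rewrite trunc_gen /=; have [->|j0] := eqVneq j 0%N.
    rewrite repeated_node_gt0 inrS_gen evp_gen rmorphB /= evpZ rmorph1 mulr1 evp_gen /= addrK.
    by rewrite /om repeated_node_gt0.
  rewrite evpZ rmorph1 mulr1 /om /=; case: ifP => _; last by rewrite !rmorph0.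
  by rewrite inrS_gen evp_gen.
suff -> : Qom = 0 by rewrite rmorph0.
apply: (at_ell_inj char0 F_reg); apply: (eq_sym_pt char0) => z; rewrite rmorph0.
pose pt (b : I) := if b.2 == n then z (inl b.1) else
  if b.2 == 0%N then z (inr b.1) - rest b.1 else om b.
have ptz k : evp pt (zeta k) = z (inr k).
  rewrite zeta_split rmorphD rmorph_sum /= evp_gen /pt /= (ltn_eqF repeated_node_gt0).
  rewrite [X in _ + X](eq_bigr (fun j : 'I_n => newton_at j * om (k, val j))) => [|j j0].
    by rewrite subrK.
  by rewrite evpZ evp_gen /= (ltn_eqF (ltn_ord j)) (gtn_eqF j0).
transitivity (evp pt (at_gen ell_zeta Q)); last by rewrite Q0 rmorph0.
rewrite /at_gen /at_ell /Qom !evp_subst; apply: eq_ev => // -[i|[i j]] /=.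
  rewrite evp_gen /ell /ell_zeta !rmorph_sum; apply: eq_bigr => k _.
  rewrite !rmorphM /= !evp_gen /pt eqxx !evp_subst; congr (_ * _).
  by apply: eq_ev => // l; rewrite evp_gen ptz.
rewrite trunc_gen /=; have [->|j0] := eqVneq j 0%N.
  by rewrite repeated_node_gt0 rmorphB /= evpZ rmorph1 mulr1 !evp_gen /pt /= (ltn_eqF repeated_node_gt0).
rewrite evpZ rmorph1 mulr1 /om /=; case: ifP => lt_jn; last by rewrite rmorph0.
by rewrite evp_gen /pt /= (ltn_eqF lt_jn) (negbTE j0) /om lt_jn.
Qed.

End MultipleNode.

(** Newton interpolation of F(xi) at the node a_n, where all Newton polynomials of
   index above n vanish. *)
Lemma zeta_newton f :
  subst zeta f = \sum_(j < n.+1) newton_at j *: newton_coef a j f.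
Proof.
have atS : newton_at n.+1 = 0 by rewrite /newton_at big_ord_recr /= subrr mulr0.
rewrite -evx_node {1}(newton_expand a n.+1 (evx a n.+1 f)) hornerD hornerM.
rewrite newton_node atS scale0r mul0r addr0.
rewrite horner_sum; apply: eq_bigr => j _.
by rewrite hornerZ newton_node mulr_algr nc_evx.
Qed.

(** Taylor expansion of F at the generic element of the lower layers. The quadratic
   term does not contribute, since N_n(a_n) = 0. *)
Lemma newton_coef_multiple i : newton_at n = 0 ->
  newton_coef a n (F i) = ell_zeta i + nc n (evx a n (F i)).
Proof.
move=> at0; have nodeE f : (evx a n f).[(a n)%:A] = subst zeta f.
  have [g e] := evx_split a f (leqnSn n); rewrite -evx_node e hornerD hornerM.
  by rewrite newton_node at0 scale0r mul0r addr0.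
have [g e] := ev_taylor (@polyC S \o GRing.in_alg S) (F i) (xiS a n).
rewrite /newton_coef {1}/evx e -/(evx a n (F i)) !ncD -addrA addrC; congr (_ + _).
rewrite expr2 -mulrA -ncD -mulrDr nc_newton hornerD hornerM newton_node at0.
rewrite scale0r mul0r addr0 horner_sum; apply: eq_bigr => k _.
by rewrite hornerM hornerC -/(evx a n _) nodeE.
Qed.

Lemma newton_layer : generates_layer (fun i => newton_coef a n (F i)) /\
  free_layer (fun i => newton_coef a n (F i)).
Proof.
have [at0|at0] := eqVneq (newton_at n) 0.
  have [] := @layer_shift ell_zeta (fun i => newton_coef a n (F i)) 1
    (fun i => - nc n (evx a n (F i))) (oner_neq0 _).
  - by move=> i; rewrite rmorphN /= trunc_nc map_trunc_evx.
  - by move=> i; rewrite scale1r newton_coef_multiple // addrK.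
  move=> g f; split; first exact/g/multiple_generates.
  exact/f/multiple_free.
have [] := @layer_shift (fun i => subst zeta (F i)) (fun i => newton_coef a n (F i))
  (newton_at n) (fun i => \sum_(j < n) newton_at j *: newton_coef a j (F i)) at0.
- move=> i; rewrite rmorph_sum; apply: eq_bigr => j _ /=.
  by rewrite linearZ /= trunc_newton_coef.
- by move=> i; rewrite zeta_newton big_ord_recr /= addrC.
move=> g f; split; first exact/g/simple_generates.
exact/f/simple_free.
Qed.

End Step.

Lemma co_truncr n u Q : co u (truncr n Q) = trunc n (co u Q).
Proof.
have [r ->] := sym_pairs Q; elim: r => [|x r IHr]; first by rewrite big_nil !rmorph0 !linear0.
rewrite big_cons !linearD /= ?linearD /= IHr; congr (_ + _).
have -> : truncr n (inlS I (mono K x.1) * inrS 'I_m x.2) =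
    inlS I (mono K x.1) * inrS 'I_m (trunc n x.2).
  rewrite rmorphM /= truncr_inr; congr (_ * _).
  by rewrite /inlS /truncr lrmorph_subst; apply: eq_subst => i /=; rewrite subst_gen.
by rewrite !co_inlr; case: eqP => _; rewrite ?mul1r // !mul0r rmorph0.
Qed.

(** By the layer n, H is a polynomial in the F_i^[n] over the lower layers. Applying
   a field to this expression, its coefficients are differentiated, and as the
   F_i^[n] are free these coefficients are invariants with one layer less. *)
Theorem newton_generated n (H : S) : trunc n H = H ->
  (forall y l, D_cur a L y l H = 0) ->
  generated_subalgebra
    (fun Y => exists i j, (j < n)%N /\ Y = newton_coef a j (F i)) H.
Proof.
elim: n H => [|n IHn] H tH DH B subB FB; case: (subB) => B1 BL BM.
  have B0 : B 0 by rewrite -(addNr 1) -scaleN1r; apply: BL.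
  have [k ->] : exists k : K, H = k%:A.
    rewrite -tH; elim/sym_ind: (H) => [k|f g [k1 e1] [k2 e2]|b f _].
    - by exists k; rewrite linearZ /= rmorph1.
    - by exists (k1 + k2); rewrite rmorphD /= e1 e2 scalerDl.
    - by exists 0; rewrite rmorphM /= trunc_gen mul0r scale0r.
  by rewrite -[_%:A]addr0; apply: BL.
have [gen free] := newton_layer n.
have [|Q eH] := gen H tH; first by move=> y; apply: DH.
set Psi := fun i => _ in gen free eH.
have [U uU eQ] := sym_expand Q.
have PsiE u : at_gen n Psi (inlS I (mono K u)) = subst Psi (mono K u).
  exact: at_gen_inlS.
have HE : H = \sum_(u <- U) subst Psi (mono K u) * trunc n (co u Q).
  rewrite eH {1}eQ rmorph_sum; apply: eq_bigr => u _.
  by rewrite rmorphM /= PsiE at_gen_inr.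
have DPsi y l u : D_cur a L y l (subst Psi (mono K u)) = 0.
  rewrite D_cur_subst; apply: big1 => i _ /=.
  by rewrite D_cur_newton_coef ?mulr0 // => y'; apply: F_inv.
have inv u y l : u \in U -> D_cur a L y l (trunc n (co u Q)) = 0.
  move=> uIn.
  (* The field applied to the coefficients of Q gives a relation between the Psi. *)
  pose Q' := \sum_(u <- U) inlS I (mono K u) * inrS 'I_m (D_cur a L y l (trunc n (co u Q))).
  have : at_gen n Psi Q' = 0.
    rewrite -(DH y l) HE /Q' rmorph_sum [RHS]raddf_sum; apply: eq_bigr => v _.
    rewrite rmorphM /= D_curM DPsi mul0r add0r PsiE at_gen_inr.
    by congr (_ * _); apply: trunc_D_cur; apply: trunc_id.
  move/free/(congr1 (co u)); rewrite co_truncr linear0 => e.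
  have := co_sum (fun u => D_cur a L y l (trunc n (co u Q))) uU uIn.
  rewrite -/Q' => eQ'; rewrite eQ' in e; rewrite -e.
  by apply/esym/trunc_D_cur/trunc_id.
have B0 : B 0 by rewrite -(addNr 1) -scaleN1r; apply: BL.
have BD x y : B x -> B y -> B (x + y) by rewrite -{2}[x]scale1r; apply: BL.
have BPsi u : B (subst Psi (mono K u)).
  elim/monomial_ind: u => [|i v IHv]; first by rewrite mono1 rmorph1.
  rewrite monoM rmorphM /= -gen_mono subst_gen.
  by apply: BM IHv; apply: FB; exists i, n.
rewrite HE big_seq; elim/big_rec: _ => [|u x uU' Bx] //.
apply: BD => //; apply: BM; first exact: BPsi.
apply: IHn => //; first exact: trunc_id.
  by move=> y l; apply: inv.
by move=> Y [i [j [lt_jn ->]]]; apply: FB; exists i, j; rewrite ltnS ltnW.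
Qed.
End Invariants.

(** * Poisson brackets and the conditions on the Lie algebra *)

Section Poisson.
Variables (K : fieldType) (I : choiceType) (b : I -> I -> sym K I).

Lemma poissonEl f g : poisson b f g = dext idfun (fun i => dext idfun (b i) g) f.
Proof.
apply: eq_bigr => i _; rewrite mulr_sumr; apply: eq_bigr => j _.
by rewrite /= mulrA.
Qed.

Lemma poissonEr f g : poisson b f g = dext idfun (fun j => dext idfun (b^~ j) f) g.
Proof.
rewrite /poisson exchange_big /=; apply: eq_bigr => j _.
have dist (x : sym K I) (G : I -> sym K I) :
    \sum_(i <- vars f) x * G i = x * \sum_(i <- vars f) G i by rewrite mulr_sumr.
apply: etrans (dist (pderiv j g) (fun i => pderiv i f * b i j)).
apply: eq_bigr => i _.
exact: etrans (congr1 (fun z => z * b i j) (mulrC _ _)) (esym (mulrA _ _ _)).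
Qed.

Lemma poisson_gen i g : poisson b (gen K i) g = dext idfun (b i) g.
Proof. by rewrite poissonEl dext_gen. Qed.

End Poisson.

Lemma evp_cst (K : fieldType) (I : choiceType) (t : I -> K) (k : K) : evp t k%:A = k.
Proof. by rewrite evpZ rmorph1 mulr1. Qed.

Section LieData.
Variables (K : fieldType) (q : vectType K) (br : lieBracket q).
Local Notation D := (\dim {:q}).
Local Notation Sq := (sym K 'I_D).
Local Notation e := (@basisv K q).

Lemma basisE x : x = \sum_i coord (vbasis {:q}) i x *: e i.
Proof. exact: coord_vbasis (memvf x). Qed.

Lemma coord_basisv i j : coord (vbasis {:q}) i (e j) = (i == j)%:R.
Proof. by rewrite /basisv coord_free ?(basis_free (vbasisP _)) // eq_sym. Qed.

Lemma br_sumr x (r : 'I_D -> K) (v : 'I_D -> q) :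
  br x (\sum_i r i *: v i) = \sum_i r i *: br x (v i).
Proof.
pose h := GRing.isLinear.Build K q q _ _ (lie_linear_r br x).
pose H : {linear q -> q} := HB.pack (br x : q -> q) h.
have -> : br x (\sum_i r i *: v i) = H (\sum_i r i *: v i) by [].
by rewrite linear_sum; apply: eq_bigr => i _; rewrite linearZ.
Qed.

Lemma brDl x x' y : br (x + x') y = br x y + br x' y.
Proof. by have := lie_linear_l br y 1 x x'; rewrite !scale1r. Qed.

Lemma brDr x y y' : br x (y + y') = br x y + br x y'.
Proof. by have := lie_linear_r br x 1 y y'; rewrite !scale1r. Qed.

Lemma br_anti x y : br x y = - br y x.
Proof.
apply/eqP; rewrite -addr_eq0; apply/eqP.
have := lie_alternating br (x + y).
by rewrite brDl !brDr !lie_alternating add0r addr0.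
Qed.

Lemma linform_is_linear : linear (@linform K q).
Proof.
move=> k x y; rewrite /linform scaler_sumr -big_split; apply: eq_bigr => i _ /=.
by rewrite linearP scalerDl scalerA.
Qed.
HB.instance Definition _ := GRing.isLinear.Build K q Sq *:%R (@linform K q) linform_is_linear.

Lemma linform_basis i : linform (e i) = gen K i.
Proof.
rewrite /linform (bigD1 i) //= coord_basisv eqxx scale1r big1 ?addr0 // => j ne_ji.
by rewrite coord_basisv (negbTE ne_ji) scale0r.
Qed.

(** The value at x_k of the Hamiltonian field of the basis vector y. *)
Definition structure_field (y k : 'I_D) : Sq := linform (br (e y) (e k)).
Local Notation L := structure_field.

Lemma lie_invariantE H : lie_invariant br H <-> (forall y, dext idfun (L y) H = 0).
Proof.
have gE y : poissonq br H (gen K y) = - dext idfun (L y) H.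
  rewrite /poissonq poissonEr dext_gen -mulN1r -(rmorphN1 (idfun : {rmorphism Sq -> Sq})).
  rewrite mulr_sumr; apply: eq_bigr => i _ /=.
  by rewrite /L br_anti linearN mulrN mulN1r.
split=> [inv y|inv x].
  have := inv (e y); rewrite linform_basis gE => /eqP.
  by rewrite oppr_eq0 => /eqP.
rewrite /linform /poissonq poissonEr.
elim/big_rec: _ => [|i z _ Hz]; first exact: dext0.
rewrite dextD Hz addr0 dextZ dext_gen.
have := gE i; rewrite /poissonq poissonEr dext_gen inv oppr0 => ->.
by rewrite mulr0.
Qed.

Definition dual_pt (g : dualv q) : 'I_D -> K := fun i => g (e i).

Lemma evalqE f (g : dualv q) : evalq f g = evp (dual_pt g) f.
Proof. by rewrite /evalq subst_ev; apply: eq_ev => // k /=; rewrite /GRing.scale /= mulr1. Qed.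

Lemma evp_linform (g : dualv q) x : evp (dual_pt g) (linform x) = g x.
Proof.
rewrite [in RHS](basisE x) /linform rmorph_sum linear_sum; apply: eq_bigr => i _.
by rewrite /= evpZ evp_gen linearZ.
Qed.

(** The kernel of the matrix of the brackets at a functional consists of the
   coordinates of its stabiliser. *)
Lemma index_rank m : is_index br m ->
  exists t, (\rank (kermx (adp L t)) <= m)%N.
Proof.
move=> [[g dg] _]; exists (dual_pt g); rewrite -dg.
set A := adp _ _; set B := row_base (kermx A).
pose X := [tuple \sum_k B i k *: e k | i < \rank (kermx A)].
have nX (i : 'I_(\rank (kermx A))) : X`_i = \sum_k B i k *: e k by rewrite (nth_mktuple _ _ i).
have coordX (c : 'I_D -> K) : \sum_k c k *: e k = 0 -> forall k, c k = 0.
  by have /freeP fb := basis_free (vbasisP {:q}); apply: fb.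
have fX : free X.
  apply/freeP => c; under eq_bigr => i _ do rewrite nX scaler_sumr.
  rewrite exchange_big /= => c0 i.
  have : (\row_i c i) *m B = 0.
    apply/rowP => k; rewrite !mxE.
    have /coordX/(_ k) : \sum_k (\sum_i c i * B i k) *: e k = 0.
      rewrite -[RHS]c0; apply: eq_bigr => k' _; rewrite scaler_suml.
      by apply: eq_bigr => i' _; rewrite scalerA.
    by move=> ck; rewrite -[RHS]ck; apply: eq_bigr => i' _; rewrite mxE.
  move/eqP; rewrite mulmx_free_eq0 ?row_base_free // => /eqP/rowP/(_ i).
  by rewrite !mxE.
rewrite -[X in (X <= _)%N](size_tuple X) -(eqP fX); apply/dimvS/span_subvP => x.
case/tnthP=> i ->; rewrite (tnth_nth 0) nX; apply/stabiliserP => y.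
have BA : B *m A = 0.
  by apply/eqP; rewrite -submx0 -(mulmx_ker A) submxMr // eq_row_base.
have brE u v : g (br (\sum_k u k *: e k) (\sum_l v l *: e l)) =
    \sum_l v l * \sum_k u k * g (br (e k) (e l)).
  rewrite br_sumr linear_sum; apply: eq_bigr => l _; rewrite linearZ /=; congr (_ * _).
  rewrite br_anti br_sumr linearN linear_sum -sumrN; apply: eq_bigr => k _.
  by rewrite linearZ /= (br_anti (e k)) linearN mulrN.
rewrite (basisE y) brE big1 // => l _.
have := congr1 (fun M : 'M_(_, _) => M i l) BA; rewrite !mxE => BA0.
have -> : \sum_k B i k * g (br (e k) (e l)) = - \sum_k B i k * A k l.
  have AE k : A k l = g (br (e l) (e k)) by rewrite mxE /structure_field evp_linform.
  rewrite -sumrN; apply: eq_bigr => k _; rewrite AE.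
  by rewrite (br_anti (e k)) linearN mulrN.
by rewrite BA0 oppr0 mulr0.
Qed.

Lemma OmegaE m (F : 'I_m -> Sq) (g : dualv q) : Omega F g ->
  exists M : 'M[K]_(D, m), \det (jacp F (dual_pt g) *m M) != 0.
Proof.
move=> [eta w0]; exists (\matrix_(k, j) eta j (e k)).
rewrite (_ : _ *m _ = \matrix_(i < m, j < m) differential (F i) g (eta j)) //.
apply/matrixP => i j; rewrite !mxE; apply: eq_bigr => k _.
by rewrite !mxE evalqE.
Qed.

Lemma big_point m (F : 'I_m -> Sq) : is_big (Omega F) ->
  forall f : Sq, ~ (exists c : K, f = c%:A) ->
  exists2 t, evp t f = 0 & exists M : 'M[K]_(D, m), \det (jacp F t *m M) != 0.
Proof.
move=> bigF f nf; apply: NNPP => H; apply: (bigF f nf) => g fg /OmegaE[M detM].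
by apply: H; exists (dual_pt g); [rewrite -evalqE | exists M].
Qed.

(** Bigness is applied to the divisor of a coordinate function, which exists as q
   is not 0. *)
Lemma big_regular m (F : 'I_m -> Sq) : is_big (Omega F) ->
  (exists x y : q, br x y != 0) ->
  exists t (M : 'M[K]_(D, m)), \det (jacp F t *m M) != 0.
Proof.
move=> /big_point bigF [x [y xy]].
have [i _] : exists i : 'I_D, true.
  case: (posnP D) => [D0|D0]; last by exists (Ordinal D0).
  case/eqP: xy; rewrite (basisE (br x y)) big1 // => i.
  by have := ltn_ord i; rewrite [X in (_ < X)%N]D0.
have [|t _ [M tM]] := bigF (gen K i); last by exists t, M.
move=> [c ec]; have := evp_gen (fun=> c + 1) i; rewrite ec evp_cst => /eqP.
by rewrite -subr_eq0 opprD addrA subrr add0r oppr_eq0 oner_eq0.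
Qed.

End LieData.

(** * Quotients of the current algebra by a polynomial *)

Section Embedding.
Variables (K : fieldType) (A : comAlgType K).

Definition emb : {poly K} -> {poly A} := map_poly (GRing.in_alg A).
HB.instance Definition _ := GRing.RMorphism.on emb.

Lemma embX : emb 'X = 'X. Proof. exact: map_polyX. Qed.
Lemma embC k : emb k%:P = (k%:A)%:P. Proof. exact: map_polyC. Qed.
Lemma coef_emb g i : (emb g)`_i = (g`_i)%:A. Proof. exact: coef_map. Qed.

Lemma horner_emb (g : {poly K}) (t : K) : (emb g).[t%:A] = (g.[t])%:A.
Proof. exact: (horner_map (GRing.in_alg A)). Qed.

End Embedding.

Section Recurrence.
Variables (K : fieldType) (A : comAlgType K) (p : {poly K}) (n : nat).
Hypothesis size_p : size p = n.+1.
Variable T : nat -> A.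
Hypothesis T_rec : forall j, \sum_(l < n.+1) p`_l *: T (j + l) = 0.

(** A sequence T with the linear recurrence of characteristic polynomial p, such as
   x t^k in q[t]/(p), is coded by polynomials on which the shift of T acts as the
   multiplication by X modulo p (waveS). The coefficients drop_poly s.+1 p are the
   Horner polynomials, the basis dual to the powers of t for the residue form
   of p. *)
Definition wave (k : nat) : {poly A} :=
  \sum_(s < n) T (k + s) *: emb A (drop_poly s.+1 p).

Lemma emb_drop s : emb A (drop_poly s p) =
  'X * emb A (drop_poly s.+1 p) + ((p`_s)%:A)%:P.
Proof.
rewrite -embX -embC -rmorphM -rmorphD; congr (emb A _).
apply/polyP => i; rewrite coefD coefC coefXM !coef_drop_poly.
by case: i => [|i] /=; rewrite ?add0r ?addr0 // addSnnS.
Qed.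

Lemma waveS k : wave k.+1 = 'X * wave k - T k *: emb A p.
Proof.
have dlast : emb A (drop_poly n p) = ((p`_n)%:A)%:P.
  rewrite emb_drop (_ : drop_poly n.+1 p = 0) ?rmorph0 ?mulr0 ?add0r //.
  by apply: drop_poly_eq0; rewrite size_p.
have eX : 'X * wave k = \sum_(s < n.+1) T (k + s) *: emb A (drop_poly s p).
  rewrite big_ord_recr /= dlast /wave mulr_sumr.
  have -> : T (k + n) *: ((p`_n)%:A)%:P = - \sum_(s < n) T (k + s) *: ((p`_s)%:A)%:P.
    have := T_rec k; rewrite big_ord_recr /= => /eqP; rewrite addr_eq0 => /eqP e.
    have sc (x : A) (c : K) : x *: ((c%:A)%:P : {poly A}) = (c *: x)%:P.
      by rewrite -mul_polyC -polyCM mulr_algr.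
    rewrite sc -[p`_n *: _]opprK -e polyCN rmorph_sum; congr (- _).
    by apply: eq_bigr => s _; rewrite sc.
  rewrite -sumrB; apply: eq_bigr => s _.
  by rewrite (emb_drop s) -scalerBr addrK scalerAr.
have d0 : drop_poly 0 p = p by apply/polyP => i; rewrite coef_drop_poly addn0.
rewrite eX big_ord_recl addn0 d0 addrC addKr /wave.
by apply: eq_bigr => s _; rewrite addSnnS.
Qed.

Lemma wave_mod k : exists g, wave k = 'X^k * wave 0 - emb A p * g.
Proof.
elim: k => [|k [g e]]; first by exists 0; rewrite mul1r mulr0 subr0.
exists ('X * g + (T k)%:P); rewrite waveS e exprS -mul_polyC.
by move: (emb A p) (wave 0) ('X : {poly A}) ('X^k : {poly A}) => P W X Xk; ring.
Qed.

End Recurrence.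

Section TensMod.
Variables (K : fieldType) (q : vectType K) (n : nat) (p : {poly K}).
Hypothesis size_p : size p = n.+1.
Local Notation D := (\dim {:q}).
Local Notation e := (@basisv K q).
Local Notation SW := (sym K ('I_D * 'I_n)%type).

Lemma tens_is_linear (J : choiceType) (j : J) : linear (fun x : q => tens x j).
Proof.
move=> k x y; rewrite /tens scaler_sumr -big_split; apply: eq_bigr => i _ /=.
by rewrite linearP scalerDl scalerA.
Qed.

Lemma tens_basis (J : choiceType) i (j : J) : tens (e i) j = gen K (i, j).
Proof.
rewrite /tens (bigD1 i) //= coord_basisv eqxx scale1r big1 ?addr0 // => k ne_ki.
by rewrite coord_basisv (negbTE ne_ki) scale0r.
Qed.

(** The vector x t^k, with the arguments ordered so that it is linear in x. *)
Definition tmod (k : nat) (x : q) : SW := tens_mod n p x k.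

Lemma tens_mod_is_linear k : linear (tmod k).
Proof.
move=> c x y; rewrite /tmod /tens_mod scaler_sumr -big_split; apply: eq_bigr => s _ /=.
by rewrite tens_is_linear scalerDr !scalerA mulrC.
Qed.
HB.instance Definition _ k :=
  GRing.isLinear.Build K q SW *:%R (tmod k) (tens_mod_is_linear k).

Lemma tmod_small x (s : 'I_n) : tmod s x = tens x s.
Proof.
rewrite /tmod /tens_mod modp_small ?size_polyXn ?size_p ?ltnS //.
rewrite (bigD1 s) //= coefXn eqxx scale1r big1 ?addr0 // => r ne_rs.
by rewrite coefXn (negbTE (_ : val r != val s)) ?scale0r.
Qed.

Lemma tmod_rec x j : \sum_(l < n.+1) p`_l *: tmod (j + l) x = 0.
Proof.
have modE : \sum_(l < n.+1) p`_l *: ('X^(j + l) %% p) = 0.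
  transitivity ((\sum_(l < n.+1) p`_l *: 'X^(j + l)) %% p).
    elim/big_rec2: _ => [|l y1 y2 _ ->]; first by rewrite mod0p.
    by rewrite modpD modpZl.
  have -> : \sum_(l < n.+1) p`_l *: 'X^(j + l) = 'X^j * p.
    rewrite -[p in RHS]coefK size_p poly_def mulr_sumr.
    by apply: eq_bigr => l _; rewrite exprD scalerAr.
  by rewrite modp_mull.
rewrite /tmod /tens_mod; under eq_bigr => l _ do rewrite scaler_sumr.
rewrite exchange_big big1 //= => s _.
transitivity ((\sum_(l < n.+1) p`_l *: ('X^(j + l) %% p))`_s *: tens x s).
  rewrite coef_sum scaler_suml; apply: eq_bigr => l _.
  by rewrite coefZ scalerA.
by rewrite modE coef0 scale0r.
Qed.

End TensMod.

Section CoefficientwiseDerivation.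
Variables (K : fieldType) (I : choiceType) (w : I -> sym K I).
Local Notation S := (sym K I).

Definition vfield : S -> S := dext idfun w.

Lemma vfield_is_linear : linear vfield.
Proof. by move=> k f g; rewrite /vfield dextD dextZ /= mulr_algl. Qed.
HB.instance Definition _ := GRing.isLinear.Build K S S *:%R vfield vfield_is_linear.

Lemma vfieldM f g : vfield (f * g) = vfield f * g + f * vfield g.
Proof. exact: dextM. Qed.

Lemma map_vfieldM (f g : {poly S}) : map_poly vfield (f * g) =
  map_poly vfield f * g + f * map_poly vfield g.
Proof.
apply/polyP => i; rewrite coefD coef_map !coefM raddf_sum -big_split.
by apply: eq_bigr => j _; rewrite /= vfieldM !coef_map.
Qed.

Lemma map_vfield_emb (x : S) g : map_poly vfield (x *: emb S g) = vfield x *: emb S g.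
Proof.
by apply/polyP => i; rewrite coef_map /= !coefZ coef_emb !mulr_algr linearZ.
Qed.

Lemma map_vfield_ev (J : finType) (v : J -> {poly S}) (f : sym K J) :
  map_poly vfield (ev (@polyC S \o GRing.in_alg S) v f) =
  \sum_j ev (@polyC S \o GRing.in_alg S) v (pderiv j f) * map_poly vfield (v j).
Proof.
rewrite (@derivation_ev _ _ _ _ _ _ idfun (map_poly vfield)); first by rewrite dext_fin.
- by move=> x y; rewrite raddfD.
- exact: map_vfieldM.
- by move=> k /=; rewrite map_polyC /= /vfield dextC.
Qed.

End CoefficientwiseDerivation.

Section Takiff.
Variables (K : fieldType) (q : vectType K) (br : lieBracket q) (n : nat) (p : {poly K}).
Hypothesis size_p : size p = n.+1.
Local Notation D := (\dim {:q}).
Local Notation e := (@basisv K q).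
Local Notation SW := (sym K ('I_D * 'I_n)%type).
Local Notation Sq := (sym K 'I_D).
Local Notation L := (structure_field br).
Local Notation tmod := (@tmod K q n p).

(** The generic element of q[t]/(p), for z a basis vector: the vectors z t^s are
   its coordinates in the basis of the polynomials drop_poly s.+1 p. *)
Definition takiff_gen (z : q) : {poly SW} := wave p n (fun k => tmod k z) 0.

Definition takiff_ev : Sq -> {poly SW} :=
  ev (@polyC SW \o GRing.in_alg SW) (fun i => takiff_gen (e i)).
HB.instance Definition _ := GRing.RMorphism.on takiff_ev.

Lemma takiff_gen_basis i : takiff_gen (e i) = \sum_(s < n) gen K (i, s) *: emb SW (drop_poly s.+1 p).
Proof. by apply: eq_bigr => s _; rewrite add0n tmod_small // tens_basis. Qed.

Lemma takiff_ev_linform z : takiff_ev (linform z) = takiff_gen z.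
Proof.
rewrite /linform rmorph_sum /takiff_gen /wave.
transitivity (\sum_i \sum_(s < n) (coord (vbasis {:q}) i z *: tmod s (e i)) *:
    emb SW (drop_poly s.+1 p)).
  apply: eq_bigr => i _; rewrite /= /takiff_ev evZ ev_gen /= mul_polyC scaler_sumr.
  by apply: eq_bigr => s _; rewrite scalerA mulr_algl.
rewrite exchange_big; apply: eq_bigr => s _ /=.
by rewrite -scaler_suml {2}(basisE z) linear_sum; congr (_ *: _);
  apply: eq_bigr => i _; rewrite linearZ.
Qed.

(** The Hamiltonian field of y g(t), on the generators. *)
Definition field_mod (y : 'I_D) (g : {poly K}) : 'I_D * 'I_n -> SW :=
  fun b => \sum_(k < n) g`_k *: tmod (k + b.2) (br (e y) (e b.1)).

(** The bracket with y t^k shifts the sequence [y, x] t^j by k places, which is the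
   multiplication by X^k on the generic element. *)
Lemma map_field_takiff_gen y (g : {poly K}) i : (size g <= n)%N -> exists h,
  map_poly (vfield (field_mod y g)) (takiff_gen (e i)) =
  emb SW g * takiff_ev (L y i) - emb SW p * h.
Proof.
move=> sg; rewrite /structure_field takiff_ev_linform; set z := br (e y) (e i).
have rec j := tmod_rec size_p z j.
have /choice[h eh] := wave_mod (T := fun k => tmod k z) size_p rec.
exists (\sum_(k < n) (g`_k)%:A *: h k).
rewrite takiff_gen_basis raddf_sum /=.
transitivity (\sum_(k < n) (g`_k)%:A *: wave p n (fun k => tmod k z) k).
  rewrite /wave; under [RHS]eq_bigr => k _ do rewrite scaler_sumr.
  rewrite exchange_big; apply: eq_bigr => s _ /=.
  rewrite map_vfield_emb /vfield dext_gen /field_mod /= scaler_suml.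
  by apply: eq_bigr => k _; rewrite scalerA mulr_algl.
transitivity (\sum_(k < n) ((g`_k)%:A *: 'X^k * takiff_gen z - emb SW p * ((g`_k)%:A *: h k))).
  apply: eq_bigr => k _; rewrite (eh k) scalerBr scalerAl; congr (_ - _).
  exact: scalerAr.
rewrite sumrB -mulr_suml -mulr_sumr; congr (_ * _ - _).
apply/polyP => j; rewrite coef_emb coef_sum.
have [lt_jn|le_nj] := ltnP j n.
  rewrite (bigD1 (Ordinal lt_jn)) //= coefZ coefXn eqxx mulr1 big1 ?addr0 // => k ne_kj.
  by rewrite coefZ coefXn (negbTE (_ : j != val k)) ?mulr0 // eq_sym.
rewrite [g`_j]nth_default ?(leq_trans sg) // scale0r big1 // => k _.
by rewrite coefZ coefXn (gtn_eqF (leq_trans (ltn_ord k) le_nj)) mulr0.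
Qed.

Lemma map_field_takiff_ev y (g : {poly K}) f : (size g <= n)%N -> exists h,
  map_poly (vfield (field_mod y g)) (takiff_ev f) =
  emb SW g * takiff_ev (dext idfun (L y) f) - emb SW p * h.
Proof.
move=> sg; have /choice[h eh] := fun i => map_field_takiff_gen y i sg.
exists (\sum_i takiff_ev (pderiv i f) * h i).
rewrite map_vfield_ev dext_fin rmorph_sum !mulr_sumr -sumrB.
apply: eq_bigr => i _; rewrite /= eh -/(takiff_ev _) rmorphM /=.
by rewrite mulrBr; congr (_ - _); apply: mulrCA.
Qed.

Definition bracket_mod (a b : 'I_D * 'I_n) : SW := tmod (a.2 + b.2) (br (e a.1) (e b.1)).

Lemma bracket_mod_anti a b : bracket_mod a b = - bracket_mod b a.
Proof. by rewrite /bracket_mod br_anti linearN addnC. Qed.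

Lemma dextN (I : choiceType) (w : I -> sym K I) f :
  dext idfun (fun i => - w i) f = - dext idfun w f.
Proof. by rewrite /dext -sumrN; apply: eq_bigr => i _; rewrite mulrN. Qed.

Lemma ZcentreE Y : Zcentre br p Y <-> (forall a, dext idfun (bracket_mod a) Y = 0).
Proof.
have anti a : dext idfun (bracket_mod^~ a) Y = - dext idfun (bracket_mod a) Y.
  by rewrite -dextN; apply: eq_dext => // b; apply: bracket_mod_anti.
split=> [Z a|Z G].
  have := Z (gen K a); rewrite /poisson_mod poissonEr dext_gen.
  rewrite -[dext _ _ _]/(dext idfun (bracket_mod^~ a) Y) anti => /eqP.
  by rewrite oppr_eq0 => /eqP.
rewrite /poisson_mod poissonEr; apply: big1 => a _ /=.
by rewrite -[dext _ _ _]/(dext idfun (bracket_mod^~ a) Y) anti Z oppr0 mulr0.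
Qed.

Lemma vfield_modE y (g : {poly K}) f : vfield (field_mod y g) f =
  \sum_(k < n) g`_k *: dext idfun (bracket_mod (y, k)) f.
Proof.
rewrite /vfield /dext; under [RHS]eq_bigr => k _ do rewrite scaler_sumr.
rewrite exchange_big; apply: eq_bigr => b _ /=.
by rewrite mulr_sumr; apply: eq_bigr => k _; rewrite scalerAr.
Qed.

Lemma Zcentre_vfield Y : Zcentre br p Y -> forall y g, vfield (field_mod y g) Y = 0.
Proof.
by move=> /ZcentreE Z y g; rewrite vfield_modE big1 // => k _; rewrite Z scaler0.
Qed.

Lemma vfield_modX y (k : 'I_n) f :
  vfield (field_mod y 'X^k) f = dext idfun (bracket_mod (y, k)) f.
Proof.
rewrite vfield_modE (bigD1 k) //= coefXn eqxx scale1r big1 ?addr0 // => l ne_lk.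
by rewrite coefXn (negbTE (_ : val l != val k)) ?scale0r.
Qed.

(** The field of y t^k sends F(Phi) to X^k times a derivative of F, which is 0,
   modulo p, and the multiples of p vanish at its roots. *)
Lemma Zcentre_root f (v0 : K) : (forall y, dext idfun (L y) f = 0) ->
  p.[v0] = 0 -> Zcentre br p (takiff_ev f).[v0%:A].
Proof.
move=> finv pv0; apply/ZcentreE => -[y k]; rewrite -vfield_modX.
have sk : (size ('X^k : {poly K}) <= n)%N by rewrite size_polyXn.
have [h eh] := map_field_takiff_ev y f sk.
have hornerE (g : {poly SW}) : vfield (field_mod y 'X^k) g.[v0%:A] =
    (map_poly (vfield (field_mod y 'X^k)) g).[v0%:A].
  have [] // := ddiff_map (phi := vfield (field_mod y 'X^k)) (c := v0%:A) (d := v0%:A) g.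
    exact: raddfD.
  by move=> x; rewrite !mulr_algr linearZ.
rewrite hornerE eh finv rmorph0 mulr0 sub0r hornerN hornerM horner_emb pv0.
by rewrite scale0r mul0r oppr0.
Qed.

End Takiff.

(** * Generators of the Poisson centre of a quotient *)

Section ScalarNewton.
Variables (K : fieldType) (a : nat -> K).

Definition newtonK (l : nat) : {poly K} := \prod_(j < l) ('X - (a j)%:P).

Lemma emb_newtonK (A : comAlgType K) l : emb A (newtonK l) = newton a A l.
Proof.
rewrite /newtonK rmorph_prod; apply: eq_bigr => j _.
by rewrite /= rmorphB /= embX embC.
Qed.

Lemma size_newtonK l : size (newtonK l) = l.+1.
Proof.
elim: l => [|l IHl]; first by rewrite /newtonK big_ord0 size_poly1.
have nz : newtonK l != 0 by rewrite -size_poly_gt0 IHl.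
by rewrite /newtonK big_ord_recr /= size_Mmonic ?monicXsubC // IHl size_XsubC addn2.
Qed.

Lemma newtonK_monic l : newtonK l \is monic.
Proof. by apply: monic_prod => j _; apply: monicXsubC. Qed.

(** The regular algebra K^o is used to see K as an algebra over itself. *)
Definition ncK (j : nat) (g : {poly K}) : K := nc a (A := K^o) j g.

Lemma nc_emb (A : comAlgType K) j g : nc a j (emb A g) = (ncK j g)%:A.
Proof.
symmetry; apply: (@nc_map K a K^o A (fun k => k%:A) j g) => [k x|k x].
  by rewrite scalerDl.
by rewrite scalerA.
Qed.

Lemma ncK_sum j (T : Type) (r : seq T) (P : pred T) (G : T -> {poly K}) :
  ncK j (\sum_(t <- r | P t) G t) = \sum_(t <- r | P t) ncK j (G t).
Proof. exact: (@nc_sum K a K^o). Qed.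

Lemma ncKZ j (k : K) g : ncK j (k *: g) = k * ncK j g.
Proof. exact: (@ncZ K a K^o). Qed.

Lemma ncK_eq0 n (g : {poly K}) : (size g <= n)%N ->
  (forall j : 'I_n, ncK j g = 0) -> g = 0.
Proof.
move=> sg g0; have := @nc_size K a K^o g n sg; rewrite big1 // => j _.
by rewrite [X in X *: _](g0 j) scale0r.
Qed.

End ScalarNewton.

Section CentreGenerators.
Variables (K : fieldType) (char0 : [pchar K] =i pred0).
Variables (q : vectType K) (br : lieBracket q) (m n : nat) (p : {poly K}) (a : nat -> K).
Hypothesis size_p : size p = n.+1.
Hypothesis p_roots : p = newtonK a n.
Local Notation D := (\dim {:q}).
Local Notation e := (@basisv K q).
Local Notation I := ('I_D * nat)%type.
Local Notation S := (sym K I).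
Local Notation SW := (sym K ('I_D * 'I_n)%type).
Local Notation Sq := (sym K 'I_D).
Local Notation L := (structure_field br).
Local Notation takiff_gen := (@takiff_gen K q n p).
Local Notation takiff_ev := (@takiff_ev K q n p).
Local Notation nc := (nc a).

Lemma size_takiff_gen z : (size (takiff_gen z) <= n)%N.
Proof.
apply: leq_trans (size_sum _ _ _) _; apply/bigmax_leqP => s _.
apply: leq_trans (size_scale_leq _ _) _; apply: leq_trans (size_poly _ _) _.
by rewrite size_drop_poly size_p subSS leq_subr.
Qed.

(** The truncated currents with the roots of p as nodes, mapped to q[t]/(p) by
   sending the generic element xi to the generic element Phi. This carries the
   fields D_(y,l) to Hamiltonian fields (to_takiff_D_cur). *)
Definition to_takiff : S -> SW :=
  subst (fun b : I => if (b.2 < n)%N then nc b.2 (takiff_gen (e b.1)) else 0).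
HB.instance Definition _ := GRing.LRMorphism.on to_takiff.

Lemma to_takiff_gen i j : (j < n)%N -> to_takiff (gen K (i, j)) = nc j (takiff_gen (e i)).
Proof. by move=> lt_jn; rewrite /to_takiff subst_gen /= lt_jn. Qed.

Lemma map_newton l (A B : comAlgType K) (f : {lrmorphism A -> B}) :
  map_poly f (newton a A l) = newton a B l.
Proof.
rewrite /newton rmorph_prod; apply: eq_bigr => j _ /=.
by rewrite rmorphB /= map_polyX map_polyC /= rmorph_alg.
Qed.

Lemma to_takiff_xi i : map_poly to_takiff (xi a n i) = takiff_gen (e i).
Proof.
rewrite [RHS](nc_size a (size_takiff_gen (e i))) /xi raddf_sum; apply: eq_bigr => j _ /=.
by rewrite map_polyZ /= to_takiff_gen // map_newton.
Qed.

Lemma to_takiff_evx f : map_poly to_takiff (evx a n f) = takiff_ev f.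
Proof.
rewrite /evx rmorph_ev; apply: eq_ev => [k|i] /=; last exact: to_takiff_xi.
by rewrite map_polyC /= rmorph_alg.
Qed.

Lemma to_takiff_nc j g : to_takiff (nc j g) = nc j (map_poly to_takiff g).
Proof. by apply: nc_map => [f1 f2|k f1]; rewrite ?rmorphD ?linearZ. Qed.

Lemma to_takiff_newton_coef j f : (j < n)%N ->
  to_takiff (newton_coef a j f) = nc j (takiff_ev f).
Proof. by move=> lt_jn; rewrite -(nc_evx a f lt_jn) to_takiff_nc to_takiff_evx. Qed.

Lemma emb_p : emb SW p = newton a SW n.
Proof. by rewrite p_roots emb_newtonK. Qed.

Lemma vfield_nc y g j (f : {poly SW}) : vfield (field_mod br p y g) (nc j f) =
  nc j (map_poly (vfield (field_mod br p y g)) f).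
Proof. by apply: nc_map => [f1 f2|k f1]; rewrite ?raddfD ?linearZ. Qed.

Lemma to_takiff_D_cur y l f : (l < n)%N -> trunc n f = f ->
  to_takiff (D_cur a L y l f) = vfield (field_mod br p y (newtonK a l)) (to_takiff f).
Proof.
move=> lt_ln <-; rewrite {1 2}/trunc D_cur_subst rmorph_dext lrmorph_subst.
rewrite {1}/vfield dext_subst; apply: eq_dext => [g|[i j]] /=.
  by rewrite lrmorph_subst.
rewrite -/(vfield _ _); case: ifP => [lt_jn|_]; last first.
  by rewrite D_cur0 !rmorph0 linear0.
rewrite (D_cur_gen _ _ _ _ _ lt_jn) to_takiff_nc rmorphM /= map_newton to_takiff_evx.
rewrite to_takiff_gen // vfield_nc.
have sl : (size (newtonK a l) <= n)%N by rewrite size_newtonK.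
have [h ->] := map_field_takiff_gen br size_p y i sl.
by rewrite emb_p emb_newtonK ncD ncN (nc_newton_lt _ _ lt_jn) subr0.
Qed.

Definition takiff_mx : 'M[K]_n := \matrix_(j, s) ncK a j (drop_poly s.+1 p).

(** The polynomials d_s have pairwise distinct degrees below n, hence their Newton
   coordinates form an invertible matrix. *)
Lemma takiff_unit : takiff_mx \in unitmx.
Proof.
rewrite -unitmx_tr -row_free_unit -kermx_eq0; apply/eqP/row_matrixP => i0.
rewrite row0; set c := row i0 _.
have cU : c *m takiff_mx^T = 0 by rewrite -row_mul mulmx_ker row0.
pose g := \sum_(s < n) c 0 s *: drop_poly s.+1 p.
have g0 : g = 0.
  apply: (@ncK_eq0 _ a n) => [|j].
    apply: leq_trans (size_sum _ _ _) _; apply/bigmax_leqP => s _.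
    apply: leq_trans (size_scale_leq _ _) _.
    by rewrite size_drop_poly size_p subSS leq_subr.
  have := congr1 (fun M : 'rV_n => M 0 j) cU; rewrite !mxE => <-.
  by rewrite ncK_sum; apply: eq_bigr => s _; rewrite ncKZ !mxE.
have pn : p`_n = 1.
  by have := newtonK_monic a n; rewrite -p_roots monicE lead_coefE size_p => /eqP.
(* The coefficient of degree n - (s+1) of g is c_s plus a combination of the
   earlier c's, since p is monic. *)
suff c0 k : forall s : 'I_n, (s < k)%N -> c 0 s = 0.
  by apply/rowP => s; rewrite (c0 n) // mxE.
elim: k => // k IHk s; rewrite ltnS => le_sk.
have := congr1 (fun h : {poly K} => h`_(n - s.+1)) g0.
rewrite coef0 coef_sum (bigD1 s) //= coefZ coef_drop_poly subnK // pn mulr1.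
rewrite big1 ?addr0 // => t ne_ts; rewrite coefZ.
have [lt_ts|le_st] := ltnP t s; first by rewrite IHk ?mul0r ?(leq_trans lt_ts).
rewrite coef_drop_poly nth_default ?mulr0 // size_p.
have lt_st : (s < t)%N by rewrite ltn_neqAle le_st andbT eq_sym.
by rewrite -{1}(subnK (ltn_ord s)) -addnS leq_add2l.
Qed.

Definition from_takiff : SW -> S :=
  subst (fun b : 'I_D * 'I_n => \sum_j invmx takiff_mx b.2 j *: gen K (b.1, val j)).
HB.instance Definition _ := GRing.LRMorphism.on from_takiff.

Lemma to_takiff_genE i (j : 'I_n) :
  to_takiff (gen K (i, val j)) = \sum_s takiff_mx j s *: gen K (i, s).
Proof.
rewrite (to_takiff_gen i (ltn_ord j)) takiff_gen_basis // nc_sum; apply: eq_bigr => s _.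
by rewrite ncZ nc_emb mulr_algr mxE.
Qed.

Lemma mulmx1_sum (V : lmodType K) (M N : 'M[K]_n) s (G : 'I_n -> V) : M *m N = 1%:M ->
  \sum_j \sum_t (M s j * N j t) *: G t = G s.
Proof.
move=> MN; rewrite exchange_big /= -[RHS]scale1r.
have MNE t : \sum_j M s j * N j t = (s == t)%:R.
  by have := congr1 (fun X : 'M_n => X s t) MN; rewrite !mxE.
rewrite (bigD1 s) //= -scaler_suml MNE eqxx big1 ?addr0 // => t ne_ts.
by rewrite -scaler_suml MNE eq_sym (negbTE ne_ts) scale0r.
Qed.

Lemma from_takiffK f : to_takiff (from_takiff f) = f.
Proof.
move: f; apply: (subst_ext (f1 := to_takiff \o from_takiff) (f2 := idfun)) => -[i s] /=.
rewrite /from_takiff subst_gen rmorph_sum /=.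
rewrite -[RHS](mulmx1_sum s (fun t => gen K (i, t)) (mulVmx takiff_unit)).
apply: eq_bigr => j _; rewrite linearZ /= to_takiff_genE scaler_sumr.
by apply: eq_bigr => t _; rewrite scalerA.
Qed.

Lemma to_takiffK f : trunc n f = f -> from_takiff (to_takiff f) = f.
Proof.
move=> <-; move: f; apply: (subst_ext (f1 := from_takiff \o to_takiff \o trunc n)
  (f2 := trunc n)) => -[i j] /=.
rewrite trunc_gen /=; case: ifP => [lt_jn|]; last by rewrite !rmorph0.
rewrite (to_takiff_genE i (Ordinal lt_jn)) rmorph_sum /=.
rewrite -[RHS](mulmx1_sum (Ordinal lt_jn) (fun t => gen K (i, val t)) (mulmxV takiff_unit)).
apply: eq_bigr => s _; rewrite linearZ /= /from_takiff subst_gen scaler_sumr.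
by apply: eq_bigr => t _; rewrite scalerA.
Qed.

Lemma trunc_from_takiff f : trunc n (from_takiff f) = from_takiff f.
Proof.
rewrite /from_takiff lrmorph_subst; apply: eq_subst => b /=.
rewrite rmorph_sum; apply: eq_bigr => j _ /=.
by rewrite linearZ /= trunc_gen /= ltn_ord.
Qed.

Lemma D_cur_high y l f : (n <= l)%N -> trunc n f = f -> D_cur a L y l f = 0.
Proof.
move=> le_nl <-; rewrite /trunc D_cur_subst; apply: big1 => -[i j] _ /=.
case: ifP => [lt_jn|_]; last by rewrite D_cur0 mulr0.
rewrite (D_cur_gen _ _ _ _ _ (ltnSn j)) nc_newton_lt ?mulr0 //.
exact: leq_trans le_nl.
Qed.

Variable F : 'I_m -> Sq.
Hypothesis F_inv : forall i y, dext idfun (L y) (F i) = 0.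
Hypothesis L_index : exists t, (\rank (kermx (adp L t)) <= m)%N.
Hypothesis F_reg : exists t (M : 'M[K]_(D, m)), \det (jacp F t *m M) != 0.
Hypothesis F_big : forall f : Sq, ~ (exists c : K, f = c%:A) ->
  exists2 t, evp t f = 0 & exists M : 'M[K]_(D, m), \det (jacp F t *m M) != 0.
Hypothesis F_gen : forall H : Sq, (forall y, dext idfun (L y) H = 0) ->
  exists P, H = subst F P.
Hypothesis F_indep : alg_independent F.

(** The isomorphism from_takiff turns an element of the centre into an invariant of
   the truncated currents, and those are generated by the Newton coordinates of
   the F_i(xi). *)
Theorem Zcentre_generated (Y : SW) : Zcentre br p Y ->
  generated_subalgebra
    (fun Z => exists i j, (j < n)%N /\ Z = nc j (takiff_ev (F i))) Y.
Proof.
move=> ZY B [B1 BL BM] FB; rewrite -(from_takiffK Y).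
have tH := trunc_from_takiff Y.
have DH y l : D_cur a L y l (from_takiff Y) = 0.
  have [lt_ln|le_nl] := ltnP l n; last exact: D_cur_high.
  have tD := trunc_D_cur a L y l tH.
  rewrite -(to_takiffK tD) to_takiff_D_cur // from_takiffK.
  by rewrite (Zcentre_vfield ZY) rmorph0.
have gH := newton_generated char0 F_inv L_index F_reg F_big F_gen F_indep tH DH.
apply: (gH (fun f => B (to_takiff f))).
  split=> [|k x y Bx By|x y Bx By]; first by rewrite rmorph1.
    by rewrite linearD linearZ; apply: BL.
  by rewrite rmorphM; apply: BM.
move=> Z [i [j [lt_jn ->]]]; rewrite to_takiff_newton_coef //.
by apply: FB; exists i, j.
Qed.

End CentreGenerators.

(** * Invariants of the negative half of the loop algebra *)

Section Support.
Variables (K : fieldType) (I : choiceType).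
Implicit Types f g : sym K I.

Lemma varsP i f : reflect (exists2 u, scoef u f != 0 & u i != 0%N) (i \in vars f).
Proof.
apply: (iffP (bigfcupP _ _ _ _)) => [[u]|[u uf ui]].
  by rewrite andbT scoef_supp => uf iu; exists u => //; rewrite cmE_neq0.
by exists u; rewrite ?scoef_supp ?uf // -cmE_neq0.
Qed.

Lemma vars_cst i (k : K) : i \notin vars (k%:A : sym K I).
Proof.
apply/varsP => -[u]; rewrite scoefZ -mono1 scoef_mono.
by have [<-|_] := eqVneq (onecm I) u; rewrite ?onecmE ?mulr0 ?eqxx // => _.
Qed.

Lemma varsD i f g : i \in vars (f + g) -> i \in vars f \/ i \in vars g.
Proof.
move=> /varsP[u]; rewrite scoefD => fg ui.
have [f0|f0] := eqVneq (scoef u f) 0; last by left; apply/varsP; exists u.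
by right; apply/varsP; exists u => //; move: fg; rewrite f0 add0r.
Qed.

Lemma vars_genM i j f : i \in vars (gen K j * f) -> i = j \/ i \in vars f.
Proof.
move=> /varsP[u]; rewrite [X in gen K j * X](sym_monoE f) mulr_sumr scoef_sum => + ui.
move=> /eqP nz; apply: NNPP => /not_or_and[ij nif]; apply: nz.
rewrite big1_seq // => w /andP[_ wf].
rewrite -scalerAr scoefZ gen_mono -monoM scoef_mono.
case: eqP => [e|_]; last by rewrite mulr0.
case: nif; apply/varsP; exists w; first by rewrite -scoef_supp.
move: ui; rewrite -e mulcmE ucmE; have [e'|_] := eqVneq j i; last by rewrite add0n.
by case: ij; rewrite e'.
Qed.

Lemma eq_subst_vars (A : comAlgType K) (v w : I -> A) f :
  {in vars f, v =1 w} -> subst v f = subst w f.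
Proof.
move=> e; apply: eq_big_seq => u uf; congr (_ *: _); apply: eq_big_seq => i iu.
by rewrite e //; apply: (fsubsetP (finsupp_vars uf)).
Qed.

End Support.

Section Ideals.
Variables (K : fieldType) (A : comAlgType K) (X : A -> Prop).
Local Notation ideal := (generated_ideal X).

Lemma ideal0 : ideal 0.
Proof. by exists 0%N, (fun=> 0), (fun=> 0); split=> [[]|] //; rewrite big_ord0. Qed.

Lemma idealMl x y : ideal y -> ideal (x * y).
Proof.
move=> [r [a [g [Xg ->]]]]; exists r, (fun i => x * a i), g; split=> //.
by rewrite mulr_sumr; apply: eq_bigr => i _; rewrite mulrA.
Qed.

Lemma idealD x y : ideal x -> ideal y -> ideal (x + y).
Proof.
move=> [r [a [g [Xg ->]]]] [r' [a' [g' [Xg' ->]]]].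
pose cat (h : 'I_r -> A) (h' : 'I_r' -> A) (i : 'I_(r + r')) :=
  match split i with inl j => h j | inr j => h' j end.
exists (r + r')%N, (cat a a'), (cat g g'); split=> [i|].
  by rewrite /cat; case: (split i).
rewrite big_split_ord; congr (_ + _); apply: eq_bigr => i _; rewrite /cat.
  by case: splitP => [j /= /ord_inj->|k /= e] //; have := ltn_ord i; rewrite e ltnNge leq_addr.
case: splitP => [j /= e|k /= /addnI/ord_inj->] //.
by have := ltn_ord j; rewrite -e ltnNge leq_addr.
Qed.

Lemma ideal_gen x : X x -> ideal x.
Proof.
by move=> Xx; exists 1%N, (fun=> 1), (fun=> x); split=> //; rewrite big_ord1 mul1r.
Qed.

End Ideals.

Section Loop.
Variables (K : fieldType) (q : vectType K) (br : lieBracket q).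
Local Notation D := (\dim {:q}).
Local Notation e := (@basisv K q).
Local Notation Sloop := (sym K ('I_D * int)%type).
Local Notation S := (sym K ('I_D * nat)%type).
Local Notation L := (structure_field br).
Local Notation zero_nodes := (fun _ : nat => 0 : K).

(** The quotient by the ideal of q[t], with x t^(-k-1) renamed (x, k). *)
Definition loop_proj : Sloop -> S :=
  subst (fun b => if b.2 is Negz k then gen K (b.1, k) else 0).
HB.instance Definition _ := GRing.LRMorphism.on loop_proj.

Definition loop_incl : S -> Sloop := subst (fun b => gen K (b.1, Negz b.2)).
HB.instance Definition _ := GRing.LRMorphism.on loop_incl.

Lemma loop_proj_gen b : loop_proj (gen K b) = if b.2 is Negz k then gen K (b.1, k) else 0.
Proof. exact: subst_gen. Qed.

Lemma loop_incl_gen b : loop_incl (gen K b) = gen K (b.1, Negz b.2).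
Proof. exact: subst_gen. Qed.

Lemma loop_inclK f : loop_proj (loop_incl f) = f.
Proof.
move: f; apply: (subst_ext (f1 := loop_proj \o loop_incl) (f2 := idfun)) => -[i j] /=.
by rewrite loop_incl_gen loop_proj_gen.
Qed.

Lemma loop_proj_pos x k : loop_proj (tens x (Posz k)) = 0.
Proof.
rewrite /tens rmorph_sum big1 // => i _ /=.
by rewrite linearZ /= loop_proj_gen scaler0.
Qed.

Lemma loop_proj_neg x k : loop_proj (tens x (Negz k)) = tens x k.
Proof.
rewrite /tens rmorph_sum; apply: eq_bigr => i _ /=.
by rewrite linearZ /= loop_proj_gen.
Qed.

(** Modulo the ideal every polynomial is equal to its part in the negative
   variables. *)
Lemma ideal_loop_proj f : generated_ideal (@in_current K q) f <-> loop_proj f = 0.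
Proof.
split=> [[r [a [g [Xg ->]]]]|rf].
  rewrite rmorph_sum big1 // => i _ /=; have [x [k ->]] := Xg i.
  by rewrite rmorphM /= loop_proj_pos mulr0.
suff gen_ideal h : generated_ideal (@in_current K q) (h - loop_incl (loop_proj h)).
  by have := gen_ideal f; rewrite rf rmorph0 subr0.
elim/sym_ind: h => [k|h1 h2 I1 I2|[i [z|z]] h Ih].
- by rewrite !rmorph_alg subrr; apply: ideal0.
- by rewrite !rmorphD /= opprD addrACA; apply: idealD.
- rewrite !rmorphM /= loop_proj_gen /= rmorph0 mul0r subr0 mulrC; apply: idealMl.
  by apply: ideal_gen; exists (e i), z; rewrite tens_basis.
- rewrite !rmorphM /= loop_proj_gen /= loop_incl_gen -mulrBr.
  exact: idealMl.
Qed.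

Lemma in_SnegE Y : in_Sneg Y <-> loop_incl (loop_proj Y) = Y.
Proof.
have lrE : loop_incl (loop_proj Y) = subst (fun b => loop_incl (loop_proj (gen K b))) Y.
  rewrite /loop_proj lrmorph_subst; apply: eq_subst => b /=.
  by rewrite !subst_gen.
split=> [Yneg|<-].
  rewrite lrE -[RHS]subst_id; apply: eq_subst_vars => -[i [z|z]] /Yneg //= _.
  by rewrite loop_proj_gen loop_incl_gen.
elim/sym_ind: (loop_proj Y) => [k b|f g If Ig b|[i j] f If b].
- by rewrite rmorph_alg (negbTE (vars_cst _ _)).
- by rewrite rmorphD => /varsD[/If|/Ig].
- by rewrite rmorphM /= loop_incl_gen => /vars_genM[->|/If].
Qed.

Lemma newton_zero (A : comAlgType K) l : newton zero_nodes A l = 'X^l.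
Proof.
rewrite /newton (eq_bigr (fun=> 'X)) ?prodr_const ?card_ord // => i _.
by rewrite scale0r subr0.
Qed.

Lemma evx_linform (a : nat -> K) n z :
  evx a n (linform z) = \sum_(l < n) tens z (val l) *: newton a S l.
Proof.
rewrite /linform rmorph_sum /=.
under eq_bigr => i _ do rewrite /evx evZ ev_gen /= mul_polyC /xi scaler_sumr.
rewrite exchange_big; apply: eq_bigr => l _ /=.
rewrite /tens scaler_suml; apply: eq_bigr => i _.
by rewrite scalerA mulr_algl.
Qed.

(** With all nodes equal to 0 the Newton polynomials are the powers of X, and taking
   the j-th coefficient of X^k xi is the shift of the index caused by t^k; the terms
   that leave the negative part are killed by the projection. *)
Lemma loop_proj_poisson y k f :
  loop_proj (poisson_loop br (tens (e y) (Posz k)) (loop_incl f)) = D_cur zero_nodes L y k f.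
Proof.
rewrite tens_basis /poisson_loop poisson_gen /loop_incl dext_subst rmorph_dext.
apply: eq_dext => [g|[i j]] /=; first by rewrite loop_inclK.
rewrite dext_gen /= /structure_field evx_linform; set z := br _ _.
rewrite mulr_sumr nc_sum.
transitivity (\sum_(l < j.+1) (j == k + l)%N%:R *: tens z (val l) : S).
  have [le_kj|lt_jk] := leqP k j.
    have lt_jk1 : (j - k < j.+1)%N by rewrite ltnS leq_subr.
    have -> : Posz k + Negz j = Negz (j - k).
      by rewrite !NegzE -subSn // -subzn 1?ltnW // opprB.
    rewrite loop_proj_neg (bigD1 (Ordinal lt_jk1)) //= subnKC // eqxx scale1r big1 ?addr0 // => l.
    rewrite -val_eqE /= => ne_l; case: eqP => [e'|_]; last by rewrite scale0r.
    by have := addKn k l; rewrite -e' => /esym/eqP; rewrite (negbTE ne_l).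
  have -> : Posz k + Negz j = Posz (k - j.+1) by rewrite NegzE subzn.
  rewrite loop_proj_pos big1 // => l _.
  by rewrite (ltn_eqF (leq_trans lt_jk (leq_addr _ _))) scale0r.
apply: eq_bigr => l _; rewrite -scalerAr ncZ !newton_zero -exprD -newton_zero nc_basis.
by rewrite mulrC -scaler_nat; case: (_ == _); rewrite ?scale1r ?mul1r ?scale0r ?mul0r.
Qed.

Lemma Zhat_negE Y : Zhat_neg br Y <->
  loop_incl (loop_proj Y) = Y /\ forall y k, D_cur zero_nodes L y k (loop_proj Y) = 0.
Proof.
split=> [[/in_SnegE YE inv]|[YE inv]].
  split=> // y k; rewrite -loop_proj_poisson YE.
  exact/ideal_loop_proj/inv.
split=> [|x k]; first exact/in_SnegE.
apply/ideal_loop_proj; rewrite /poisson_loop poissonEl /tens.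
elim/big_rec: _ => [|i f _ IHf]; first by rewrite dext0 rmorph0.
rewrite dextD rmorphD /= IHf addr0 dextZ /= rmorphM /= dext_gen.
have := loop_proj_poisson i k (loop_proj Y).
by rewrite YE tens_basis /poisson_loop poisson_gen inv /= => ->; rewrite mulr0.
Qed.

Lemma trunc_exists f : exists n, trunc n f = f :> S.
Proof.
elim/sym_ind: f => [k|f g [n nf] [n' ng]|[i j] f [n nf]].
- by exists 0%N; rewrite rmorph_alg.
- exists (maxn n n'); rewrite rmorphD /=.
  by rewrite (trunc_le (leq_maxl n n') nf) (trunc_le (leq_maxr n n') ng).
- exists (maxn n j.+1); rewrite rmorphM /= trunc_gen /= leq_maxr.
  by rewrite (trunc_le (leq_maxl n j.+1) nf).
Qed.

Variables (n : nat) (p : {poly K}).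
Local Notation SW := (sym K ('I_D * 'I_n)%type).

(** The variable (x, j) stands for x t^(-j-1), which is sent to x t^(j+1). *)
Definition psi_incl : S -> SW := subst (fun b => tmod n p b.2.+1 (e b.1)).
HB.instance Definition _ := GRing.LRMorphism.on psi_incl.

Lemma psi_flip_incl f : psi n p (flip (loop_incl f)) = psi_incl f.
Proof.
rewrite /flip /loop_incl /psi !lrmorph_subst /psi_incl; apply: eq_subst => b /=.
by rewrite /= !subst_gen /= subst_gen.
Qed.

Lemma psi_Zhat_pos Y : (exists2 Z, Zhat_pos br Z & Y = psi n p Z) <->
  exists2 f, (forall y k, D_cur zero_nodes L y k f = 0) & Y = psi_incl f.
Proof.
split=> [[Z [Y' [/Zhat_negE[YE inv] ->]] ->]|[f inv ->]].
  by exists (loop_proj Y') => //; rewrite -psi_flip_incl YE.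
exists (flip (loop_incl f)); last by rewrite psi_flip_incl.
by exists (loop_incl f); split=> //; apply/Zhat_negE; rewrite loop_inclK.
Qed.

End Loop.

(** * Subalgebras, interpolation and the pencil of quotients *)

(** The degree d depends on F only, not on the point or on the scalar s, as both
   will be polynomials. *)
Lemma ev_homogeneous (K : fieldType) (I : choiceType) (A : comNzRingType)
    (c : {rmorphism K -> A}) (F : sym K I) : homogeneous F ->
  exists d, forall (s : A) v, ev c (fun i => s * v i) F = s ^+ d * ev c v F.
Proof.
move=> [d hd]; exists d => s v; rewrite /ev mulr_sumr; apply: eq_big_seq => u /hd du.
rewrite mulrCA; congr (_ * _); rewrite /monev -du /mdeg -prodrXr -big_split /=.
by apply: eq_bigr => i _; rewrite exprMn.
Qed.

Section Subalgebra.
Variables (K : fieldType) (char0 : [pchar K] =i pred0) (A : comAlgType K).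
Variable B : A -> Prop.
Hypothesis algB : is_subalgebra B.

Lemma subalg0 : B 0.
Proof. by have [B1 BL _] := algB; have := BL (-1) 1 1 B1 B1; rewrite scaleN1r addNr. Qed.

Lemma subalgZ c x : B x -> B (c *: x).
Proof. by have [_ BL _] := algB => Bx; have := BL c x 0 Bx subalg0; rewrite addr0. Qed.

Lemma subalgD x y : B x -> B y -> B (x + y).
Proof. by have [_ BL _] := algB => Bx By; have := BL 1 x y Bx By; rewrite scale1r. Qed.

Lemma subalg_sum (T : Type) (r : seq T) (P : pred T) (G : T -> A) :
  (forall i, P i -> B (G i)) -> B (\sum_(i <- r | P i) G i).
Proof.
by move=> BG; elim/big_rec: _ => [|i x Pi Bx]; [exact: subalg0 | apply: subalgD (BG i Pi) Bx].
Qed.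

Definition coefs_in (f : {poly A}) : Prop := forall i, B f`_i.

Lemma coefs_in_emb g f : coefs_in f -> coefs_in (emb A g * f).
Proof.
move=> Bf i; rewrite coefM; apply: subalg_sum => j _.
by rewrite coef_emb mulr_algl; apply: subalgZ.
Qed.

Lemma coefs_in_horner f (t : K) : coefs_in f -> B f.[t%:A].
Proof.
move=> Bf; rewrite horner_coef; apply: subalg_sum => i _.
by rewrite -(rmorphXn (GRing.in_alg A)) /= mulr_algr; apply: subalgZ.
Qed.

Lemma coefs_in_nc (a : nat -> K) j f : coefs_in f -> B (nc a j f).
Proof.
move=> Bf; rewrite -[f]coefK poly_def nc_sum; apply: subalg_sum => i _.
rewrite ncZ -embX -rmorphXn nc_emb mulr_algr; exact: subalgZ.
Qed.

(** Divided differences at an allowed point t0 take values in B at the points other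
   than t0, and have smaller degree. Hence the induction is over all finite sets
   of forbidden points. *)
Lemma interpolation f : (forall t : K, t != 0 -> B f.[t%:A]) -> coefs_in f.
Proof.
suff H N : forall (s : seq K) (g : {poly A}), (size g <= N)%N ->
    (forall t, t \notin s -> B g.[t%:A]) -> coefs_in g.
  by move=> Bf; apply: (H _ [:: 0] f (leqnn _)) => t; rewrite inE; apply: Bf.
elim: N => [|N IHN] s g.
  by rewrite leqn0 size_poly_eq0 => /eqP-> _ i; rewrite coef0; apply: subalg0.
move=> sg Bg; have [t _ nts] := poly_nonroot char0 s (oner_neq0 {poly K}).
have gE := ddiffE t%:A g; set h := ddiff _ g in gE.
have Bh : coefs_in h.
  apply: (IHN (t :: s)) => [|t'].
    have [->|h0] := eqVneq h 0; first by rewrite size_poly0.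
    have := size_Mmonic h0 (monicXsubC t%:A); rewrite size_XsubC addn2 /= => sh.
    rewrite -ltnS -sh (_ : h * _ = g - (g.[t%:A])%:P); last by rewrite {1}gE addrK.
    apply: leq_trans (size_polyD _ _) _; rewrite geq_max sg size_polyN.
    exact: leq_trans (size_polyC_leq1 _) _.
  rewrite inE negb_or => /andP[ne_t nt's].
  have d0 : t' - t != 0 by rewrite subr_eq0.
  have := congr1 (fun f : {poly A} => (t' - t)^-1 *: (f.[t'%:A] - g.[t%:A])) gE.
  rewrite hornerD hornerC addrK hornerM hornerXsubC -scalerBl mulr_algr scalerA mulVf //.
  rewrite scale1r => <-; apply/subalgZ/subalgD; first exact: Bg.
  by rewrite -scaleN1r; apply/subalgZ/Bg.
move=> i; rewrite gE coefD mulrBr coefB coefMX coefMC coefC mulr_algr.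
apply: subalgD; last by case: (i == _); [exact: Bg | exact: subalg0].
apply: subalgD; last by rewrite -scaleN1r; do 2!apply: subalgZ; apply: Bh.
by case: (i == _); [exact: subalg0 | exact: Bh].
Qed.

End Subalgebra.

Lemma generated_is_subalgebra (K : fieldType) (A : comAlgType K) (X : A -> Prop) :
  is_subalgebra (generated_subalgebra X).
Proof.
split=> [B [] //|c x y gx gy B aB XB|x y gx gy B aB XB].
  by have [_ BL _] := aB; apply: BL; [apply: gx | apply: gy].
by have [_ _ BM] := aB; apply: BM; [apply: gx | apply: gy].
Qed.

Lemma generated_sub (K : fieldType) (A : comAlgType K) (X : A -> Prop) x :
  X x -> generated_subalgebra X x.
Proof. by move=> Xx B _; apply. Qed.

Lemma poly_congXn (A : comNzRingType) (f g : {poly A}) N :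
  (forall j, (j < N)%N -> f`_j = g`_j) -> exists h, f = g + 'X^N * h.
Proof.
move=> e; exists (drop_poly N (f - g)).
rewrite -[LHS](addrNK g) addrC; congr (_ + _).
rewrite -[LHS](poly_take_drop N) mulrC (_ : take_poly N _ = 0) ?add0r //.
apply/polyP => j; rewrite coef_take_poly coef0; case: ifP => // /e.
by rewrite coefB => ->; rewrite subrr.
Qed.

Lemma poly_invXn (K : fieldType) (g : {poly K}) N : g.[0] != 0 ->
  exists u v : {poly K}, u * g + v * 'X^N = 1.
Proof.
move=> g0; have : coprimep g 'X^N.
  by rewrite coprimep_expr // coprimepX.
by case/Bezout_eq1_coprimepP => -[u v] e; exists u, v.
Qed.

Section Pencil.
Variables (K : fieldType) (char0 : [pchar K] =i pred0).
Variables (q : vectType K) (n : nat) (p : {poly K}).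
Hypothesis size_p : size p = n.+1.
Hypothesis n_gt0 : (0 < n)%N.
Hypothesis p_monic : p \is monic.
Local Notation D := (\dim {:q}).
Local Notation e := (@basisv K q).
Local Notation SW := (sym K ('I_D * 'I_n)%type).
Local Notation S := (sym K ('I_D * nat)%type).
Local Notation Sq := (sym K 'I_D).
Local Notation zero_nodes := (fun _ : nat => 0 : K).
Local Notation psi_incl := (@psi_incl K q n p).
Local Notation T i k := (@tmod K q n p k (e i)).
Local Notation const := (@polyC SW \o GRing.in_alg SW).

(** This is the polynomial X Phi(x_i) - x_i p, which is common to all members of the
   pencil (X_takiff_gen). *)
Definition pencil_gen (i : 'I_D) : {poly SW} := wave p n (fun k => T i k) 1.

Definition pencil_ev : Sq -> {poly SW} := ev const pencil_gen.
HB.instance Definition _ := GRing.RMorphism.on pencil_ev.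

(** The reversed polynomial u^(n-1) E_i(1/u), to be compared with power series in u
   whose coefficients are the x_i t^(j+1). *)
Definition rev_gen (i : 'I_D) : {poly SW} := \poly_(j < n) (pencil_gen i)`_(n.-1 - j).

Definition rev_p : {poly K} := \poly_(l < n.+1) p`_(n - l).

Lemma rev_p0 : rev_p.[0] != 0.
Proof.
rewrite horner_coef0 coef_poly subn0 /=.
by have := p_monic; rewrite monicE lead_coefE size_p => /eqP->; apply: oner_neq0.
Qed.

Lemma size_pencil_gen i : (size (pencil_gen i) <= n)%N.
Proof.
apply: leq_trans (size_sum _ _ _) _; apply/bigmax_leqP => s _.
apply: leq_trans (size_scale_leq _ _) _; apply: leq_trans (size_poly _ _) _.
by rewrite size_drop_poly size_p subSS leq_subr.
Qed.

Lemma pencil_genE i : pencil_gen i = 'X * takiff_gen n p (e i) - T i 0 *: emb SW p.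
Proof. by apply: waveS => // j; apply: tmod_rec. Qed.

Lemma coef_pencil_gen i m : (pencil_gen i)`_m = \sum_(s < n) p`_(m + s.+1) *: T i s.+1.
Proof.
rewrite /pencil_gen /wave coef_sum; apply: eq_bigr => s _.
by rewrite coefZ coef_emb coef_drop_poly mulr_algr add1n.
Qed.

Lemma horner_rev_gen i (u : K) : u != 0 ->
  (rev_gen i).[u%:A] = (u ^+ n.-1)%:A * (pencil_gen i).[(u^-1)%:A].
Proof.
move=> u0; have powE (t : K) k : (t%:A : SW) ^+ k = (t ^+ k)%:A.
  by rewrite -(rmorphXn (GRing.in_alg SW)).
rewrite /rev_gen horner_poly (horner_coef_wide _ (size_pencil_gen i)).
rewrite mulr_sumr (reindex_inj rev_ord_inj); apply: eq_bigr => j _ /=.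
have le_j : (j <= n.-1)%N by rewrite -ltnS prednK.
have nj : (n - j.+1 = n.-1 - j)%N by lia.
rewrite nj subKn // !powE !mulr_algr mulr_algl scalerA; congr (_ *: _).
by rewrite exprVn -expfB_cond // (negbTE u0) add0n.
Qed.

Definition quot_evx N (f : Sq) : {poly SW} := map_poly psi_incl (evx zero_nodes N f).

Lemma nc_zero (A : comAlgType K) j (g : {poly A}) : nc zero_nodes j g = g`_j.
Proof.
have sg : (size g <= maxn (size g) j.+1)%N by apply: leq_maxl.
have lt_j : (j < maxn (size g) j.+1)%N by apply: leq_maxr.
rewrite [in RHS](nc_size zero_nodes sg) coef_sum (bigD1 (Ordinal lt_j)) //=.
rewrite newton_zero coefZ coefXn eqxx mulr1 big1 ?addr0 // => k ne_k.
by rewrite newton_zero coefZ coefXn (negbTE (_ : j != val k)) ?mulr0 // eq_sym.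
Qed.

Lemma coef_quot_evx N j f : (j < N)%N -> (quot_evx N f)`_j = psi_incl (newton_coef zero_nodes j f).
Proof. by move=> lt_j; rewrite -(nc_evx _ _ lt_j) nc_zero /quot_evx coef_map. Qed.

Definition quot_xi N (i : 'I_D) : {poly SW} := \poly_(j < N) T i j.+1.

Lemma quot_evxE N f : quot_evx N f = ev const (quot_xi N) f.
Proof.
rewrite /quot_evx /evx rmorph_ev; apply: eq_ev => [k|i] /=.
  by rewrite map_polyC /= rmorph_alg.
rewrite /xi raddf_sum /quot_xi poly_def; apply: eq_bigr => j _ /=.
by rewrite newton_zero map_polyZ /= map_polyXn /psi_incl subst_gen.
Qed.

(** The recurrence of the sequence x_i t^k makes its generating function rational,
   with denominator the reversed p. *)
Lemma rev_p_quot_xi N i : exists g, emb SW rev_p * quot_xi N i = rev_gen i + 'X^N * g.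
Proof.
apply: poly_congXn => j lt_jN; rewrite coefMr /rev_gen coef_poly.
transitivity (\sum_(s < j.+1) rev_p`_(j - s) *: T i s.+1).
  apply: eq_bigr => s _; rewrite coef_emb mulr_algl [(quot_xi N i)`_s]coef_poly.
  by rewrite (leq_ltn_trans _ lt_jN) // -ltnS.
have rpE s : (j - s <= n)%N -> rev_p`_(j - s) = p`_(n - (j - s)).
  by move=> le_s; rewrite coef_poly ltnS le_s.
case: ifP => [lt_jn|/negbT]; last rewrite -leqNgt => le_nj.
  rewrite coef_pencil_gen (big_ord_widen n (fun s => rev_p`_(j - s) *: T i s.+1)) // big_mkcond.
  apply: eq_bigr => s _ /=; case: ifP => [|/negbT]; [rewrite ltnS|rewrite -leqNgt] => js.
    rewrite rpE; last by rewrite (leq_trans (leq_subr _ _)) // ltnW.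
    by congr (p`_ _ *: _); lia.
  by rewrite nth_default ?scale0r // size_p; lia.
rewrite -(big_mkord xpredT (fun s => rev_p`_(j - s) *: T i s.+1)).
rewrite (big_cat_nat (n := (j - n)%N)) ?leq0n //=; last by lia.
rewrite big_nat big1 ?add0r => [|s /= js]; last first.
  by rewrite nth_default ?scale0r // (leq_trans (size_poly _ _)) //; lia.
rewrite -{1}[(j - n)%N]add0n big_addn (_ : (j.+1 - (j - n) = n.+1)%N); last by lia.
rewrite big_mkord -[RHS](tmod_rec size_p (e i) (j - n).+1); apply: eq_bigr => l _.
rewrite rpE; last by lia.
by congr (p`_ _ *: tmod _ _ _ _); have := ltn_ord l; lia.
Qed.

Variable f : Sq.
Hypothesis hf : homogeneous f.

(** The coefficients of F(rev_gen) are linked to the first family by the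
   multiplication by a power of rev_p, which is invertible modulo powers of u, and
   to the second one by interpolation, after the substitution v = 1/u. *)
Lemma pencil_values_coefficients (B : SW -> Prop) : is_subalgebra B ->
  (forall j, B (psi_incl (newton_coef zero_nodes j f))) <->
  (forall v : K, v != 0 -> B (pencil_ev f).[v%:A]).
Proof.
move=> algB; set R := ev const rev_gen f.
have evalc (g : 'I_D -> {poly SW}) (t : K) :
    (ev const g f).[t%:A] = ev (GRing.in_alg SW) (fun i => (g i).[t%:A]) f.
  have -> : (ev const g f).[t%:A] = horner_eval (t%:A : SW) (ev const g f) by [].
  rewrite (rmorph_ev const g (horner_eval (t%:A : SW))); apply: eq_ev => // k.
  by rewrite /= /horner_eval hornerC.
have [d0 hd] := ev_homogeneous (GRing.in_alg SW : {rmorphism K -> SW}) hf.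
have scal (u : K) : u != 0 -> R.[u%:A] = (u ^+ n.-1 ^+ d0) *: (pencil_ev f).[(u^-1)%:A].
  move=> u0; rewrite /R /pencil_ev !evalc.
  rewrite (eq_ev (fun k => erefl _) (fun i => horner_rev_gen i u0)) hd.
  by rewrite -(rmorphXn (GRing.in_alg SW)) /= mulr_algl.
have [d hdX] := ev_homogeneous const hf.
have RX N : exists g, emb SW (rev_p ^+ d) * quot_evx N f = R + 'X^N * g.
  have /choice[r hr] := rev_p_quot_xi N.
  rewrite quot_evxE rmorphXn -hdX; exact: ev_cong hr.
split=> [Bk v v0|BE j].
  have BR : coefs_in B R.
    move=> j; have [g eg] := RX j.+1.
    have <- : (emb SW (rev_p ^+ d) * quot_evx j.+1 f)`_j = R`_j.
      by rewrite eg coefD coefXnM ltnS leqnn addr0.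
    rewrite coefMr; apply: (subalg_sum algB) => k _.
    rewrite coef_emb mulr_algl; apply: (subalgZ algB).
    by rewrite coef_quot_evx.
  have := scal _ (invr_neq0 v0); rewrite invrK => sv.
  have nz : (v^-1 ^+ n.-1 ^+ d0) != 0 by rewrite !expf_neq0 // invr_neq0.
  have -> : (pencil_ev f).[v%:A] = (v^-1 ^+ n.-1 ^+ d0)^-1 *: R.[(v^-1)%:A].
    by rewrite sv scalerA mulVf // scale1r.
  by apply: (subalgZ algB); apply: coefs_in_horner.
have BR : coefs_in B R.
  apply: (interpolation char0) => // t t0; rewrite scal //.
  by apply: (subalgZ algB); apply: BE; apply: invr_neq0.
have [g eg] := RX j.+1.
have [u [v uv]] : exists u v : {poly K}, u * rev_p ^+ d + v * 'X^(j.+1) = 1.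
  by apply: poly_invXn; rewrite horner_exp expf_neq0 // rev_p0.
rewrite -(coef_quot_evx _ (ltnSn j)).
have <- : (emb SW u * R)`_j = (quot_evx j.+1 f)`_j.
  have -> : R = emb SW (rev_p ^+ d) * quot_evx j.+1 f - 'X^(j.+1) * g by rewrite eg addrK.
  have -> : emb SW u * (emb SW (rev_p ^+ d) * quot_evx j.+1 f - 'X^(j.+1) * g) =
      emb SW (u * rev_p ^+ d) * quot_evx j.+1 f - 'X^(j.+1) * (emb SW u * g).
    by rewrite (rmorphM (emb SW)) mulrBr -(mulrA (emb SW u)); congr (_ - _); apply: mulrCA.
  have -> : u * rev_p ^+ d = 1 - v * 'X^(j.+1) by rewrite -uv addrK.
  set G := emb SW u * g; set X := quot_evx j.+1 f.
  have -> : emb SW (1 - v * 'X^(j.+1)) * X - 'X^(j.+1) * G =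
      X + 'X^(j.+1) * (- (emb SW v * X) - G).
    rewrite rmorphB rmorph1 rmorphM rmorphXn /= embX.
    by move: (emb SW v) ('X^(j.+1) : {poly SW}) X G => V Xj X G; ring.
  by rewrite coefD coefXnM ltnS leqnn addr0.
exact: coefs_in_emb.
Qed.

End Pencil.

Section PencilCentres.
Variables (K : closedFieldType) (char0 : [pchar K] =i pred0).
Variables (q : vectType K) (br : lieBracket q) (n : nat) (p : {poly K}).
Hypothesis size_p : size p = n.+1.
Hypothesis n_ge2 : (2 <= n)%N.
Hypothesis p_monic : p \is monic.
Hypothesis p0_neq0 : p.[0] != 0.
Local Notation D := (\dim {:q}).
Local Notation e := (@basisv K q).
Local Notation SW := (sym K ('I_D * 'I_n)%type).
Local Notation Sq := (sym K 'I_D).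
Local Notation L := (structure_field br).
Local Notation const := (@polyC SW \o GRing.in_alg SW).
Local Notation pencil_gen := (@pencil_gen K q n p).
Local Notation pencil_ev := (@pencil_ev K q n p).

Let n_gt0 : (0 < n)%N := ltnW n_ge2.

Definition pencil (c : K) : {poly K} := p + c *: 'X.

Lemma size_cX c : (size (c *: 'X : {poly K})%R < size p)%N.
Proof.
by rewrite size_p ltnS; apply: leq_trans (size_scale_leq _ _) _; rewrite size_polyX.
Qed.

Lemma size_pencil c : size (pencil c) = n.+1.
Proof. by rewrite /pencil size_polyDl ?size_cX. Qed.

Lemma pencil_monic c : pencil c \is monic.
Proof. by rewrite monicE /pencil lead_coefDl ?size_cX //; rewrite -monicE. Qed.

(** From p to p + cX the generic element changes only by c x_i, as X has degree 1,
   which compensates for the change of x_i p. *)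
Lemma X_takiff_gen c i : 'X * takiff_gen n (pencil c) (e i) =
  pencil_gen i + emb SW (pencil c) * (gen K (i, Ordinal n_gt0))%:P.
Proof.
have T0 (p' : {poly K}) : size p' = n.+1 -> tmod n p' 0 (e i) = gen K (i, Ordinal n_gt0).
  by move=> sp'; rewrite (tmod_small sp' (e i) (Ordinal n_gt0)) tens_basis.
rewrite (pencil_genE size_p) (T0 _ size_p) mulrC [_ * _%:P]mulrC mul_polyC.
rewrite (takiff_gen_basis (size_pencil c)) (takiff_gen_basis size_p).
have dE (s : 'I_n) : emb SW (drop_poly s.+1 (pencil c)) =
    emb SW (drop_poly s.+1 p) + ((s == Ordinal n_gt0)%:R * c)%:A%:P.
  rewrite -embC -rmorphD; congr (emb SW _); apply/polyP => j.
  rewrite coefD coefC !coef_drop_poly coefD coefZ coefX addnS eqSS addn_eq0 -val_eqE /=.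
  by case: j => [|j]; rewrite ?mulr0 //= mulrC.
under eq_bigr => s _ do rewrite dE scalerDr.
rewrite big_split /= [X in _ + X](bigD1 (Ordinal n_gt0)) //= mul1r [X in _ + (_ + X)]big1 => [|s ne_s].
  rewrite addr0 /pencil rmorphD /= -!mul_polyC.
  rewrite rmorphM /= embC embX.
  move: (\sum_(s < n) _) ((gen _ _)%:P : {poly SW}) (emb SW p) (c%:A%:P : {poly SW}) => P G Q C.
  by ring.
by rewrite (negbTE ne_s) mul0r scale0r scaler0.
Qed.

Section Invariant.
Variable f : Sq.
Hypothesis finv : forall y, dext idfun (L y) f = 0.
Hypothesis hf : homogeneous f.

(** Choose c such that v is a root of p + cX; there X Phi and E have the same value,
   so that F(E)(v) is v^d times a value of F(Phi) at a root. *)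
Lemma value_in_Zpair (v : K) : v != 0 -> Zpair br p (p + 'X) (pencil_ev f).[v%:A].
Proof.
move=> v0; pose c := - p.[v] / v.
have pv : (pencil c).[v] = 0.
  by rewrite /pencil hornerD hornerZ hornerX /c -mulrA mulVf // mulr1 subrr.
have Zc := Zcentre_root (size_pencil c) finv pv.
have [d hd] := ev_homogeneous (GRing.in_alg SW : {rmorphism K -> SW}) hf.
have evalc (g : 'I_D -> {poly SW}) :
    (ev const g f).[v%:A] = ev (GRing.in_alg SW) (fun i => (g i).[v%:A]) f.
  have -> : (ev const g f).[v%:A] = horner_eval (v%:A : SW) (ev const g f) by [].
  rewrite (rmorph_ev const g (horner_eval (v%:A : SW))); apply: eq_ev => // k.
  by rewrite /= /horner_eval hornerC.
have -> : (pencil_ev f).[v%:A] = v ^+ d *: (takiff_ev n (pencil c) f).[v%:A].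
  have vd : (v ^+ d)%:A = v%:A ^+ d :> SW by exact: (rmorphXn (GRing.in_alg SW)).
  rewrite /pencil_ev /takiff_ev !evalc -[v ^+ d *: _]mulr_algl vd -hd.
  apply: eq_ev => // i; have := congr1 (fun g : {poly SW} => g.[v%:A]) (X_takiff_gen c i).
  by rewrite hornerM hornerX => ->; rewrite hornerD hornerM horner_emb pv scale0r mul0r addr0.
apply: (subalgZ (generated_is_subalgebra _)); apply: generated_sub.
(* The combination with the coefficient 1 - c is p + cX. *)
exists (1 - c); rewrite opprB addrCA subrr addr0 scalerDr addrA -scalerDl subrK scale1r.
exact: Zc.
Qed.

(** Modulo p_c, X^d F(Phi) is F(E) and X is invertible, as p_c(0) = p(0) is not 0. So
   the Newton coordinates of F(Phi) are linear combinations of coefficients of F(E),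
   with scalars in K. *)
Lemma newton_coordinate_in (B : SW -> Prop) c (a : nat -> K) j : is_subalgebra B ->
  pencil c = newtonK a n -> (j < n)%N ->
  (forall v : K, v != 0 -> B (pencil_ev f).[v%:A]) -> B (nc a j (takiff_ev n (pencil c) f)).
Proof.
move=> algB pa lt_jn BE.
have BEc : coefs_in B (pencil_ev f) by apply: (interpolation char0).
have [d hd] := ev_homogeneous const hf.
have [g eg] : exists g, 'X ^+ d * takiff_ev n (pencil c) f = pencil_ev f + emb SW (pencil c) * g.
  by rewrite /takiff_ev -hd; apply: ev_cong (X_takiff_gen c).
have [u [w uw]] : exists u w : {poly K}, u * pencil c + w * 'X^d = 1.
  by apply: poly_invXn; rewrite /pencil hornerD hornerZ hornerX mulr0 addr0.
have -> : takiff_ev n (pencil c) f = emb SW w * pencil_ev f +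
    newton a SW n * (emb SW u * takiff_ev n (pencil c) f + emb SW w * g).
  rewrite -emb_newtonK -pa.
  have -> : pencil_ev f = 'X^d * takiff_ev n (pencil c) f - emb SW (pencil c) * g by rewrite eg addrK.
  have := congr1 (emb SW) uw; rewrite rmorphD rmorph1 !rmorphM rmorphXn /= embX.
  move: (emb SW u) (emb SW w) (emb SW (pencil c)) ('X^d : {poly SW}) => U W P X e1.
  rewrite -[LHS]mul1r -e1; move: (takiff_ev n _ f) => h.
  by ring.
rewrite ncD (nc_newton_lt _ _ lt_jn) addr0.
by apply: (coefs_in_nc algB); apply: coefs_in_emb.
Qed.

End Invariant.

Lemma pencil_roots c : exists a : nat -> K, pencil c = newtonK a n.
Proof.
have [r er] := closed_field_poly_normal (pencil c).
move: er; rewrite (monicP (pencil_monic c)) scale1r => er.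
have sr : size r = n.
  by have := size_pencil c; rewrite er size_prod_XsubC => -[].
exists (fun j => r`_j); rewrite {1}er (big_nth 0) sr big_mkord.
by [].
Qed.

End PencilCentres.

Theorem theorem6p1 (K : closedFieldType) (q : vectType K) (br : lieBracket q)
    (n m : nat) (F : 'I_m -> sym K 'I_(\dim {:q})) (p : {poly K})
    (char0 : [pchar K] =i pred0)
    (nonabelian : exists x y : q, br x y != 0)
    (n_ge2 : (2 <= n)%N)
    (m_index : is_index br m)
    (F_homogeneous : forall i, homogeneous (F i))
    (F_independent : alg_independent F)
    (F_generate : forall H, lie_invariant br H <-> exists P, H = subst F P)
    (Omega_big : is_big (Omega F))
    (p_monic : p \is monic)
    (p_degree : size p = n.+1)
    (p0_neq0 : p.[0] != 0) :
  forall Y : sym K ('I_(\dim {:q}) * 'I_n)%type,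
    (exists2 Z, Zhat_pos br Z & Y = psi n p Z) <-> Zpair br p (p + 'X) Y.
Proof.
move=> Y.
have F_inv i y : dext idfun (structure_field br y) (F i) = 0.
  by move: y; apply/lie_invariantE/F_generate; exists (gen K i); rewrite subst_gen.
have L_index := index_rank m_index.
have F_reg := big_regular Omega_big nonabelian.
have F_big := big_point Omega_big.
have F_gen (H : sym K 'I_(\dim {:q})) :
    (forall y, dext idfun (structure_field br y) H = 0) -> exists P, H = subst F P.
  by move=> inv; apply/F_generate/lie_invariantE.
have n_gt0 := ltnW n_ge2.
have poles i B (algB : is_subalgebra B) :=
  pencil_values_coefficients char0 p_degree n_gt0 p_monic (F_homogeneous i) algB.
split=> [/psi_Zhat_pos[f inv ->]|ZY].
  have [N tN] := trunc_exists f.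
  have gf := newton_generated char0 F_inv L_index F_reg F_big F_gen F_independent tN inv.
  have algZ : is_subalgebra (@Zpair K q br n p (p + 'X)).
    exact: generated_is_subalgebra.
  have [Z1 ZL ZM] := algZ.
  apply: (gf (fun g => Zpair br p (p + 'X) (psi_incl n p g))).
    split=> [|k x y Zx Zy|x y Zx Zy]; first by rewrite rmorph1.
      by rewrite linearD linearZ; apply: ZL.
    by rewrite rmorphM; apply: ZM.
  move=> _ [i [j [_ ->]]]; apply: (poles i _ (generated_is_subalgebra _)).2 => v v0.
  exact: value_in_Zpair.
apply/psi_Zhat_pos.
pose B Y' := exists2 f, (forall y k, D_cur (fun=> 0) (structure_field br) y k f = 0) &
  Y' = psi_incl n p f.
have algB : is_subalgebra B.
  split=> [|k _ _ [x Dx ->] [y Dy ->]|_ _ [x Dx ->] [y Dy ->]].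
  - by exists 1; rewrite ?rmorph1 // => y k; rewrite -(scale1r 1) D_curC.
  - exists (k *: x + y); last by rewrite linearD linearZ.
    by move=> z l; rewrite linearD linearZ /= Dx Dy scaler0 addr0.
  - exists (x * y); last by rewrite rmorphM.
    by move=> z l; rewrite D_curM Dx Dy mul0r mulr0 addr0.
apply: (ZY B algB) => Y' [a Za].
(* The combination a p + (1 - a) (p + X) is the member p + (1 - a) X of the pencil. *)
pose c := 1 - a.
have pc : a *: p + (1 - a) *: (p + 'X) = pencil p c.
  by rewrite scalerDr addrA -scalerDl addrCA subrr addr0 scale1r.
rewrite {}pc in Za.
have [r pr] := pencil_roots p_degree n_ge2 p_monic c.
apply: (Zcentre_generated char0 (size_pencil p_degree n_ge2 c) pr F_inv L_index F_reg F_big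
  F_gen F_independent Za) => // _ [i [j [lt_jn ->]]].
apply: (newton_coordinate_in char0 p_degree n_ge2) => //.
apply: (poles i B algB).1 => l.
exists (newton_coef (fun=> 0) l (F i)) => // y k.
exact: D_cur_newton_coef.
Qed.
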